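(* Let $1<p<2$, let $q=\frac{p}{p-1}$, and let $\beta>0$ be such that $\beta q\le 1$. (1) If $f\in A^1_\beta(\mathbb{T})$ and $\dim(\mathcal{Z}(f))<\frac{2}{q}(1-\beta q)$, then $f$ is cyclic in $A^p_\beta(\mathbb{T})$. (2) If $f\in A^1_\beta(\mathbb{T})$ and $C_{1-\beta q}(\mathcal{Z}(f))>0$, then $f$ is not cyclic in $A^p_\beta(\mathbb{T})$. (3) For every $\alpha$ with $\frac{2}{q}(1-\beta q)<\alpha\le 1$, there exists a closed set $E\subset\mathbb{T}$ such that $\dim(E)=\alpha$ and every $f\in A^1_\beta(\mathbb{T})$ satisfying $\mathcal{Z}(f)=E$ is not cyclic in $A^p_\beta(\mathbb{T})$. (4) Let $k=[q/2]$ be the integer part of $q/2$. For all $\varepsilon>0$, there exists a closed set $E\subset\mathbb{T}$ such that $$\dim(E)\ge\max\left(\frac{2}{q}(1-\beta q)k-\varepsilon,\ 1-2(k+1)\beta\right)$$ and such that every $f\in A^1_\beta(\mathbb{T})$ satisfying $\mathcal{Z}(f)=E$ is cyclic in $A^p_\beta(\mathbb{T})$. Furthermore, if $p=\frac{2k}{2k-1}$ for some positive integer $k$, then $E$ can be chosen such that $\dim(E)=1-\beta q$.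
   Context: $\mathbb{T}=\mathbb{R}/2\pi\mathbb{Z}$. For a distribution $S$ on $\mathbb{T}$, $\widehat{S}(n)$, $n\in\mathbb{Z}$, denote its Fourier coefficients, so $S=\sum_n\widehat{S}(n)e_n$ with $e_n(t)=e^{int}$. For $1\le p<\infty$ and $\beta\in\mathbb{R}$, $A^p_\beta(\mathbb{T})$ is the Banach space of distributions $S$ on $\mathbb{T}$ with $\|S\|_{A^p_\beta(\mathbb{T})}^p=\sum_{n\in\mathbb{Z}}|\widehat{S}(n)|^p(1+|n|)^{p\beta}<\infty$. For $\beta\ge0$, $S\in A^p_\beta(\mathbb{T})$ is called cyclic in $A^p_\beta(\mathbb{T})$ if $\{PS : P\text{ a trigonometric polynomial}\}$ is dense in $A^p_\beta(\mathbb{T})$. Elements $f\in A^1_\beta(\mathbb{T})$, $\beta\ge0$, are continuous functions (and belong to $A^p_\beta(\mathbb{T})$), and $\mathcal{Z}(f)=\{t\in\mathbb{T}:f(t)=0\}$. $\dim$ is Hausdorff dimension. Capacity: for $\alpha\in[0,1)$ and a positive measure $\mu$ on $\mathbb{T}$, the $\alpha$-energy is $I_\alpha(\mu)=\sum_{n\ge1}\frac{|\widehat{\mu}(n)|^2}{(1+|n|)^{1-\alpha}}$; the $\alpha$-capacity of a Borel set $E\subset\mathbb{T}$ is $C_\alpha(E)=1/\inf\{I_\alpha(\mu)\}$, the infimum being over all probability measures $\mu$ on $\mathbb{T}$ supported on a compact subset of $E$ (with $\inf\emptyset=\infty$, $1/\infty=0$, $1/0=\infty$). *)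

(* Defs.v *)
From mathcomp Require Import all_boot all_order all_algebra complex.
From mathcomp Require Import all_classical all_reals all_analysis.

Set Implicit Arguments.
Unset Strict Implicit.
Unset Printing Implicit Defensive.

Import Order.TTheory GRing.Theory Num.Theory numFieldNormedType.Exports.

Local Open Scope classical_set_scope.
Local Open Scope ring_scope.
Local Open Scope complex_scope.

(* Functions on T = R/2piZ are 2pi-periodic functions on R, subsets of T are
   2pi-periodic subsets of R, and closed (equivalently, compact) subsets of T
   are 2pi-periodic closed subsets of R. *)

Section Torus.
Variable R : realType.
Implicit Types (E K : set R) (f phi P : R -> R[i]) (S : (R -> R[i]) -> R[i]).

Definition cmod (z : R[i]) : R := ComplexField.Normc.normc z.

Definition periodic_fun f := forall t, f (t + 2 * pi) = f t.

Definition periodic_set E := forall t, E (t + 2 * pi) <-> E t.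

Definition closed_torus E := periodic_set E /\ closed E.

Definition re f : R -> R := fun t => complex.Re (f t).
Definition im f : R -> R := fun t => complex.Im (f t).

Definition continuousT f :=
  [/\ periodic_fun f, continuous (re f) & continuous (im f)].

Definition zeros f : set R := [set t | f t = 0].

Definition expi (n : int) : R -> R[i] :=
  fun t => cos (n%:~R * t) +i* sin (n%:~R * t).

Definition trig_poly P :=
  exists (s : seq int) (a : int -> R[i]),
    forall t, P t = \sum_(n <- s) a n * expi n t.

Definition cintegral (mu : {measure set (measurableTypeR R) -> \bar R}) (D : set R) f
    : R[i] :=
  Rintegral mu D (re f) +i* Rintegral mu D (im f).

(* Distributions on T: continuous linear functionals on the space of smooth
   functions T -> C.  They are represented by total functionals, of which only
   the values at test functions matter. *)

Definition test_fun phi :=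
  periodic_fun phi /\
  forall (n : nat) (t : R),
    derivable (derive1n n (re phi)) t 1 /\ derivable (derive1n n (im phi)) t 1.

Definition cderiven (n : nat) phi : R -> R[i] :=
  fun t => derive1n n (re phi) t +i* derive1n n (im phi) t.

Definition is_distribution S :=
  (forall (a : R[i]) phi psi, test_fun phi -> test_fun psi ->
     S (fun t => a * phi t + psi t) = a * S phi + S psi) /\
  (exists (N : nat) (C : R), forall phi (M : R), test_fun phi ->
     (forall k t, (k <= N)%N -> cmod (cderiven k phi t) <= M) ->
     cmod (S phi) <= C * M).

Definition distr_of_fun f : (R -> R[i]) -> R[i] :=
  fun phi => ((2 * pi)^-1)%:C *
    cintegral lebesgue_measure `[0, 2 * pi] (fun t => f t * phi t).

Definition distr_mul P S : (R -> R[i]) -> R[i] :=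
  fun phi => S (fun t => P t * phi t).

Definition fourier S (n : int) : R[i] := S (expi (- n)).

Definition Anorm (p beta : R) S : \bar R :=
  ((\esum_(n in [set: int])
      ((cmod (fourier S n)) `^ p * (1 + (`|n|%N)%:R) `^ (p * beta))%:E)
   `^ p^-1)%E.

Definition in_A (p beta : R) S := is_distribution S /\ (Anorm p beta S < +oo)%E.

(* f is the continuous representative of an element of A^p_beta *)
Definition fun_in_A (p beta : R) f :=
  continuousT f /\ in_A p beta (distr_of_fun f).

(* density of {P S : P trigonometric polynomial} in A^p_beta, for S in A^p_beta *)
Definition cyclic (p beta : R) S :=
  forall U, in_A p beta U -> forall eps : R, 0 < eps ->
  exists P, trig_poly P /\
    (Anorm p beta (fun phi => (U phi - distr_mul P S phi)%R) < eps%:E)%E.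

(* maxe 0 because ereal_sup set0 = -oo *)
Definition diam (A : set R) : \bar R :=
  maxe 0%E (ereal_sup [set r | exists x y, [/\ A x, A y & r = `|x - y|%:E]]).

Definition hausdorff_premeasure (s delta : R) (A : set R) : \bar R :=
  ereal_inf [set v | exists U : nat -> set R,
    [/\ A `<=` \bigcup_i U i,
        forall i, (diam (U i) <= delta%:E)%E
      & v = (\sum_(0 <= i <oo) (diam (U i)) `^ s)%E]].

Definition hausdorff_measure (s : R) (A : set R) : \bar R :=
  ereal_sup [set hausdorff_premeasure s delta A | delta in [set d | 0 < d]].

Definition hausdorff_dim (A : set R) : \bar R :=
  ereal_inf [set s%:E | s in [set s | 0 < s /\ hausdorff_measure s A = 0%E]].

(* Hausdorff dimension of a subset of T, computed on a fundamental domain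
   (the projection R -> T is a local isometry). *)
Definition dimT E : \bar R := hausdorff_dim (E `&` `[0, 2 * pi[).

(* A probability measure on T is a Borel probability measure on R carried by
   the fundamental domain [0, 2pi[. *)

Definition measure_fourier (mu : probability (measurableTypeR R) R) (n : int)
    : R[i] :=
  cintegral mu setT (expi (- n)).

Definition energy (alpha : R) (mu : probability (measurableTypeR R) R)
    : \bar R :=
  (\sum_(1 <= n <oo)
     ((cmod (measure_fourier mu n%:Z)) ^+ 2 / (1 + n%:R) `^ (1 - alpha))%:E)%E.

(* mu is a probability measure on T supported on a compact subset of E *)
Definition supported_in (mu : probability (measurableTypeR R) R) E :=
  exists K, [/\ closed_torus K, K `<=` E & mu (K `&` `[0, 2 * pi[) = 1%E].

(* The inverse in \bar R satisfies 0^-1 = +oo and +oo^-1 = 0, and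
   ereal_inf set0 = +oo. *)
Definition capacity (alpha : R) E : \bar R :=
  ((ereal_inf [set energy alpha mu | mu in
      [set mu : probability (measurableTypeR R) R | supported_in mu E]])^-1)%E.

End Torus.

(* Main.v *)
(* Write q for the conjugate exponent and w n = 1 + |n|.

   Cyclicity. If f is not cyclic, Hahn-Banach gives a sequence s in the weighted l^q space
   dual to A^p_b, which kills all the products h f with h in A^1_b.  By Wiener's lemma, so
   does every g in A^1_b vanishing near the zero set E.  Convolving, the powers s^k, which
   are the Fourier coefficients of distributions, kill the functions vanishing near the
   k-fold sum of E.  If s^k lies in a weighted l^2 space and the k-fold sum of E has
   cutoffs of small norm in the dual weighted l^2 space (which is the case when its
   Hausdorff content of order 1 - 2c vanishes), then s^k = 0.  The case k = 1 is (1); for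
   (4) one uses Cantor sets whose k-fold sums are as small as the set itself.

   Noncyclicity. A probability measure on E (or densities shrinking to E) with Fourier
   coefficients bounded in the dual space separates 1 from the products P f.  For (2) the
   measure is one of finite energy; for (3) the set is Kaufman's set of points well
   approximated by rationals, whose measure has coefficients O(n^-a) for all a < dim E / 2. *)
Require Import Defs.
From mathcomp Require Import all_boot all_order all_algebra complex.
From mathcomp Require Import all_classical all_reals all_analysis.
From mathcomp Require Import measurable_realfun zify ring lra.
Import Order.TTheory GRing.Theory Num.Theory numFieldNormedType.Exports.
Set Implicit Arguments.
Unset Strict Implicit.
Unset Printing Implicit Defensive.
Local Open Scope classical_set_scope.
Local Open Scope ring_scope.
Local Open Scope complex_scope.

(** Both directions meet at one threshold. By Hölder, a sequence of the dual of A^p_b lies in the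
    l^2 space of weight w^(-2c) as soon as 1 - 2c < (2/q)(1 - b q), and sets of dimension below 1 -
    2c are negligible for that space. Conversely, coefficients O(n^-a) lie in the dual when q (a +
    b) > 1, that is when 2a > (2/q)(1 - b q), and 2a may approach the dimension of Kaufman's set.
    Passing to s^k multiplies the first threshold by k as long as 2k < q, at the price that s^k
    pairs only with functions of A^1_(kb). For q = 2k nothing is lost to Hölder, hence the exact
    dimension 1 - b q; for q < 2(k + 1) the power k + 1 needs only the boundedness of s n * w n ^ (-
    b), hence 1 - 2(k + 1) b. Cutoffs, tents and densities are all Lipschitz, and Lipschitz
    functions lie in A^1_s for s < 1/2; this suffices since q > 2 and b q <= 1 give b < 1/2.
    Kaufman's measure is never formed: the densities leading to it act as functionals with uniform
    bounds, so no weak limit is taken. *)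

#[global] Arguments cmod : simpl never.

(** * Complex moduli, exponentials and continuous functions on the circle *)

Section Basics.
Variable R : realType.
Implicit Types (f g : R -> R[i]) (u v : R -> R) (z : R[i]) (n m : int).

Lemma cmodE z : cmod z = Num.sqrt (complex.Re z ^+ 2 + complex.Im z ^+ 2).
Proof. by case: z. Qed.

Lemma cmod_sqr z : cmod z ^+ 2 = complex.Re z ^+ 2 + complex.Im z ^+ 2.
Proof. by rewrite cmodE sqr_sqrtr // addr_ge0 // sqr_ge0. Qed.

Lemma cmod_ge0 z : 0 <= cmod z.
Proof. by rewrite cmodE sqrtr_ge0. Qed.

Lemma cmod0 : cmod (0 : R[i]) = 0. Proof. exact: ComplexField.Normc.normc0. Qed.
Lemma cmod1 : cmod (1 : R[i]) = 1. Proof. exact: ComplexField.Normc.normc1. Qed.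
Lemma cmodM z1 z2 : cmod (z1 * z2) = cmod z1 * cmod z2.
Proof. exact: ComplexField.Normc.normcM. Qed.
Lemma cmodN z : cmod (- z) = cmod z. Proof. exact: normcN. Qed.
Lemma cmodD z1 z2 : cmod (z1 + z2) <= cmod z1 + cmod z2.
Proof. exact: le_normcD. Qed.
Lemma cmodV z : cmod z^-1 = (cmod z)^-1.
Proof. exact: ComplexField.Normc.normcV. Qed.
Lemma cmodBC z1 z2 : cmod (z1 - z2) = cmod (z2 - z1).
Proof. by rewrite -cmodN opprB. Qed.
Lemma cmodB z1 z2 : cmod (z1 - z2) <= cmod z1 + cmod z2.
Proof. by rewrite (le_trans (cmodD _ _))// cmodN. Qed.
Lemma cmodX z k : cmod (z ^+ k) = cmod z ^+ k.
Proof. by elim: k => [|k IH]; rewrite ?expr0 ?cmod1// !exprS cmodM IH. Qed.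
Lemma cmod_eq0 z : cmod z = 0 -> z = 0.
Proof. exact: ComplexField.Normc.eq0_normc. Qed.
Lemma cmod_real (x : R) : cmod x%:C = `|x|.
Proof. by rewrite cmodE /= expr0n addr0 sqrtr_sqr. Qed.
Lemma cmodJ z : cmod (conjc z) = cmod z.
Proof. by rewrite !cmodE; case: z => a b /=; rewrite sqrrN. Qed.
Lemma cmod_sum (I : Type) (s : seq I) (P : pred I) (F : I -> R[i]) :
  cmod (\sum_(i <- s | P i) F i) <= \sum_(i <- s | P i) cmod (F i).
Proof.
elim/big_ind2 : _ => //; first by rewrite cmod0.
by move=> x1 x2 y1 y2 h1 h2; rewrite (le_trans (cmodD _ _))// lerD.
Qed.
Lemma cmod_dist z1 z2 : cmod z1 - cmod z2 <= cmod (z1 - z2).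
Proof. by rewrite lerBlDr (le_trans _ (cmodD _ _))// subrK. Qed.

Lemma Re_le_cmod z : `|complex.Re z| <= cmod z.
Proof. by rewrite cmodE -sqrtr_sqr ler_wsqrtr// lerDl sqr_ge0. Qed.
Lemma Im_le_cmod z : `|complex.Im z| <= cmod z.
Proof. by rewrite cmodE -[`|_|]sqrtr_sqr ler_wsqrtr// lerDr sqr_ge0. Qed.
Lemma cmod_le_ReIm z : cmod z <= `|complex.Re z| + `|complex.Im z|.
Proof.
rewrite -(@ler_pXn2r _ 2)// ?nnegrE ?cmod_ge0 ?addr_ge0//.
rewrite cmod_sqr sqrrD !real_normK ?num_real// lerD2r lerDl.
by rewrite mulrn_wge0// mulr_ge0.
Qed.

Lemma ReD z1 z2 : complex.Re (z1 + z2) = complex.Re z1 + complex.Re z2.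
Proof. by case: z1; case: z2. Qed.
Lemma ImD z1 z2 : complex.Im (z1 + z2) = complex.Im z1 + complex.Im z2.
Proof. by case: z1; case: z2. Qed.
Lemma ReM z1 z2 : complex.Re (z1 * z2) =
  complex.Re z1 * complex.Re z2 - complex.Im z1 * complex.Im z2.
Proof. by case: z1; case: z2. Qed.
Lemma ImM z1 z2 : complex.Im (z1 * z2) =
  complex.Re z1 * complex.Im z2 + complex.Im z1 * complex.Re z2.
Proof. by case: z1; case: z2. Qed.
Lemma mulcJ_cmod z : z * (conjc z) = (cmod z ^+ 2)%:C.
Proof.
rewrite cmod_sqr; case: z => a b.
by apply/eqP; rewrite eq_complex /=; apply/andP; split; apply/eqP; ring.
Qed.

Lemma cjM z1 z2 : conjc (z1 * z2) = conjc z1 * conjc z2.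
Proof. exact: rmorphM. Qed.
Lemma cjB z1 z2 : conjc (z1 - z2) = conjc z1 - conjc z2.
Proof. exact: raddfB. Qed.
Lemma cj_sum (I : Type) (s : seq I) (F : I -> R[i]) :
  conjc (\sum_(i <- s) F i) = \sum_(i <- s) conjc (F i).
Proof. exact: raddf_sum. Qed.

Lemma cmod_expi n t : cmod (@expi R n t) = 1.
Proof. by rewrite cmodE /= cos2Dsin2 sqrtr1. Qed.
Lemma expiD n m t : @expi R (n + m) t = expi n t * expi m t.
Proof. by rewrite /expi intrD mulrDl cosD sinD; simpc; rewrite [X in _ +i* X]addrC. Qed.
Lemma expiDt n s t : @expi R n (s + t) = expi n s * expi n t.
Proof. by rewrite /expi mulrDr cosD sinD; simpc; rewrite [X in _ +i* X]addrC. Qed.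
Lemma expi0 t : @expi R 0 t = 1.
Proof. by rewrite /expi mul0r cos0 sin0. Qed.
Lemma expiJ n t : (conjc (@expi R n t)) = expi (- n) t.
Proof. by rewrite /expi /= intrN mulNr cosN sinN. Qed.
Lemma expiNK n t : @expi R n t * expi (- n) t = 1.
Proof. by rewrite -expiD subrr expi0. Qed.
Lemma expi_period n : periodic_fun (@expi R n).
Proof.
move=> t; rewrite expiDt; suff -> : @expi R n (2 * pi) = 1 by rewrite mulr1.
have H (k : nat) : @expi R k (2 * pi) = 1.
  elim: k => [|k IH]; first exact: expi0.
  by rewrite -addn1 PoszD expiD IH mul1r /expi mul1r mulr_natl cos2pi sin2pi.
case: n => k; first exact: H.
by rewrite NegzE -expiJ H conjc1.
Qed.

Definition cont f := continuous (re f) /\ continuous (im f).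
Definition contp f := periodic_fun f /\ cont f.

Lemma contpT f : contp f <-> continuousT f.
Proof. by split=> [[? []]|[? ? ?]]. Qed.

Lemma contD f g : cont f -> cont g -> cont (fun t => f t + g t).
Proof.
move=> [f1 f2] [g1 g2]; split.
  have -> : re (fun t => f t + g t) = fun t => re f t + re g t.
    by apply/funext => t; rewrite /re ReD.
  by move=> t; apply: cvgD; [exact: f1|exact: g1].
have -> : im (fun t => f t + g t) = fun t => im f t + im g t.
  by apply/funext => t; rewrite /im ImD.
by move=> t; apply: cvgD; [exact: f2|exact: g2].
Qed.
Lemma contM f g : cont f -> cont g -> cont (fun t => f t * g t).
Proof.
move=> [f1 f2] [g1 g2]; split.
  have -> : re (fun t => f t * g t) = fun t => re f t * re g t - im f t * im g t.
    by apply/funext => t; rewrite /re ReM.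
  by move=> t; apply: cvgB; apply: cvgM; [exact: f1|exact: g1|exact: f2|exact: g2].
have -> : im (fun t => f t * g t) = fun t => re f t * im g t + im f t * re g t.
  by apply/funext => t; rewrite /im ImM.
by move=> t; apply: cvgD; apply: cvgM; [exact: f1|exact: g2|exact: f2|exact: g1].
Qed.
Lemma cont_real u : continuous u -> cont (fun t => (u t)%:C).
Proof. by move=> cu; split=> //=; rewrite /im/=; exact: cst_continuous. Qed.
Lemma cont_cst z : cont (fun=> z).
Proof. by split; exact: cst_continuous. Qed.
Lemma contJ f : cont f -> cont (fun t => (conjc (f t))).
Proof.
move=> [f1 f2]; split.
  suff -> : re (fun t => (conjc (f t))) = re f by [].
  by apply/funext => t; rewrite /re; case: (f t).
have -> : im (fun t => (conjc (f t))) = fun t => - im f t.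
  by apply/funext => t; rewrite /im; case: (f t).
by move=> t; apply: cvgN; exact: f2.
Qed.
Lemma cont_expi n : cont (expi n).
Proof.
split; rewrite /re /im /=.
  move=> t; apply: (@continuous_comp _ _ _ (fun t : R => n%:~R * t) cos).
    by apply: cvgM; [exact: cvg_cst|exact: cvg_id].
  exact: continuous_cos.
move=> t; apply: (@continuous_comp _ _ _ (fun t : R => n%:~R * t) sin).
  by apply: cvgM; [exact: cvg_cst|exact: cvg_id].
exact: continuous_sin.
Qed.
Lemma cont_sum (I : Type) (s : seq I) (F : I -> R -> R[i]) :
  (forall i, cont (F i)) -> cont (fun t => \sum_(i <- s) F i t).
Proof.
move=> cF; elim: s => [|i s IH].
  by under eq_fun do rewrite big_nil; exact: cont_cst.
by under eq_fun do rewrite big_cons; exact: contD.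
Qed.
Lemma cont_shift f (h : R) : cont f -> cont (fun t => f (t + h)).
Proof.
have cs : continuous (fun t : R => t + h).
  by move=> t; apply: cvgD; [exact: cvg_id|exact: cvg_cst].
move=> [f1 f2]; split => t.
  by apply: (@continuous_comp _ _ _ (fun t => t + h) (re f)); [exact: cs|exact: f1].
by apply: (@continuous_comp _ _ _ (fun t => t + h) (im f)); [exact: cs|exact: f2].
Qed.
Lemma cont_cmod f : cont f -> continuous (fun t => cmod (f t)).
Proof.
move=> [f1 f2]; under eq_fun do rewrite cmodE.
move=> t; apply: (@continuous_comp _ _ _ (fun t => re f t ^+ 2 + im f t ^+ 2) Num.sqrt); last first.
  exact: sqrt_continuous.
by apply: cvgD; under eq_fun do rewrite expr2; apply: cvgM; try exact: f1; exact: f2.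
Qed.
Lemma cont_inv f : cont f -> (forall t, f t != 0) -> cont (fun t => (f t)^-1).
Proof.
move=> cf f0.
have -> : (fun t => (f t)^-1) = fun t => (conjc (f t)) * ((cmod (f t) ^+ 2)^-1)%:C.
  apply/funext => t; apply: (mulfI (f0 t)); rewrite mulfV// mulrA mulcJ_cmod.
  rewrite -rmorphM /= mulfV// expf_eq0 /=; apply/negP => /eqP /cmod_eq0/eqP.
  by rewrite (negbTE (f0 t)).
apply: contM; first exact: contJ.
apply: cont_real => t; apply: cvgV.
  rewrite expf_eq0 /=; apply/negP => /eqP /cmod_eq0/eqP.
  by rewrite (negbTE (f0 t)).
by under eq_fun do rewrite expr2; apply: cvgM; exact: cont_cmod.
Qed.

Lemma contpD f g : contp f -> contp g -> contp (fun t => f t + g t).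
Proof. by move=> [p1 c1] [p2 c2]; split; [move=> t; rewrite p1 p2|exact: contD]. Qed.
Lemma contpM f g : contp f -> contp g -> contp (fun t => f t * g t).
Proof. by move=> [p1 c1] [p2 c2]; split; [move=> t; rewrite p1 p2|exact: contM]. Qed.
Lemma contp_cst z : contp (fun=> z).
Proof. by split=> //; exact: cont_cst. Qed.
Lemma contpN f : contp f -> contp (fun t => - f t).
Proof.
by move=> cf; under eq_fun do rewrite -mulN1r; apply: contpM => //; exact: contp_cst.
Qed.
Lemma contpB f g : contp f -> contp g -> contp (fun t => f t - g t).
Proof. by move=> cf cg; apply: contpD => //; exact: contpN. Qed.
Lemma contp_expi n : contp (expi n).
Proof. by split; [exact: expi_period|exact: cont_expi]. Qed.
Lemma contp_sum (I : Type) (s : seq I) (F : I -> R -> R[i]) :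
  (forall i, contp (F i)) -> contp (fun t => \sum_(i <- s) F i t).
Proof.
move=> cF; split; last by apply: cont_sum => i; case: (cF i).
by move=> t; apply: eq_bigr => i _; case: (cF i) => ->.
Qed.
Lemma contpJ f : contp f -> contp (fun t => (conjc (f t))).
Proof. by move=> [p c]; split; [move=> t; rewrite p|exact: contJ]. Qed.
Lemma contp_shift f (h : R) : contp f -> contp (fun t => f (t + h)).
Proof. by move=> [p c]; split; [move=> t; rewrite addrAC p|exact: cont_shift]. Qed.
Lemma contp_inv f : contp f -> (forall t, f t != 0) -> contp (fun t => (f t)^-1).
Proof. by move=> [p c] f0; split; [move=> t; rewrite p|exact: cont_inv]. Qed.
Lemma contpX f k : contp f -> contp (fun t => f t ^+ k).
Proof.
move=> cf; elim: k => [|k IH].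
  by under eq_fun do rewrite expr0; exact: contp_cst.
by under eq_fun do rewrite exprS; exact: contpM.
Qed.

End Basics.

(** * Fourier coefficients *)

Section Mean.
Variable R : realType.
Implicit Types (f g : R -> R[i]) (u v : R -> R) (z : R[i]) (n m : int).
Notation mu := (@lebesgue_measure R).

Definition mean u : R := (2 * pi)^-1 * Rintegral mu `[0, 2 * pi] u.

Lemma twopi_gt0 : 0 < 2 * pi :> R.
Proof. by rewrite mulr_gt0 // pi_gt0. Qed.

Lemma itwopi_ge0 : 0 <= (2 * pi)^-1 :> R.
Proof. by rewrite invr_ge0 ltW// twopi_gt0. Qed.

Lemma intg u (a b : R) : continuous u -> mu.-integrable `[a, b] (EFin \o u).
Proof.
move=> cu; apply: continuous_compact_integrable; first exact: segment_compact.
exact: continuous_subspaceT.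
Qed.

Lemma mean_Z u (c : R) : continuous u -> mean (fun t => c * u t) = c * mean u.
Proof.
by move=> cu; rewrite /mean RintegralZl; [rewrite mulrCA|exact: measurable_itv|exact: intg].
Qed.
Lemma mean_D u v : continuous u -> continuous v ->
  mean (fun t => u t + v t) = mean u + mean v.
Proof. by move=> cu cv; rewrite /mean RintegralD ?mulrDr//; exact: intg. Qed.
Lemma mean_B u v : continuous u -> continuous v ->
  mean (fun t => u t - v t) = mean u - mean v.
Proof. by move=> cu cv; rewrite /mean RintegralB ?mulrBr//; exact: intg. Qed.
Lemma mean_cst (c : R) : mean (fun=> c) = c.
Proof.
rewrite /mean Rintegral_cst//= lebesgue_measure_itv/= lte_fin twopi_gt0/=.
by rewrite subr0 mulrCA mulVf ?mulr1// gt_eqF// twopi_gt0.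
Qed.
Lemma mean_ge0 u : (forall t, 0 <= u t) -> 0 <= mean u.
Proof.
move=> u0; rewrite mulr_ge0 ?itwopi_ge0//.
exact: Rintegral_ge0.
Qed.
Lemma mean_le u v : continuous u -> continuous v -> (forall t, 0 <= t <= 2 * pi -> u t <= v t) ->
  mean u <= mean v.
Proof.
move=> cu cv uv; rewrite ler_wpM2l// ?itwopi_ge0//.
apply: le_Rintegral; [exact: measurable_itv|exact: intg|exact: intg|].
by move=> x /=; rewrite in_itv /= => /uv.
Qed.
Lemma mean_norm u : continuous u -> `|mean u| <= mean (fun t => `|u t|).
Proof.
move=> cu; rewrite normrM ger0_norm ?itwopi_ge0//.
rewrite ler_wpM2l ?itwopi_ge0//.
by apply: le_normr_Rintegral => //; exact: intg.
Qed.

Lemma integral_shift u (a b h : R) : a <= b -> continuous u ->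
  Rintegral mu `[a + h, b + h] u = Rintegral mu `[a, b] (fun t => u (t + h)).
Proof.
move=> ab cu; rewrite /Rintegral; congr fine.
have d1 (x : R) : is_derive x 1 (fun t : R => t + h) 1.
  by apply: is_derive_eq; rewrite ?addr0.
have D : (fun t : R => t + h)^`()%classic = fun=> 1.
  by apply/funext => x; rewrite derive1E derive_val.
have cF : continuous (fun t : R => t + h).
  by move=> t; apply: cvgD; [exact: cvg_id|exact: cvg_cst].
rewrite (@integration_by_substitution_increasing R (fun t => t + h) u a b ab).
- by apply: eq_integral => x _; rewrite D fctE mulr1.
- by move=> x y _ _; rewrite ltrD2r.
- by rewrite D => x _; exact: cvg_cst.
- by rewrite D; exact: is_cvg_cst.
- by rewrite D; exact: is_cvg_cst.
- split; last 2 first.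
  + by apply: cvg_at_right_filter; exact: cF.
  + by apply: cvg_at_left_filter; exact: cF.
  + by move=> x _; exact: ex_derive.
- exact: continuous_subspaceT.
Qed.

Lemma mod2pi (x a : R) : exists n : int, a <= x + 2 * pi * n%:~R < a + 2 * pi.
Proof.
exists (- Num.floor ((x - a) / (2 * pi))).
have p0 := twopi_gt0; set y := (x - a) / (2 * pi).
have xE : x = a + y * (2 * pi) by rewrite /y divfK ?gt_eqF//; lra.
have h1 : (Num.floor y)%:~R <= y := floor_le _.
have h2 : y < (Num.floor y)%:~R + 1 by rewrite -intrD1 floorD1_gt.
rewrite xE intrN; nra.
Qed.

Lemma periodic_int (T : Type) (u : R -> T) : (forall t, u (t + 2 * pi) = u t) ->
  forall t n, u (t + 2 * pi * n%:~R) = u t.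
Proof.
move=> pu; have H t (k : nat) : u (t + 2 * pi * k%:R) = u t.
  elim: k => [|k IH]; first by rewrite mulr0 addr0.
  by rewrite -natr1 (_ : t + _ = t + 2 * pi * k%:R + 2 * pi) ?pu//; ring.
move=> t [k|k]; first exact: H.
by rewrite NegzE intrN mulrN -[LHS](H _ k.+1) subrK.
Qed.

Lemma integral_split u (a b c : R) : continuous u -> a <= b -> b <= c ->
  Rintegral mu `[a, c] u = Rintegral mu `[a, b] u + Rintegral mu `[b, c] u.
Proof.
move=> cu ab bc; rewrite -[X in _ + X]Rintegral_itv_obnd_cbnd; last first.
  by apply: integrableS (@intg u b c cu); [exact: measurable_itv|exact: measurable_itv|exact: subset_itv_oc_cc].
rewrite -(@Rintegral_itvB _ _ _ _ b (@intg u a c cu))// ?bnd_simp//.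
by rewrite addrCA subrr addr0.
Qed.

Lemma integral_le_cst u (a b M : R) : continuous u -> a <= b ->
  (forall t, a <= t <= b -> u t <= M) -> Rintegral mu `[a, b] u <= M * (b - a).
Proof.
move=> cu ab uM; have -> : M * (b - a) = Rintegral mu `[a, b] (fun=> M).
  rewrite Rintegral_cst//= lebesgue_measure_itv /= lte_fin.
  by move: ab; rewrite le_eqVlt => /predU1P[->|->]; rewrite ?ltxx ?subrr.
apply: le_Rintegral; [exact: measurable_itv|exact: intg|apply: intg; exact: cst_continuous|].
by move=> x /=; rewrite in_itv /= => /uM.
Qed.

Lemma mean_shift u (h : R) : continuous u -> (forall t, u (t + 2 * pi) = u t) ->
  mean (fun t => u (t + h)) = mean u.
Proof.
move=> cu pu; wlog h0 : h / 0 <= h < 2 * pi.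
  have [n hn] := mod2pi h 0; move=> /(_ (h + 2 * pi * n%:~R)).
  rewrite add0r in hn => /(_ hn) <-; congr mean; apply/funext => t.
  by rewrite addrA periodic_int.
have /andP[hge hlt] := h0; have p0 := twopi_gt0.
rewrite /mean; congr (_ * _).
rewrite -integral_shift ?(ltW p0)// add0r.
rewrite (@integral_split u h (2 * pi) (2 * pi + h)) ?(ltW hlt)//; last by lra.
rewrite (@integral_split u 0 h (2 * pi)) ?(ltW hlt)// addrC; congr (_ + _).
rewrite -{1}[2 * pi]add0r [2 * pi + h]addrC integral_shift//.
by congr Rintegral; apply/funext => t; rewrite pu.
Qed.

(* The normalised integral over the torus, so that the Fourier coefficients
   of f are I (f * e_(-n)). *)
Definition tint f : R[i] := mean (re f) +i* mean (im f).

Arguments tint : simpl never.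

Lemma tintE f : ((2 * pi)^-1)%:C * cintegral mu `[0, 2 * pi] f = tint f.
Proof. by rewrite /cintegral /tint /mean; simpc. Qed.

Lemma tintD f g : cont f -> cont g -> tint (fun t => f t + g t) = tint f + tint g.
Proof.
move=> [f1 f2] [g1 g2]; rewrite /tint -[RHS]/(_ +i* _) -!mean_D//.
by congr (_ +i* _); congr mean; apply/funext => t; rewrite /re /im ?ReD ?ImD.
Qed.
Lemma tintZ f z : cont f -> tint (fun t => z * f t) = z * tint f.
Proof.
have cZ (c : R) u : continuous u -> continuous (fun t => c * u t).
  by move=> cu t; apply: cvgM; [exact: cvg_cst|exact: cu].
move=> [f1 f2]; case: z => a b; rewrite /tint -[RHS]/(_ +i* _) -!mean_Z//.
rewrite -mean_B; [|exact: cZ..]; rewrite -mean_D; [|exact: cZ..].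
by congr (_ +i* _); congr mean; apply/funext => t; rewrite /re /im ?ReM ?ImM.
Qed.
Lemma tintN f : cont f -> tint (fun t => - f t) = - tint f.
Proof. by move=> cf; under eq_fun do rewrite -mulN1r; rewrite tintZ// mulN1r. Qed.
Lemma contN f : cont f -> cont (fun t => - f t).
Proof. by move=> cf; under eq_fun do rewrite -mulN1r; apply: contM => //; exact: cont_cst. Qed.
Lemma tintB f g : cont f -> cont g -> tint (fun t => f t - g t) = tint f - tint g.
Proof. by move=> cf cg; rewrite tintD ?tintN//; exact: contN. Qed.
Lemma tint_cst z : tint (fun=> z) = z.
Proof. by rewrite /tint !mean_cst; case: z. Qed.
Lemma tint0 : tint (fun=> 0) = 0. Proof. exact: tint_cst. Qed.
Lemma tint_sum (I : Type) (s : seq I) (F : I -> R -> R[i]) :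
  (forall i, cont (F i)) -> tint (fun t => \sum_(i <- s) F i t) = \sum_(i <- s) tint (F i).
Proof.
move=> cF; elim: s => [|i s IH].
  by under eq_fun do rewrite big_nil; rewrite big_nil tint0.
by under eq_fun do rewrite big_cons; rewrite big_cons tintD ?IH//; exact: cont_sum.
Qed.
Lemma tintJ f : cont f -> tint (fun t => (conjc (f t))) = (conjc (tint f)).
Proof.
move=> [f1 f2]; rewrite /tint -[RHS]/(_ +i* _).
have -> : re (fun t => (conjc (f t))) = re f by apply/funext => t; rewrite /re; case: (f t).
have -> : im (fun t => (conjc (f t))) = fun t => (-1) * im f t.
  by apply/funext => t; rewrite /im mulN1r; case: (f t).
by rewrite mean_Z// mulN1r.
Qed.
Lemma tint_shift f h : contp f -> tint (fun t => f (t + h)) = tint f.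
Proof.
move=> [pf [f1 f2]]; rewrite /tint; congr (_ +i* _).
  by rewrite -(@mean_shift (re f) h)// => t; rewrite /re pf.
by rewrite -(@mean_shift (im f) h)// => t; rewrite /im pf.
Qed.
Lemma tint_real u : tint (fun t => (u t)%:C) = (mean u)%:C.
Proof. by rewrite /tint /im /= mean_cst. Qed.

(** Real and imaginary parts are bounded separately, whence the factor 2, which is harmless in all
    uses. *)
Lemma cmod_tint f : cont f -> cmod (tint f) <= 2 * mean (fun t => cmod (f t)).
Proof.
move=> cf; have [f1 f2] := cf; rewrite (le_trans (cmod_le_ReIm _))//= mulr_natl mulr2n.
have nc u : continuous u -> continuous (fun t => `|u t|).
  by move=> cu t; apply: cvg_norm; exact: cu.
apply: lerD; apply: (le_trans (mean_norm _)) => //; apply: mean_le.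
- exact: nc. - exact: cont_cmod. - by move=> t _; exact: Re_le_cmod.
- exact: nc. - exact: cont_cmod. - by move=> t _; exact: Im_le_cmod.
Qed.

Lemma cmod_tint_le f B : cont f -> (forall t, cmod (f t) <= B) -> cmod (tint f) <= 2 * B.
Proof.
move=> cf fB; rewrite (le_trans (cmod_tint cf))// ler_pM2l// -[leRHS]mean_cst.
by apply: mean_le => //; [exact: cont_cmod|exact: cst_continuous].
Qed.

(** For n different from 0 the shift by pi / n changes the sign of [expi n] and preserves the
    integral. *)
Lemma tint_expi n : tint (expi n) = (n == 0)%:R.
Proof.
have [->|n0] := eqVneq n 0.
  by rewrite (_ : expi 0 = fun=> 1) ?tint_cst//; apply/funext => t; rewrite expi0.
have := tint_shift (pi / n%:~R) (contp_expi R n).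
under eq_fun do rewrite expiDt mulrC.
rewrite tintZ; last exact: cont_expi.
have -> : @expi R n (pi / n%:~R) = -1.
  rewrite /expi mulrCA mulfV ?mulr1 ?intr_eq0// cospi sinpi.
  by apply/eqP; rewrite eq_complex /= oppr0 !eqxx.
move=> /eqP; rewrite mulN1r eq_sym -addr_eq0 -mulr2n mulrn_eq0 /=.
by move/eqP.
Qed.

Definition hat f n : R[i] := tint (fun t => f t * expi (- n) t).

Arguments hat : simpl never.

Lemma hatE f n : fourier (distr_of_fun f) n = hat f n.
Proof. by rewrite /fourier /distr_of_fun tintE. Qed.

Lemma hatD f g n : cont f -> cont g -> hat (fun t => f t + g t) n = hat f n + hat g n.
Proof.
move=> cf cg; rewrite /hat -tintD; [|apply: contM => //; exact: cont_expi..].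
by congr tint; apply/funext => t; rewrite mulrDl.
Qed.
Lemma hatZ f z n : cont f -> hat (fun t => z * f t) n = z * hat f n.
Proof.
move=> cf; rewrite /hat -tintZ; [|apply: contM => //; exact: cont_expi].
by congr tint; apply/funext => t; rewrite mulrA.
Qed.
Lemma hatN f n : cont f -> hat (fun t => - f t) n = - hat f n.
Proof. by move=> cf; under eq_fun do rewrite -mulN1r; rewrite hatZ// mulN1r. Qed.
Lemma hatB f g n : cont f -> cont g -> hat (fun t => f t - g t) n = hat f n - hat g n.
Proof. by move=> cf cg; rewrite hatD ?hatN//; exact: contN. Qed.
Lemma hat_sum (I : Type) (s : seq I) (F : I -> R -> R[i]) n :
  (forall i, cont (F i)) -> hat (fun t => \sum_(i <- s) F i t) n = \sum_(i <- s) hat (F i) n.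
Proof.
move=> cF; rewrite /hat -tint_sum; last by move=> i; apply: contM => //; exact: cont_expi.
by congr tint; apply/funext => t; rewrite mulr_suml.
Qed.
Lemma hat_expi n m : hat (expi n) m = (n == m)%:R.
Proof. by rewrite /hat; under eq_fun do rewrite -expiD; rewrite tint_expi subr_eq0. Qed.
Lemma hatM_expi f n m : hat (fun t => expi n t * f t) m = hat f (m - n).
Proof.
by rewrite /hat; congr tint; apply/funext => t; rewrite opprB expiD; ring.
Qed.
Lemma hat_shift f h n : contp f -> hat (fun t => f (t + h)) n = expi n h * hat f n.
Proof.
move=> cf; rewrite /hat -(@tint_shift (fun t => f t * expi (- n) t) h); last first.
  by apply: contpM => //; exact: contp_expi.
rewrite -tintZ; last first.
  by apply: (@cont_shift _ (fun t => f t * expi (- n) t)); apply: contM; [case: cf|exact: cont_expi].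
congr tint; apply/funext => t.
rewrite expiDt; have <- : f (t + h) * expi (- n) t * (expi n h * expi (- n) h) = f (t + h) * expi (- n) t.
  by rewrite expiNK mulr1.
ring.
Qed.
Lemma hatJ f n : cont f -> hat (fun t => (conjc (f t))) n = (conjc (hat f (- n))).
Proof.
move=> cf; rewrite /hat -tintJ; last by apply: contM => //; exact: cont_expi.
by congr tint; apply/funext => t; rewrite cjM expiJ opprK.
Qed.
Lemma cmod_hat_le f n B : cont f -> (forall t, cmod (f t) <= B) -> cmod (hat f n) <= 2 * B.
Proof.
move=> cf fB; apply: cmod_tint_le; first by apply: contM => //; exact: cont_expi.
by move=> t; rewrite cmodM cmod_expi mulr1.
Qed.
Lemma hat0 f : hat f 0 = tint f.
Proof. by rewrite /hat oppr0; congr tint; apply/funext => t; rewrite expi0 mulr1. Qed.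

(** Expansion of the nonnegative mean of |f - P|^2, where P is the partial Fourier sum over F: the
    mixed terms and the square of P all integrate to the same sum S. *)
Lemma bessel f (F : seq int) : uniq F -> contp f ->
  \sum_(n <- F) cmod (hat f n) ^+ 2 <= mean (fun t => cmod (f t) ^+ 2).
Proof.
move=> uF [pf cf].
pose P t := \sum_(n <- F) hat f n * expi n t.
have cE n z : cont (fun t => z * expi n t) by apply: contM; [exact: cont_cst|exact: cont_expi].
have cP : cont P by apply: cont_sum => n; exact: cE.
set S := \sum_(n <- F) _.
have HS : \sum_(n <- F) hat f n * (conjc (hat f n)) = S%:C.
  by rewrite rmorph_sum /=; apply: eq_bigr => n _; rewrite mulcJ_cmod.
have fP : tint (fun t => f t * (conjc (P t)) ) = S%:C.
  rewrite -HS; transitivity (tint (fun t => \sum_(n <- F) (conjc (hat f n)) * (f t * expi (- n) t))).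
    congr tint; apply/funext => t; rewrite /P cj_sum mulr_sumr; apply: eq_bigr => n _.
    by rewrite cjM expiJ mulrCA.
  rewrite tint_sum; last first.
    by move=> n; apply: contM; [exact: cont_cst|apply: contM => //; exact: cont_expi].
  apply: eq_bigr => n _; rewrite tintZ; last by apply: contM => //; exact: cont_expi.
  by rewrite mulrC.
have hP n : n \in F -> hat P n = hat f n.
  move=> nF; rewrite /P hat_sum; last by move=> i; exact: cE.
  rewrite (bigD1_seq n) //= hatZ; last exact: cont_expi.
  rewrite hat_expi eqxx mulr1 big1 ?addr0// => m /negbTE mn.
  rewrite hatZ; last exact: cont_expi.
  by rewrite hat_expi mn mulr0.
have PP : tint (fun t => P t * (conjc (P t)) ) = S%:C.
  rewrite -HS; transitivity (tint (fun t => \sum_(n <- F) (conjc (hat f n)) * (P t * expi (- n) t))).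
    congr tint; apply/funext => t; rewrite /P cj_sum mulr_sumr; apply: eq_bigr => n _.
    by rewrite cjM expiJ mulrCA.
  rewrite tint_sum; last first.
    by move=> n; apply: contM; [exact: cont_cst|apply: contM => //; exact: cont_expi].
  apply: eq_big_seq => n nF; rewrite tintZ; last by apply: contM => //; exact: cont_expi.
  by rewrite -/(hat P n) hP// mulrC.
have : 0 <= mean (fun t => cmod (f t - P t) ^+ 2) by apply: mean_ge0 => t; rewrite sqr_ge0.
suff -> : mean (fun t => cmod (f t - P t) ^+ 2) = mean (fun t => cmod (f t) ^+ 2) - S.
  by rewrite subr_ge0.
apply: complexI; rewrite -tint_real rmorphB /= -tint_real.
transitivity (tint (fun t => f t * (conjc (f t)) - (f t * (conjc (P t)) + (conjc (f t * (conjc (P t)) )) - P t * (conjc (P t)) ))).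
  congr tint; apply/funext => t; rewrite -mulcJ_cmod cjB cjM conjcK; ring.
have cff : cont (fun t => f t * (conjc (f t)) ) by apply: contM => //; exact: contJ.
have cfP : cont (fun t => f t * (conjc (P t)) ) by apply: contM => //; exact: contJ.
have cPP : cont (fun t => P t * (conjc (P t)) ) by apply: contM => //; exact: contJ.
have cfPJ := contJ cfP.
have cc := contD cfP cfPJ.
rewrite tintB ?tintB ?tintD ?tintJ//; last by apply: contD => //; exact: contN.
rewrite fP PP conjc_real addrK; congr (_ - _).
by congr tint; apply/funext => t; rewrite mulcJ_cmod.
Qed.

End Mean.

#[global] Arguments tint : simpl never.
#[global] Arguments hat : simpl never.

(** * Weights, absolutely convergent Fourier series, uniqueness and inversion *)

Section Seqs.
Variable R : realType.
Implicit Types (f g : R -> R[i]) (u v : R -> R) (z : R[i]) (n m : int).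

Definition w n : R := 1 + (`|n|%N)%:R.

Lemma w_ge1 n : 1 <= w n. Proof. by rewrite /w lerDl. Qed.
Lemma w_gt0 n : 0 < w n. Proof. exact: lt_le_trans ltr01 (w_ge1 n). Qed.
Lemma wN n : w (- n) = w n. Proof. by rewrite /w abszN. Qed.
Lemma wD n m : w (n + m) <= w n * w m.
Proof.
have h : (`|(n + m)%R| <= `|n| + `|m|)%N by lia.
rewrite /w mulrDl (mulrDr 1) !mul1r mulrDr mulr1 -addrA lerD2l.
have : (`|(n + m)%R|%N)%:R <= (`|n|%N)%:R + (`|m|%N)%:R :> R by rewrite -natrD ler_nat.
have : 0 <= (`|n|%N)%:R * (`|m|%N)%:R :> R by rewrite mulr_ge0.
lra.
Qed.
Lemma wt_gt0 (s : R) n : 0 < w n `^ s. Proof. by rewrite powR_gt0// w_gt0. Qed.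
Lemma wt_ge0 (s : R) n : 0 <= w n `^ s. Proof. exact: powR_ge0. Qed.
Lemma wt_ge1 (s : R) n : 0 <= s -> 1 <= w n `^ s.
Proof. by move=> s0; rewrite -(powRr0 (w n)) ler_powR// w_ge1. Qed.
Lemma wt_mono (s t : R) n : s <= t -> w n `^ s <= w n `^ t.
Proof. by move=> st; rewrite ler_powR// w_ge1. Qed.
Lemma wtD (s : R) n m : 0 <= s -> w (n + m) `^ s <= w n `^ s * w m `^ s.
Proof.
move=> s0; rewrite -powRM; [|exact: ltW (w_gt0 _)..]; apply: ge0_ler_powR => //.
- by rewrite nnegrE ltW// w_gt0.
- by rewrite nnegrE mulr_ge0// ltW// w_gt0.
- exact: wD.
Qed.

Definition zr (N : nat) : seq int := [seq i%:Z - N%:Z | i <- iota 0 (N + N).+1].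

Lemma zr_uniq N : uniq (zr N).
Proof. by rewrite map_inj_uniq ?iota_uniq// => i j /addIr []. Qed.
Lemma mem_zr N n : (n \in zr N) = (`|n| <= N)%N.
Proof.
apply/mapP/idP => [[j]|h].
  by rewrite mem_iota add0n => /andP[_ hj] ->; lia.
by exists (`|(n + N%:Z)%R|%N); rewrite ?mem_iota; lia.
Qed.

Lemma ler_sum_sub (T : eqType) (F G : seq T) (y : T -> R) : (forall k, 0 <= y k) -> uniq F ->
  {subset F <= G} -> \sum_(n <- F) y n <= \sum_(n <- G) y n.
Proof.
move=> y0; elim: F G => [|a F IH] G /=; first by rewrite big_nil sumr_ge0.
move=> /andP[aF uF] FG; rewrite big_cons [leRHS](perm_big (a :: rem a G)); last first.
  by apply: perm_to_rem; apply: FG; rewrite mem_head.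
rewrite big_cons lerD2l; apply: IH => // b bF.
have : b \in G by apply: FG; rewrite inE bF orbT.
rewrite (perm_mem (perm_to_rem (FG a (mem_head _ _)))) inE => /predU1P[ba|//].
by rewrite -ba bF in aF.
Qed.

(** Sums over the integers are handled through uniform bounds on finite sums, so that limits and
    orders of summation do not appear. *)
Definition bnd (x : int -> R) (C : R) := forall F, uniq F -> \sum_(n <- F) x n <= C.

(** A finite set F0 whose sum nearly attains the supremum leaves at most e for every finite set
    disjoint from it. *)
Lemma bnd_tail (x : int -> R) C : (forall n, 0 <= x n) -> bnd x C -> forall e : R, 0 < e ->
  exists N, forall F, uniq F -> (forall n, n \in F -> (N < `|n|)%N) -> \sum_(n <- F) x n <= e.
Proof.
move=> x0 bC e e0.
pose A : set R := [set s | exists2 F, uniq F & s = \sum_(n <- F) x n].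
have sA : has_sup A.
  split; first by exists 0, [::]; rewrite ?big_nil.
  by exists C => _ [F uF ->]; exact: bC.
have [_ [F0 uF0 ->] h] := sup_adherent e0 sA.
exists (\max_(n <- F0) `|n|%N) => F uF FN.
have uFF : uniq (F0 ++ F).
  rewrite cat_uniq uF0 uF andbT /=; apply/hasPn => n nF.
  apply/negP => nF0; have := FN _ nF; rewrite ltnNge => /negP; apply.
  exact: (@leq_bigmax_seq _ F0 xpredT (fun n : int => `|n|%N) n).
have : \sum_(n <- F0 ++ F) x n <= sup A.
  by apply: (ub_le_sup sA.2); exists (F0 ++ F).
by rewrite big_cat /=; lra.
Qed.

Definition psum (a : int -> R[i]) N t : R[i] := \sum_(n <- zr N) a n * expi n t.

Lemma contp_term (a : int -> R[i]) n : contp (fun t => a n * expi n t).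
Proof. by apply: contpM; [exact: contp_cst|exact: contp_expi]. Qed.

Lemma contp_psum a N : contp (psum a N).
Proof. by apply: contp_sum => n; exact: contp_term. Qed.

Lemma hat_fsum (a : int -> R[i]) (F : seq int) n : uniq F ->
  hat (fun t => \sum_(m <- F) a m * expi m t) n = if n \in F then a n else 0.
Proof.
move=> uF; have cE m : cont (fun t => a m * expi m t) by case: (contp_term a m).
rewrite hat_sum//.
have hE m : hat (fun t => a m * expi m t) n = a m * (m == n)%:R.
  by rewrite hatZ ?hat_expi//; exact: cont_expi.
under eq_bigr do rewrite hE.
case: ifPn => nF.
  by rewrite (bigD1_seq n)//= eqxx mulr1 big1 ?addr0// => m /negbTE ->; rewrite mulr0.
rewrite big_seq big1// => m mF; case: eqP => [mn|]; last by rewrite mulr0.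
by rewrite -mn mF in nF.
Qed.

Lemma hat_psum a N n : hat (psum a N) n = if (`|n| <= N)%N then a n else 0.
Proof. by rewrite -mem_zr; apply: hat_fsum; exact: zr_uniq. Qed.

Lemma contp_bnd f : contp f -> exists2 B : R, 0 < B & forall t, cmod (f t) <= B.
Proof.
move=> [pf cf].
have [c _ hc] := @EVT_max R (fun t => cmod (f t)) 0 (2 * pi) (ltW (twopi_gt0 R))
  (continuous_subspaceT (cont_cmod cf)).
exists (cmod (f c) + 1); first by rewrite ltr_wpDl// cmod_ge0.
move=> t; have [n hn] := mod2pi t 0.
rewrite -(periodic_int pf t n) (le_trans (hc _ _)) ?lerDl//.
by rewrite in_itv /= add0r in hn *; case/andP: hn => -> /ltW ->.
Qed.

Lemma contp_lbnd f : contp f -> (forall t, f t != 0) -> exists2 c : R, 0 < c & forall t, c <= cmod (f t).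
Proof.
move=> cf f0; have [B B0 hB] := contp_bnd (contp_inv cf f0).
exists B^-1; first by rewrite invr_gt0.
move=> t; have := hB t; rewrite cmodV => h.
have c0 : 0 < cmod (f t).
  by rewrite lt_neqAle cmod_ge0 andbT eq_sym; apply/eqP => /cmod_eq0/eqP; apply/negP.
by rewrite -[leRHS]invrK lef_pV2// posrE invr_gt0.
Qed.

Lemma contp_unif f : (forall e : R, 0 < e -> exists2 g, contp g & forall t, cmod (f t - g t) <= e) ->
  contp f.
Proof.
move=> H.
have rim (k : R[i] -> R) : (forall z1 z2, k (z1 - z2) = k z1 - k z2) ->
    (forall z, `|k z| <= cmod z) ->
    (forall g, contp g -> continuous (fun t => k (g t))) -> continuous (fun t => k (f t)).
  move=> kB kle kc t; apply/cvgrPdist_le => e e0.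
  have [g cg hg] := H (e / 3) ltac:(lra).
  have /cvgrPdist_le /(_ (e / 3)) := kc g cg t.
  move=> /(_ ltac:(lra)); apply: filterS => s hs.
  have -> : k (f t) - k (f s) =
    k (f t - g t) + (k (g t) - k (g s)) - k (f s - g s) by rewrite !kB; ring.
  have := le_trans (kle _) (hg t); have := le_trans (kle _) (hg s).
  rewrite !ler_norml in hs *; lra.
split; last first.
  split; first by apply: (rim (@complex.Re R)) => //; [by case=> ? ? []|exact: Re_le_cmod|by move=> g [_ []]].
  by apply: (rim (@complex.Im R)) => //; [by case=> ? ? []|exact: Im_le_cmod|by move=> g [_ []]].
move=> t; apply/eqP; rewrite -subr_eq0; apply/eqP/cmod_eq0/eqP.
rewrite eq_le cmod_ge0 andbT; apply/ler_addgt0Pr => e e0; rewrite add0r.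
have [g [pg _] hg] := H (e / 2) ltac:(lra).
have -> : f (t + 2 * pi) - f t = (f (t + 2 * pi) - g (t + 2 * pi)) - (f t - g t).
  by rewrite pg; ring.
rewrite (le_trans (cmodB _ _))//; have := hg t; have := hg (t + 2 * pi); lra.
Qed.

Lemma hat_near f g e n : contp f -> contp g -> (forall t, cmod (f t - g t) <= e) ->
  cmod (hat f n - hat g n) <= 2 * e.
Proof.
move=> cf cg fg; rewrite -hatB; [|by case: cf|by case: cg].
by apply: cmod_hat_le => //; case: (contpB cf cg).
Qed.

(** The limit inferior of y. The Cauchy estimates are hypotheses inside the conclusion, so that one
    number l serves all pairs e, N at once. *)
Lemma cauchy_lim (y : nat -> R) : exists l : R, forall e N,
  (forall M, (N <= M)%N -> `|y M - y N| <= e) -> `|l - y N| <= e.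
Proof.
pose A : set R := [set a | exists N, forall M, (N <= M)%N -> a <= y M].
exists (sup A) => e N h.
have An : A (y N - e).
  by exists N => M NM; have := h M NM; rewrite ler_norml; lra.
have ub a : A a -> a <= y N + e.
  move=> [N' h']; have := h' (maxn N N') (leq_maxr _ _); have := h (maxn N N') (leq_maxl _ _).
  rewrite ler_norml; lra.
have h1 : y N - e <= sup A by apply: ub_le_sup => //; exists (y N + e) => a /ub.
have h2 : sup A <= y N + e by apply: ge_sup => //; exists (y N - e).
by rewrite ler_norml; lra.
Qed.

Lemma synth (a : int -> R[i]) C : bnd (fun n => cmod (a n)) C ->
  exists f, [/\ contp f, (forall n, hat f n = a n) &
    forall e : R, 0 < e -> exists N0, forall N, (N0 <= N)%N -> forall t, cmod (f t - psum a N t) <= e].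
Proof.
move=> ba.
have tl (e : R) : 0 < e -> exists N0, forall N M, (N0 <= N)%N -> (N <= M)%N ->
    forall t, cmod (psum a M t - psum a N t) <= e.
  move=> e0; have [N0 hN0] := bnd_tail (fun n => cmod_ge0 (a n)) ba e0.
  exists N0 => N M N0N NM t.
  have -> : psum a M t - psum a N t =
      \sum_(n <- zr M | n \notin zr N) a n * expi n t.
    rewrite /psum [X in X - _](bigID (mem (zr N))) /=.
    rewrite -[X in X + _ - _]big_filter [X in X + _ - _](perm_big (zr N)) 1?addrC ?addKr//.
    apply: uniq_perm; rewrite ?filter_uniq ?zr_uniq// => n.
    by rewrite mem_filter andbC /= !mem_zr; lia.
  rewrite (le_trans (cmod_sum _ _ _))// -big_filter.
  under eq_bigr do rewrite cmodM cmod_expi mulr1.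
  apply: hN0; first by rewrite filter_uniq// zr_uniq.
  by move=> n; rewrite mem_filter !mem_zr; lia.
(* The point value is characterised by all its Cauchy estimates at once; the limits of the real and
   imaginary parts satisfy them, with a factor 2. *)
pose f t := xget 0 [set l | forall e N, (forall M, (N <= M)%N -> cmod (psum a M t - psum a N t) <= e) ->
  cmod (l - psum a N t) <= 2 * e].
have fP t e N : (forall M, (N <= M)%N -> cmod (psum a M t - psum a N t) <= e) ->
  cmod (f t - psum a N t) <= 2 * e.
  have [l1 h1] := cauchy_lim (fun N => complex.Re (psum a N t)).
  have [l2 h2] := cauchy_lim (fun N => complex.Im (psum a N t)).
  apply: (@xgetPex _ 0 [set l | forall e N, (forall M, (N <= M)%N -> cmod (psum a M t - psum a N t) <= e) ->
  cmod (l - psum a N t) <= 2 * e]); exists (l1 +i* l2) => e' N' h.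
  rewrite (le_trans (cmod_le_ReIm _))// mulr_natl mulr2n; apply: lerD.
    rewrite (_ : complex.Re _ = l1 - complex.Re (psum a N' t)); last by case: (psum a N' t).
    apply: h1 => M NM; rewrite (le_trans _ (h M NM))// (le_trans _ (Re_le_cmod _))//.
    by case: (psum a M t); case: (psum a N' t).
  rewrite (_ : complex.Im _ = l2 - complex.Im (psum a N' t)); last by case: (psum a N' t).
  apply: h2 => M NM; rewrite (le_trans _ (h M NM))// (le_trans _ (Im_le_cmod _))//.
  by case: (psum a M t); case: (psum a N' t).
have fN (e : R) : 0 < e -> exists N0, forall N, (N0 <= N)%N -> forall t, cmod (f t - psum a N t) <= e.
  move=> e0; have [N0 h] := tl (e / 2) ltac:(lra); exists N0 => N N0N t.
  have -> : e = 2 * (e / 2) by lra.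
  by apply: fP => M NM; exact: h.
have cf : contp f.
  apply: contp_unif => e e0; have [N h] := fN e e0; exists (psum a N); first exact: contp_psum.
  exact: h.
exists f; split => // n; apply/eqP; rewrite -subr_eq0; apply/eqP/cmod_eq0/eqP.
rewrite eq_le cmod_ge0 andbT; apply/ler_addgt0Pr => e e0; rewrite add0r.
have [N h] := fN (e / 2) ltac:(lra).
have := hat_near n cf (contp_psum a (maxn N `|n|%N)) (h _ (leq_maxl _ _)).
by rewrite hat_psum leq_maxr; lra.
Qed.

Lemma cos_lt1 (x : R) : 0 < x < 2 * pi -> cos x < 1.
Proof.
move=> h; have := cos_mulr2n (x / 2); rewrite (_ : x / 2 *+ 2 = x); last by rewrite mulr2n; lra.
move=> ->.
have s0 : 0 < sin (x / 2) by apply: sin_gt0_pi; lra.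
have := cos2Dsin2 (x / 2); nra.
Qed.

Lemma cmod_expi1_sqr (x : R) : cmod (1 - expi 1 x) ^+ 2 = 2 - 2 * cos x.
Proof.
rewrite cmod_sqr /expi mul1r /=; have := cos2Dsin2 x; nra.
Qed.

(** Near t continuity gives e; away from t modulo 2 pi, |1 - e^(ix)| is bounded below, so a multiple
    of its square dominates the bounded left-hand side. This shape can be integrated against the
    Fejer kernel. *)
Lemma fejer_bound f t (e : R) : contp f -> 0 < e -> exists2 C : R, 0 < C &
  forall x : R, cmod (f t - f (t + x)) <= e + C * cmod (1 - expi 1 x) ^+ 2.
Proof.
move=> cf e0; have p0 := twopi_gt0 R.
pose v x := f t - f (x + t).
have cv : contp v by apply: contpB; [exact: contp_cst|exact: contp_shift].
have [B B0 hB] := contp_bnd cv.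
have [d d0 hd] : exists2 d : R, 0 < d & forall x, `|x| < d -> cmod (v x) <= e.
  have /cvgrPdist_le /(_ e e0) := @cont_cmod _ v cv.2 0.
  move=> /nbhs_ballP[d /= d0 h]; exists d => // x xd.
  have := h x; rewrite /ball /= sub0r normrN => /(_ xd).
  by rewrite {1}/v add0r subrr cmod0 sub0r normrN ger0_norm ?cmod_ge0.
pose d' := Num.min d pi.
have d'0 : 0 < d' by rewrite lt_min d0 pi_gt0.
have d'd : d' <= d by rewrite ge_min lexx.
have d'p : d' <= pi by rewrite ge_min lexx orbT.
have cc : {within `[d' / 2, 2 * pi - d' / 2], continuous (fun x : R => 2 - 2 * cos x)}.
  apply: continuous_subspaceT => x; apply: cvgB; first exact: cvg_cst.
  by apply: cvgM; [exact: cvg_cst|exact: continuous_cos].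
have [c hc1 hc2] := @EVT_min R _ (d' / 2) (2 * pi - d' / 2) ltac:(lra) cc.
have m0 : 0 < 2 - 2 * cos c.
  rewrite in_itv /= in hc1.
  have := @cos_lt1 c ltac:(lra); lra.
exists (B / (2 - 2 * cos c)); first by rewrite divr_gt0.
move=> x; have [n hn] := mod2pi x (- (d' / 2)).
have vp : cmod (f t - f (t + x)) = cmod (v (x + 2 * pi * n%:~R)).
  by rewrite (periodic_int cv.1) /v (addrC x).
have ep : @expi R 1 x = expi 1 (x + 2 * pi * n%:~R).
  by rewrite (periodic_int (@expi_period R 1)).
rewrite vp ep; move: (x + 2 * pi * n%:~R) hn => {vp ep} {}x hx.
have [xd|xd] := ltP `|x| d.
  rewrite (le_trans (hd _ xd))// lerDl mulr_ge0 ?sqr_ge0// divr_ge0 ?ltW//.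
have hx2 : d' <= x by move: xd; case: (ger0P x) => x0 xd; lra.
have := hc2 x; rewrite in_itv /= => /(_ ltac:(lra)) hcx.
rewrite cmod_expi1_sqr (le_trans (hB _))// (@le_trans _ _ (B / (2 - 2 * cos c) * (2 - 2 * cos c)))//.
  by rewrite divfK// gt_eqF.
by apply: ler_wpDl; [exact: ltW|apply: ler_wpM2l => //; rewrite divr_ge0// ltW].
Qed.

(** Fejer's argument. With D the sum of the first N exponentials, |D|^2 has mean N, while |1 -
    e^(ix)|^2 |D|^2 = |1 - e^(iNx)|^2 is at most 4. If all coefficients vanish, so does the integral
    of f(t + x) |D(x)|^2; hence N f(t) is an integral of differences f(t) - f(t + x), at most e N /
    2 + 8 C in modulus. *)
Lemma hat_eq0 f : contp f -> (forall n, hat f n = 0) -> forall t, f t = 0.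
Proof.
move=> cf f0 t; apply/cmod_eq0/eqP; rewrite eq_le cmod_ge0 andbT.
apply/ler_addgt0Pr => e e0; rewrite add0r.
have [C C0 hC] := fejer_bound t cf (e := e / 4) ltac:(lra).
(* Large enough for 8 C < e N / 2. *)
pose N := (Num.truncn (16 * C / e)).+1.
have N0 : 0 < N%:R :> R by rewrite ltr0n.
have hN : 16 * C / e < N%:R by rewrite /N truncnS_gt.
pose D x : R[i] := \sum_(j <- iota 0 N) expi j%:Z x.
have cD : contp D by apply: contp_sum => j; exact: contp_expi.
have DD x : D x * conjc (D x) = \sum_(j <- iota 0 N) \sum_(k <- iota 0 N) expi (j%:Z - k%:Z) x.
  rewrite /D cj_sum mulr_suml; apply: eq_bigr => j _; rewrite mulr_sumr.
  by apply: eq_bigr => k _; rewrite expiJ -expiD.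
have cDD : contp (fun x => D x * conjc (D x)) by apply: contpM => //; exact: contpJ.
have tDD : tint (fun x => D x * conjc (D x)) = N%:R.
  under [X in tint X]eq_fun do rewrite DD.
  rewrite tint_sum; last by move=> j; apply: cont_sum => k; exact: cont_expi.
  transitivity (\sum_(j <- iota 0 N) (1 : R[i])).
    apply: eq_big_seq => j; rewrite mem_iota => jN.
    rewrite tint_sum; last by move=> k; exact: cont_expi.
    rewrite (bigD1_seq j) ?iota_uniq ?mem_iota//= tint_expi subrr eqxx big1 ?addr0// => k kj.
    by rewrite tint_expi subr_eq0 eqz_nat eq_sym (negbTE kj).
  by rewrite big_const_seq count_predT size_iota iter_addr_0.
have fDD : tint (fun x => f (t + x) * (D x * conjc (D x))) = 0.
  under [X in tint X]eq_fun do rewrite DD mulr_sumr.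
  rewrite tint_sum; last first.
    move=> j; under eq_fun do rewrite mulr_sumr; apply: cont_sum => k; apply: contM; last exact: cont_expi.
    under eq_fun do rewrite addrC.
    by apply: cont_shift; case: cf.
  rewrite big1// => j _; under [X in tint X]eq_fun do rewrite mulr_sumr.
  rewrite tint_sum; last first.
    move=> k; apply: contM; last exact: cont_expi.
    under eq_fun do rewrite addrC.
    by apply: cont_shift; case: cf.
  rewrite big1// => k _.
  transitivity (hat (fun x => f (x + t)) (- (j%:Z - k%:Z))).
    by rewrite /hat; congr tint; apply/funext => x; rewrite opprK addrC.
  by rewrite hat_shift// f0 mulr0.
have cft : cont (fun x => f (t + x)).
  by under eq_fun do rewrite addrC; apply: cont_shift; case: cf.
have key : f t * N%:R = tint (fun x => (f t - f (t + x)) * (D x * conjc (D x))).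
  under [X in tint X]eq_fun do rewrite mulrBl.
  rewrite tintB; [|by apply: contM; [exact: cont_cst|case: cDD]|by apply: contM => //; case: cDD].
  by rewrite fDD subr0 tintZ ?tDD//; case: cDD.
have tel x : (1 - expi 1 x) * D x = 1 - expi N%:Z x.
  rewrite /D; elim: (N) => [|k IH]; first by rewrite big_nil mulr0 expi0 subrr.
  rewrite -addn1 iotaD big_cat /= big_seq1 add0n mulrDr IH mulrBl mul1r -expiD.
  by rewrite -PoszD add1n addn1; ring.
have bnd1 x : cmod ((f t - f (t + x)) * (D x * conjc (D x))) <=
    e / 4 * cmod (D x) ^+ 2 + C * 4.
  rewrite !cmodM cmodJ -expr2.
  have := hC x; move: (cmod (f t - f (t + x))) => y hy.
  have h4 : cmod (1 - expi 1 x) ^+ 2 * cmod (D x) ^+ 2 <= 4.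
    rewrite -exprMn -cmodM tel.
    have : cmod (1 - expi N%:Z x) <= 2.
      by rewrite (le_trans (cmodB _ _))// cmod1 cmod_expi.
    have := cmod_ge0 (1 - @expi R N%:Z x); nra.
  rewrite (le_trans (ler_wpM2r (sqr_ge0 _) hy))// mulrDl lerD2l -mulrA ler_wpM2l// ltW//.
have : cmod (f t * N%:R) <= 2 * (e / 4 * N%:R + C * 4).
  rewrite key (le_trans (cmod_tint _))//.
    by apply: contM; [apply: contD; [exact: cont_cst|exact: contN]|case: cDD].
  rewrite ler_pM2l//.
  have mD : mean (fun x => cmod (D x) ^+ 2) = N%:R.
    apply: complexI; rewrite -tint_real.
    under [X in tint X]eq_fun do rewrite -mulcJ_cmod.
    by rewrite tDD rmorph_nat.
  have cD2 : continuous (fun x => cmod (D x) ^+ 2).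
    by move=> x; under eq_fun do rewrite expr2; apply: cvgM; exact: (cont_cmod cD.2).
  have c1 : continuous (fun x => e / 4 * cmod (D x) ^+ 2).
    by move=> x; apply: cvgM; [exact: cvg_cst|exact: cD2].
  rewrite -mD -mean_Z// -[X in _ <= _ + X]mean_cst -mean_D//; last exact: cst_continuous.
  apply: mean_le => //.
    apply: cont_cmod; apply: contM; last by case: cDD.
    by apply: contD; [exact: cont_cst|exact: contN].
  by move=> x; apply: cvgD; [exact: c1|exact: cvg_cst].
have -> : cmod (f t * N%:R) = cmod (f t) * N%:R.
  by rewrite cmodM -(rmorph_nat (real_complex R)) cmod_real ger0_norm.
move=> h; rewrite ltr_pdivrMr// in hN; rewrite -(ler_pM2r N0); nra.
Qed.

(** The partial sums converge uniformly to a function with the same coefficients, which is f by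
    uniqueness. *)
Lemma inversion f C : contp f -> bnd (fun n => cmod (hat f n)) C ->
  forall e : R, 0 < e -> exists N0, forall N, (N0 <= N)%N -> forall t, cmod (f t - psum (hat f) N t) <= e.
Proof.
move=> cf bf; have [g [cg hg gN]] := synth bf.
suff fg : f = g.
  move=> e e0; have [N0 h] := gN e e0; exists N0 => N NN t; rewrite {1}fg; exact: h.
apply/funext => t; apply/eqP; rewrite -subr_eq0; apply/eqP.
apply: (@hat_eq0 (fun t => f t - g t)); first exact: contpB.
by move=> n; rewrite hatB ?hg ?subrr//; [case: cf|case: cg].
Qed.

Lemma cmod_psum_le (a : int -> R[i]) C N t : bnd (fun n => cmod (a n)) C -> cmod (psum a N t) <= C.
Proof.
move=> ba; rewrite (le_trans (cmod_sum _ _ _))//.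
under eq_bigr do rewrite cmodM cmod_expi mulr1.
exact/ba/zr_uniq.
Qed.

Lemma sup_le_l1 f C : contp f -> bnd (fun n => cmod (hat f n)) C -> forall t, cmod (f t) <= C.
Proof.
move=> cf bf t; apply/ler_addgt0Pr => e e0.
have [N h] := inversion cf bf e0.
rewrite -[f t](subrK (psum (hat f) N t)) (le_trans (cmodD _ _))// addrC lerD//; last exact: h.
exact: cmod_psum_le.
Qed.

End Seqs.

(** * The Beurling algebra and Wiener's lemma *)

Section WienerAlgebra.
Variable R : realType.
Implicit Types (f g : R -> R[i]) (u v : R -> R) (z : R[i]) (n m : int) (s e : R).

Definition A1 s f (C : R) := contp f /\ bnd (fun n => cmod (hat f n) * w R n `^ s) C.

Lemma bnd_ge0 (x : int -> R) C : bnd x C -> 0 <= C.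
Proof. by move=> /(_ [::] isT); rewrite big_nil. Qed.

Lemma bnd_le (x y : int -> R) C : (forall n, x n <= y n) -> bnd y C -> bnd x C.
Proof. by move=> xy by_ F uF; rewrite (le_trans _ (by_ F uF))// ler_sum. Qed.

Lemma bnd_leC (x : int -> R) C D : C <= D -> bnd x C -> bnd x D.
Proof. by move=> CD bx F uF; rewrite (le_trans (bx F uF)). Qed.

Lemma A1_leC s f C D : C <= D -> A1 s f C -> A1 s f D.
Proof. by move=> CD [cf bf]; split=> //; exact: bnd_leC bf. Qed.

Lemma A1_l1 s f C : 0 <= s -> A1 s f C -> bnd (fun n => cmod (hat f n)) C.
Proof.
move=> s0 [cf]; apply: bnd_le => n.
by rewrite ler_peMr ?cmod_ge0// wt_ge1.
Qed.

Lemma A1_sup s f C t : 0 <= s -> A1 s f C -> cmod (f t) <= C.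
Proof. by move=> s0 fC; apply: sup_le_l1 (A1_l1 s0 fC) t; case: fC. Qed.

Lemma A1D s f g C D : A1 s f C -> A1 s g D -> A1 s (fun t => f t + g t) (C + D).
Proof.
move=> [cf bf] [cg bg]; split; first exact: contpD.
move=> F uF; rewrite (le_trans _ (lerD (bf F uF) (bg F uF)))// -big_split /=.
apply: ler_sum => n _; rewrite -mulrDl ler_wpM2r ?wt_ge0// hatD ?cmodD//; [by case: cf|by case: cg].
Qed.

Lemma A1Z s f z C : A1 s f C -> A1 s (fun t => z * f t) (cmod z * C).
Proof.
move=> [cf bf]; split; first by apply: contpM => //; exact: contp_cst.
move=> F uF; rewrite (le_trans _ (ler_wpM2l (cmod_ge0 z) (bf F uF)))// mulr_sumr.
by apply: ler_sum => n _; rewrite mulrA hatZ ?cmodM//; case: cf.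
Qed.

Lemma A1N s f C : A1 s f C -> A1 s (fun t => - f t) C.
Proof.
move=> fC; under eq_fun do rewrite -mulN1r.
by have := A1Z (-1) fC; rewrite cmodN cmod1 mul1r.
Qed.

Lemma A1B s f g C D : A1 s f C -> A1 s g D -> A1 s (fun t => f t - g t) (C + D).
Proof. by move=> fC gD; apply: A1D => //; exact: A1N. Qed.

Lemma A1_expiM s f n C : 0 <= s -> A1 s f C -> A1 s (fun t => expi n t * f t) (w R n `^ s * C).
Proof.
move=> s0 [cf bf]; split; first by apply: contpM => //; exact: contp_expi.
move=> F uF.
have uF' : uniq [seq m - n | m <- F] by rewrite map_inj_uniq// => a b /addIr.
rewrite (le_trans _ (ler_wpM2l (wt_ge0 s n) (bf _ uF')))// big_map mulr_sumr.
apply: ler_sum => m _; rewrite hatM_expi mulrCA ler_wpM2l ?cmod_ge0//.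
by rewrite -{1}(subrK n m) addrC wtD.
Qed.

Lemma hat_cst z n : hat (fun=> z) n = z * (0 == n)%:R.
Proof.
rewrite -hat_expi -hatZ; last exact: cont_expi.
by rewrite (_ : (fun t => z * expi 0 t) = fun=> z)//; apply/funext => t; rewrite expi0 mulr1.
Qed.

Lemma A1_cst s z : A1 s (fun=> z) (cmod z).
Proof.
split; first exact: contp_cst.
have hz := hat_cst z.
move=> F uF; have [F0|F0] := boolP (0 \in F).
  rewrite (bigD1_seq 0)//= hz eqxx mulr1 /w absz0 addr0 powR1 mulr1 big1 ?addr0// => n n0.
  by rewrite hz eq_sym (negbTE n0) mulr0 cmod0 mul0r.
rewrite big_seq big1 ?cmod_ge0// => n nF.
rewrite hz; case: eqP => [n0|_]; last by rewrite mulr0 cmod0 mul0r.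
by rewrite n0 nF in F0.
Qed.

Lemma A1J s f C : A1 s f C -> A1 s (fun t => conjc (f t)) C.
Proof.
move=> [cf bf]; split; first exact: contpJ.
move=> F uF.
have uF' : uniq [seq - m | m <- F] by rewrite map_inj_uniq// => a b /oppr_inj.
rewrite (le_trans _ (bf _ uF'))// big_map.
by apply: ler_sum => m _; rewrite hatJ ?cmodJ ?wN//; case: cf.
Qed.

Lemma A1_sum s (I : Type) (r : seq I) (F : I -> R -> R[i]) (C : I -> R) :
  (forall i, A1 s (F i) (C i)) -> A1 s (fun t => \sum_(i <- r) F i t) (\sum_(i <- r) C i).
Proof.
move=> H; elim: r => [|i r IH].
  under eq_fun do rewrite big_nil; rewrite big_nil -(cmod0 R); exact: A1_cst.
by under eq_fun do rewrite big_cons; rewrite big_cons; exact: A1D.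
Qed.

(** Fatou's property of the norm: uniform closeness controls each coefficient, hence each finite
    sum. *)
Lemma A1_lim s f C : (forall e, 0 < e -> exists2 g, A1 s g C & forall t, cmod (f t - g t) <= e) ->
  A1 s f C.
Proof.
move=> H; have cf : contp f.
  by apply: contp_unif => e e0; have [g [cg _] h] := H e e0; exists g.
split=> // F uF; apply/ler_addgt0Pr => e e0.
pose W := \sum_(n <- F) w R n `^ s.
have W0 : 0 <= W by apply: sumr_ge0 => n _; exact: wt_ge0.
have [g [cg bg] hg] := H (e / (2 * (W + 1))) ltac:(by rewrite divr_gt0// mulr_gt0// ltr_wpDl).
rewrite (@le_trans _ _ (\sum_(n <- F) (cmod (hat g n) * w R n `^ s + 2 * (e / (2 * (W + 1))) * w R n `^ s)))//.
  apply: ler_sum => n _; rewrite -mulrDl ler_wpM2r ?wt_ge0//.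
  rewrite -[hat f n](subrK (hat g n)) (le_trans (cmodD _ _))// addrC lerD2l.
  exact: hat_near.
rewrite big_split /= -mulr_sumr -/W lerD//; first exact: bg.
have -> : 2 * (e / (2 * (W + 1))) = e / (W + 1) by field; lra.
rewrite mulrAC ler_pdivrMr; nra.
Qed.

Lemma A1_approx s f C e : 0 < e -> A1 s f C ->
  exists N0, forall N, (N0 <= N)%N -> A1 s (fun t => f t - psum (hat f) N t) e.
Proof.
move=> e0 [cf bf].
have [|N0 h] := bnd_tail _ bf e0.
  by move=> n; rewrite mulr_ge0 ?cmod_ge0 ?wt_ge0.
exists N0 => N NN; split; first by apply: contpB => //; exact: contp_psum.
move=> F uF; rewrite (bigID (fun n => (`|n| <= N)%N)) /= big1 ?add0r; last first.
  move=> n nN; rewrite hatB; [|by case: cf|by case: (contp_psum (hat f) N)].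
  by rewrite hat_psum nN subrr cmod0 mul0r.
rewrite -big_filter big_seq.
under eq_bigr => n.
  rewrite mem_filter -ltnNge => /andP[nN _].
  rewrite hatB; [|by case: cf|by case: (contp_psum (hat f) N)].
  rewrite hat_psum leqNgt nN subr0.
  over.
rewrite -big_seq; apply: h; first exact: filter_uniq.
by move=> n; rewrite mem_filter -ltnNge => /andP[nN _]; exact: leq_ltn_trans nN.
Qed.

(** Replacing f by its partial sums reduces the convolution of coefficients to a finite combination
    of modulated copies of g, to which [A1_expiM] and the triangle inequality apply; [A1_lim]
    removes the truncation. *)
Lemma A1M s f g C D : 0 <= s -> A1 s f C -> A1 s g D -> A1 s (fun t => f t * g t) (C * D).
Proof.
move=> s0 fC gD; apply: A1_lim => e e0.
have D0 := bnd_ge0 gD.2.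
have [N0 h] := inversion fC.1 (A1_l1 s0 fC) (e := e / (D + 1)) ltac:(by rewrite divr_gt0// ltr_wpDl).
exists (fun t => psum (hat f) N0 t * g t); last first.
  move=> t; rewrite -mulrBl cmodM.
  have := h N0 (leqnn _) t; have := A1_sup t s0 gD.
  have := cmod_ge0 (g t); have := cmod_ge0 (f t - psum (hat f) N0 t).
  move: (cmod _) (cmod _) => a b a0 b0 bD ab.
  rewrite (@le_trans _ _ (e / (D + 1) * D))//; first exact: ler_pM.
  rewrite mulrAC ler_pdivrMr; nra.
have := @A1_sum s _ (zr N0) (fun n t => hat f n * (expi n t * g t))
  (fun n => cmod (hat f n) * (w R n `^ s * D)).
move=> /(_ (fun n => A1Z _ (A1_expiM n s0 gD))).
have -> : (fun t => \sum_(n <- zr N0) hat f n * (expi n t * g t)) = (fun t => psum (hat f) N0 t * g t).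
  by apply/funext => t; rewrite /psum mulr_suml; apply: eq_bigr => n _; rewrite mulrA.
apply: A1_leC; under eq_bigr do rewrite mulrA.
rewrite -mulr_suml ler_wpM2r//.
exact/fC.2/zr_uniq.
Qed.

Lemma A1X s f C k : 0 <= s -> A1 s f C -> A1 s (fun t => f t ^+ k) (C ^+ k).
Proof.
move=> s0 fC; elim: k => [|k IH].
  by rewrite expr0 -(cmod1 R); under eq_fun do rewrite expr0; exact: A1_cst.
by rewrite exprS; under eq_fun do rewrite exprS; exact: A1M.
Qed.

Definition block (i : nat) n := (2 ^ i <= `|n| < 2 ^ i.+1)%N.

Lemma block_sum (y : int -> R) (b : nat -> R) :
  (forall i F, uniq F -> (forall n, n \in F -> block i n) -> \sum_(n <- F) y n <= b i) ->
  0 <= y 0 ->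
  forall I F, uniq F -> (forall n, n \in F -> (`|n| < 2 ^ I)%N) ->
  \sum_(n <- F) y n <= y 0 + \sum_(i < I) b i.
Proof.
move=> yb y0; elim=> [|I IH] F uF FI.
  rewrite big_ord0 addr0; have [F0|F0] := boolP (0 \in F).
    rewrite (bigD1_seq 0)//= big_seq_cond big1 ?addr0// => n /andP[nF n0].
    by have := FI n nF; lia.
  rewrite big_seq big1// => n nF; have := FI n nF => nn.
  by move: nn; rewrite expn0 ltnS leqn0 absz_eq0 => /eqP n0; rewrite n0 (negbTE F0) in nF.
rewrite (bigID (fun n => (`|n| < 2 ^ I)%N)) big_ord_recr addrA /=.
rewrite -big_filter -[X in _ + X <= _]big_filter; apply: lerD.
  apply: IH; first exact: filter_uniq.
  by move=> n; rewrite mem_filter => /andP[].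
apply: yb; first exact: filter_uniq.
by move=> n; rewrite mem_filter /block => /andP[nI nF]; rewrite leqNgt nI FI.
Qed.

Lemma seq_lt_pow (F : seq int) : exists I, forall n, n \in F -> (`|n| < 2 ^ I)%N.
Proof.
exists (\max_(n <- F) `|n|%N) => n nF.
rewrite (leq_ltn_trans (@leq_bigmax_seq _ F xpredT (fun n : int => `|n|%N) n nF isT))//.
exact: ltn_expl.
Qed.

Lemma block_size i F : uniq F -> (forall n, n \in F -> block i n) -> (size F <= 4 * 2 ^ i)%N.
Proof.
move=> uF FB; have : (size F <= size (zr (2 ^ i.+1 - 1)))%N.
  apply: uniq_leq_size => // n /FB; rewrite mem_zr /block; lia.
rewrite size_map size_iota expnS; have : (0 < 2 ^ i)%N by rewrite expn_gt0.
lia.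
Qed.

Lemma block_w i n : block i n -> w R n <= 2 ^+ i.+1.
Proof.
move=> /andP[_ h]; rewrite /w -natrX (_ : 1 = 1%:R)// -natrD ler_nat; lia.
Qed.

(** For n in the block and h = pi / 2^(i+1), |n h| lies between pi / 2 and pi, so |e^(inh) - 1|^2 >=
    2; Bessel's inequality is applied to f(t + h) - f(t). *)
Lemma block_bessel f i F : contp f -> uniq F -> (forall n, n \in F -> block i n) ->
  \sum_(n <- F) cmod (hat f n) ^+ 2 <=
  mean (fun t => cmod (f (t + pi / 2 ^+ i.+1) - f t) ^+ 2) / 2.
Proof.
move=> cf uF FB; set h := pi / _.
have cfh := contp_shift h cf.
have := bessel uF (contpB cfh cf).
move=> H; rewrite ler_pdivlMr// (le_trans _ H)//.
rewrite mulr_suml big_seq [leRHS]big_seq; apply: ler_sum => n /FB nB.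
have -> : hat (fun t => f (t + h) - f t) n = (expi n h - 1) * hat f n.
  by rewrite hatB ?hat_shift ?mulrBl ?mul1r//; [case: cfh|case: cf].
rewrite cmodM exprMn mulrC ler_wpM2r ?sqr_ge0//.
rewrite cmod_sqr /expi /= subr0.
have : cos (n%:~R * h) <= 0 :> R.
  have n0 : 0 <= `|n%:~R * h| by [].
  have h0 : 0 < h by rewrite divr_gt0 ?pi_gt0// exprn_gt0.
  have h1 : (pi : R) / 2 <= `|n%:~R * h| <= pi.
    have -> : `|n%:~R * h| = (`|n|%N)%:R * h.
      by rewrite normrM (ger0_norm (ltW h0)) natr_absz intr_norm.
    have e2 : 2 ^+ i.+1 * h = pi.
      by rewrite /h mulrCA mulfV ?mulr1// expf_eq0.
    have : (2 ^ i)%:R <= (`|n|%N)%:R :> R by rewrite ler_nat; case/andP: nB.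
    have : (`|n|%N)%:R <= (2 ^ i.+1)%:R :> R by rewrite ler_nat; case/andP: nB => _ /ltnW.
    move: e2; rewrite !natrX exprS; have := pi_gt0 R; nra.
  rewrite -cos_norm -cos_pihalf.
  have [->//|ne] := eqVneq `|n%:~R * h| (pi / 2).
  rewrite ltW// ltr_cos ?in_itv /=; have := pi_gt0 R; last by move: ne; rewrite neq_lt => /orP[]; lra.
    by lra.
  by lra.
have := cos2Dsin2 (n%:~R * h); nra.
Qed.

Lemma geo_sum (r : R) I : 0 <= r < 1 -> \sum_(i < I) r ^+ i <= (1 - r)^-1.
Proof.
move=> r01; rewrite -[leRHS]mul1r ler_pdivlMr ?subr_gt0; last by lra.
have := subrX1 r I; rewrite -[X in _ = _ * X](big_mkord xpredT (fun i => r ^+ i)) big_mkord => h.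
have : 0 <= r ^+ I by rewrite exprn_ge0//; lra.
nra.
Qed.

Definition lip f (L : R) := forall x y : R, cmod (f x - f y) <= L * `|x - y|.

(** Bernstein's theorem for Lipschitz functions: on the i-th block the l^2 sum of squares is O(L^2
    4^-i), the l^1 sum is O(L 2^(-i/2)) by Cauchy-Schwarz, and with the weight 2^(is) the series
    over i stays geometric for s < 1/2. *)
Lemma bernstein s : 0 <= s < 1 / 2 -> exists2 K : R, 0 < K & forall f B L, contp f ->
  (forall t, cmod (f t) <= B) -> lip f L -> A1 s f (K * (B + L)).
Proof.
move=> s12; pose k : R := 2 `^ (1 / 2).
have k0 : 0 < k by rewrite powR_gt0.
have k2 : k ^+ 2 = 2 by rewrite /k -powR_mulrn ?powR_ge0// -powRrM (_ : 1 / 2 * 2%:R = 1) ?powRr1//; lra.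
pose r : R := 2 `^ s / k.
have r01 : 0 <= r < 1.
  rewrite divr_ge0 ?powR_ge0 ?ltW//= ltr_pdivrMr// mul1r /k.
  rewrite /powR pnatr_eq0 /= ltr_expR ltr_pM2r ?ln_gt0//; lra.
have s2 : 2 `^ s <= 2 :> R.
  by rewrite -[leRHS]powRr1// ler_powR//; lra.
have s20 : 0 < 2 `^ s :> R by rewrite powR_gt0.
exists (2 + 6 / (1 - r)).
  by rewrite ltr_wpDr// divr_ge0//; lra.
move=> f B L cf fB fL; split=> // F uF.
have B0 : 0 <= B := le_trans (cmod_ge0 _) (fB 0).
have L0 : 0 <= L by have := le_trans (cmod_ge0 _) (fL 1 0); rewrite subr0 normr1 mulr1.
(* The weight [l] below divides by the Lipschitz constant, so a positive one is treated and L is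
   approached from above. *)
suff H (L' : R) : 0 < L' -> lip f L' ->
    \sum_(n <- F) cmod (hat f n) * w R n `^ s <= 2 * B + 6 / (1 - r) * L'.
  apply/ler_addgt0Pr => e e0.
  have D0 : 0 < 6 / (1 - r) by rewrite divr_gt0//; lra.
  have := H (L + e / (6 / (1 - r))).
  rewrite ltr_wpDl ?(divr_gt0 e0 D0)// => /(_ isT) H'.
  rewrite (le_trans (H' _))//.
    by move=> x y; rewrite (le_trans (fL x y))// ler_wpM2r// lerDl ltW// divr_gt0.
  rewrite mulrDr [X in _ + (_ + X)]mulrC divfK ?gt_eqF//.
  have : 0 <= 6 / (1 - r) * B by rewrite mulr_ge0// ltW.
  nra.
move=> {fL L L0} L0 fL.
have [I FI] := seq_lt_pow F.
have bl i G : uniq G -> (forall n, n \in G -> block i n) ->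
    \sum_(n <- G) cmod (hat f n) * w R n `^ s <= 6 * L' * r ^+ i.
  move=> uG GB.
  have := block_bessel cf uG GB; set S := \sum_(n <- G) _ ^+ 2 => hS.
  have hS2 : S <= 2 * L' ^+ 2 / 4 ^+ i.
    rewrite (le_trans hS)// ler_pdivrMr//.
    set h := pi / _.
    have h2 : h <= 2 / 2 ^+ i.
      rewrite /h exprS invfM mulrA ler_wpM2r ?invr_ge0 ?exprn_ge0//.
      by rewrite ler_pdivrMr//; have := pihalf_lt2 R; lra.
    have h0 : 0 <= h by rewrite divr_ge0 ?pi_ge0 ?exprn_ge0.
    rewrite (_ : _ * 2 = (L' * (2 / 2 ^+ i)) ^+ 2); last first.
      have -> : 4 ^+ i = (2 ^+ i) ^+ 2 :> R.
        by rewrite -exprM mulnC exprM; congr (_ ^+ _); ring.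
      by field; rewrite expf_neq0.
    rewrite -[leRHS]mean_cst; apply: mean_le.
    - have := cont_cmod (contpB (contp_shift h cf) cf).2 => cc t.
      by under eq_fun do rewrite expr2; apply: cvgM; exact: cc.
    - exact: cst_continuous.
    - move=> t _; apply: lerXn2r; rewrite ?nnegrE ?cmod_ge0 ?mulr_ge0 ?(ltW L0) ?divr_ge0 ?exprn_ge0//.
      rewrite (le_trans (fL _ _))// addrAC subrr add0r ger0_norm// ler_pM2l//.
  (* Since [k] is the square root of 2, this is 2^(3i/2) / L': it balances the two terms of 2 x <= l
     x^2 + 1 / l when summed over at most 4 * 2^i frequencies. *)
  pose l : R := k ^+ (3 * i) / L'.
  have l0 : 0 < l by rewrite divr_gt0// exprn_gt0.
  have ki : 0 < k ^+ i by rewrite exprn_gt0.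
  have hl : \sum_(n <- G) cmod (hat f n) <= 3 * L' / k ^+ i.
    rewrite (@le_trans _ _ (\sum_(n <- G) (l * cmod (hat f n) ^+ 2 + l^-1) / 2))//.
      apply: ler_sum => n _; rewrite ler_pdivlMr//.
      rewrite -subr_ge0.
      have -> : l * cmod (hat f n) ^+ 2 + l^-1 - cmod (hat f n) * 2 =
        (l * cmod (hat f n) - 1) ^+ 2 / l by field; rewrite gt_eqF.
      by rewrite divr_ge0 ?sqr_ge0// ltW.
    rewrite -mulr_suml big_split /= -mulr_sumr big_const_seq count_predT iter_addr_0 -/S.
    have sz : l^-1 *+ size G <= 4 * 2 ^+ i * l^-1.
      rewrite -[leLHS]mulr_natl ler_wpM2r ?invr_ge0 ?(ltW l0)// -natrX -natrM ler_nat.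
      exact: block_size.
    have lS : l * S <= l * (2 * L' ^+ 2 / 4 ^+ i) by rewrite ler_pM2l.
    have e1 : l * (2 * L' ^+ 2 / 4 ^+ i) = 2 * L' / k ^+ i.
      have -> : 4 ^+ i = (k ^+ i) ^+ 4.
        by rewrite -exprM mulnC exprM; congr (_ ^+ _); rewrite (exprM k 2 2) k2; ring.
      rewrite /l mulnC exprM; field.
      by rewrite gt_eqF//= gt_eqF.
    have e2 : 4 * 2 ^+ i * l^-1 = 4 * L' / k ^+ i.
      have -> : 2 ^+ i = (k ^+ i) ^+ 2 by rewrite -exprM mulnC exprM k2.
      rewrite /l [(3 * i)%N]mulnC exprM; field.
      by rewrite gt_eqF//= gt_eqF.
    rewrite e1 in lS; rewrite e2 in sz.
    rewrite ler_pdivrMr//; have e3 : 3 * L' / k ^+ i * 2 = 2 * L' / k ^+ i + 4 * L' / k ^+ i by ring.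
    by rewrite e3 lerD.
  rewrite (@le_trans _ _ (\sum_(n <- G) cmod (hat f n) * (2 * (2 `^ s) ^+ i)))//.
    rewrite big_seq [leRHS]big_seq; apply: ler_sum => n nG; rewrite ler_wpM2l ?cmod_ge0//.
    have wb := block_w (GB n nG).
    rewrite (@le_trans _ _ ((2 ^+ i.+1) `^ s))//.
      by rewrite ge0_ler_powR ?nnegrE ?exprn_ge0 ?(ltW (w_gt0 _ _))//; lra.
    by rewrite -powR_mulrn// -powRrM mulrC powRrM powR_mulrn ?powR_ge0// exprS ler_wpM2r// exprn_ge0// ltW.
  rewrite -mulr_suml (le_trans (ler_wpM2r _ hl))//.
  rewrite /r expr_div_n le_eqVlt; apply/orP; left; apply/eqP; field.
  by rewrite gt_eqF.
have := block_sum bl _ uF FI.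
rewrite mulr_ge0 ?cmod_ge0 ?wt_ge0// => /(_ isT) h; rewrite (le_trans h)// lerD//.
  by rewrite /w absz0 addr0 powR1 mulr1; apply: cmod_hat_le => //; case: cf.
rewrite -mulr_sumr (le_trans (ler_wpM2l _ (geo_sum I r01)))//; first by rewrite mulr_ge0// ltW.
by rewrite le_eqVlt; apply/orP; left; apply/eqP; ring.
Qed.

End WienerAlgebra.

Section Wiener.
Variable R : realType.
Implicit Types (f g : R -> R[i]) (u v : R -> R) (z : R[i]) (n m : int) (s e : R).

Lemma sin_le_id (x : R) : 0 <= x -> sin x <= x.
Proof.
rewrite le_eqVlt => /predU1P[<-|x0]; first by rewrite sin0.
have [c hc] := @MVT R sin cos 0 x x0 (fun y _ => is_derive_sin y) (continuous_subspaceT (@continuous_sin R)).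
rewrite sin0 !subr0 => ->; have := cos_le1 c; nra.
Qed.

Lemma expi_lip n : lip (@expi R n) (`|n|%N)%:R.
Proof.
move=> x y; have -> : @expi R n x - expi n y = expi n y * (expi 1 (n%:~R * (x - y)) - 1).
  rewrite mulrBr mulr1; congr (_ - _).
  by rewrite -{1}(subrK y x) addrC expiDt; congr (_ * _); rewrite /expi mul1r.
rewrite cmodM cmod_expi mul1r cmodBC natr_absz intr_norm -normrM.
move: (n%:~R * (x - y)) => h.
rewrite -(@ler_pXn2r _ 2)// ?nnegrE ?cmod_ge0// cmod_expi1_sqr.
have c2 : cos h = 1 - 2 * sin (`|h| / 2) ^+ 2.
  rewrite -cos_norm; have := cos_mulr2n (`|h| / 2); rewrite (_ : `|h| / 2 *+ 2 = `|h|); last by rewrite mulr2n; lra.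
  by move=> ->; rewrite sin2cos2; ring.
have h0 : 0 <= `|h| / 2 by rewrite divr_ge0.
have s1 := sin_le_id h0.
have s2 : - sin (`|h| / 2) <= `|h| / 2.
  rewrite -sinN.
  have [hp|hp] := leP (`|h| / 2) pi.
    by rewrite sinN; have := @sin_ge0_pi R (`|h| / 2); rewrite h0 hp => /(_ isT); lra.
  by rewrite (le_trans (sin_le1 _))//; have := pi_ge2 R; lra.
rewrite c2; nra.
Qed.

Lemma lip_psum (a : int -> R[i]) N : exists2 L : R, 0 <= L & lip (psum a N) L.
Proof.
exists (\sum_(n <- zr N) cmod (a n) * (`|n|%N)%:R).
  by apply: sumr_ge0 => n _; rewrite mulr_ge0// cmod_ge0.
move=> x y; rewrite /psum -sumrB mulr_suml (le_trans (cmod_sum _ _ _))//.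
apply: ler_sum => n _; rewrite -mulrBr cmodM -mulrA ler_wpM2l ?cmod_ge0//.
exact: expi_lip.
Qed.

(** Beyond the geometric factor m^-(j+1) the Lipschitz constant grows only linearly in j; this makes
    the expansion in [A1_inv] converge. *)
Lemma lip_inv_exp f (L m : R) (j : nat) : 0 < m -> 0 <= L -> (forall t, m <= cmod (f t)) -> lip f L ->
  lip (fun t => (f t)^-1 ^+ j) (j%:R * m^-1 ^+ j.+1 * L).
Proof.
move=> m0 L0 fm fL x y; elim: j => [|j IH].
  by rewrite !expr0 subrr cmod0 !mul0r.
have fi t : cmod (f t)^-1 <= m^-1.
  rewrite cmodV lef_pV2 ?posrE//; exact: lt_le_trans (fm t).
have f0 t : f t != 0.
  by apply/eqP => ft; have := fm t; rewrite ft cmod0 leNgt m0.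
have mi : 0 <= m^-1 by rewrite invr_ge0 ltW.
have d1 : cmod ((f x)^-1 - (f y)^-1) <= m^-1 ^+ 2 * L * `|x - y|.
  have -> : (f x)^-1 - (f y)^-1 = (f x)^-1 * (f y)^-1 * (f y - f x).
    by field; rewrite !f0.
  rewrite cmodM cmodM expr2 -[leRHS]mulrA cmodBC.
  by apply: ler_pM; rewrite ?mulr_ge0 ?cmod_ge0//; apply: ler_pM; rewrite ?cmod_ge0.
have -> : (f x)^-1 ^+ j.+1 - (f y)^-1 ^+ j.+1 =
  (f x)^-1 * ((f x)^-1 ^+ j - (f y)^-1 ^+ j) + ((f x)^-1 - (f y)^-1) * (f y)^-1 ^+ j.
  by rewrite !exprS; ring.
rewrite (le_trans (cmodD _ _))// !cmodM cmodX.
have h1 : cmod (f x)^-1 * cmod ((f x)^-1 ^+ j - (f y)^-1 ^+ j) <=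
  m^-1 * (j%:R * m^-1 ^+ j.+1 * L * `|x - y|) by apply: ler_pM; rewrite ?cmod_ge0.
have h2 : cmod ((f x)^-1 - (f y)^-1) * cmod (f y)^-1 ^+ j <=
  m^-1 ^+ 2 * L * `|x - y| * m^-1 ^+ j.
  apply: ler_pM; rewrite ?cmod_ge0 ?exprn_ge0 ?cmod_ge0//.
  by apply: lerXn2r; rewrite ?nnegrE ?cmod_ge0.
rewrite (le_trans (lerD h1 h2))// le_eqVlt; apply/orP; left; apply/eqP.
rewrite -natr1 !exprS; ring.
Qed.

(* Newman's proof of Wiener's lemma: expand 1 / F around a trigonometric
   polynomial Q close to F; the powers 1 / Q ^ j are controlled by [bernstein]
   with a loss that is only polynomial in j. *)
Lemma A1_inv s f C : 0 <= s < 1 / 2 -> A1 s f C -> (forall t, f t != 0) ->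
  exists D, A1 s (fun t => (f t)^-1) D.
Proof.
move=> s12 fC f0; have s0 : 0 <= s by case/andP: s12.
have [c c0 hc] := contp_lbnd fC.1 f0.
have c4 : 0 < c / 4 by lra.
have [N /(_ _ (leqnn _)) hN] := A1_approx c4 fC.
set Q := psum (hat f) N in hN.
have cQ : contp Q by exact: contp_psum.
have fQ t : cmod (f t - Q t) <= c / 4 by exact: (A1_sup t s0 hN).
(* |f - Q| <= c/4 and |Q| >= 3c/4 give the ratio 1/3; the factor j + 1 <= 2^j from the Lipschitz
   constants worsens it to 2/3, which still sums. *)
pose m := c * 3 / 4; have m0 : 0 < m by rewrite /m; lra.
have Qm t : m <= cmod (Q t).
  have := cmod_dist (f t) (f t - Q t); rewrite opprB addrCA subrr addr0.
  by have := fQ t; have := hc t; rewrite /m; lra.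
have Q0 t : Q t != 0 by apply/eqP => Qt; have := Qm t; rewrite Qt cmod0 leNgt m0.
have [L L0 QL] := lip_psum (hat f) N.
have [K K0 hK] := bernstein s12.
have mi : 0 <= m^-1 by rewrite invr_ge0 ltW.
have QA j : A1 s (fun t => (Q t)^-1 ^+ j.+1)
    (K * (m^-1 ^+ j.+1 + j.+1%:R * m^-1 ^+ j.+2 * L)).
  apply: hK; first by apply: contpX; exact: contp_inv.
    move=> t; rewrite cmodX ler_pXn2r// ?nnegrE ?cmod_ge0// cmodV lef_pV2 ?posrE//.
    exact: lt_le_trans (Qm t).
  exact: lip_inv_exp.
pose T j t := (- (f t - Q t)) ^+ j * (Q t)^-1 ^+ j.+1.
pose E : R := K * (m^-1 + m^-1 ^+ 2 * L).
have E0 : 0 <= E by rewrite mulr_ge0 ?(ltW K0)// addr_ge0// ?mulr_ge0 ?exprn_ge0.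
have TA j : A1 s (T j) (E * (2 / 3) ^+ j).
  have := A1M s0 (A1X j s0 (A1N hN)) (QA j); apply: A1_leC.
  have e3 : (c / 4) ^+ j * m^-1 ^+ j = 3^-1 ^+ j.
    by rewrite -exprMn; congr (_ ^+ _); rewrite /m; field; rewrite gt_eqF.
  have -> : (c / 4) ^+ j * (K * (m^-1 ^+ j.+1 + j.+1%:R * m^-1 ^+ j.+2 * L)) =
      K * (m^-1 + j.+1%:R * (m^-1 ^+ 2 * L)) * 3^-1 ^+ j.
    by rewrite -e3 !exprS expr0 mulr1; ring.
  rewrite [(2 / 3) ^+ j]exprMn [leRHS]mulrA ler_wpM2r ?exprn_ge0 ?invr_ge0//.
  have j1 : 1 <= j.+1%:R :> R by rewrite ler1n.
  have j2 : j.+1%:R <= 2 ^+ j :> R by rewrite -natrX ler_nat ltn_expl.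
  have mL : 0 <= m^-1 ^+ 2 * L by rewrite mulr_ge0// exprn_ge0.
  rewrite /E -mulrA ler_pM2l// mulrDl lerD//; last by rewrite mulrC ler_wpM2l.
  by rewrite ler_peMr//; lra.
exists (E * 3); apply: A1_lim => e e0.
have [J hJ] : exists J, (3^-1 : R) ^+ J / c <= e.
  have := cvg_expr (z := 3^-1 : R) ltac:(by rewrite ger0_norm ?invr_ge0// invf_lt1// ltr1n).
  move=> /cvgrPdist_le /(_ (e * c) (mulr_gt0 e0 c0)) [J _ /(_ J (leqnn _))].
  rewrite sub0r normrN ger0_norm ?exprn_ge0 ?invr_ge0// => h.
  by exists J; rewrite ler_pdivrMr.
exists (fun t => \sum_(j <- iota 0 J) T j t).
  have := A1_sum (iota 0 J) TA; apply: A1_leC.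
  rewrite -mulr_sumr ler_wpM2l// -[iota 0 J](_ : index_iota 0 J = _); last by rewrite /index_iota subn0.
  rewrite big_mkord (le_trans (geo_sum J _))//; first by apply/andP; split; lra.
  by rewrite -[leRHS]invrK lef_pV2 ?posrE; lra.
move=> t; have -> : (f t)^-1 - \sum_(j <- iota 0 J) T j t = (- (f t - Q t)) ^+ J * (Q t)^-1 ^+ J / f t.
  elim: J {hJ} => [|J IH]; first by rewrite big_nil subr0 !expr0 !mul1r.
  rewrite -addn1 iotaD big_cat big_seq1 /= opprD addrA IH /T add0n addn1 !exprS.
  by field; rewrite f0 Q0.
rewrite !cmodM !cmodX cmodN !cmodV (le_trans _ hJ)// -exprMn.
have ge t' : 0 <= cmod (f t' - Q t') / cmod (Q t') by rewrite divr_ge0 ?cmod_ge0.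
apply: ler_pM; rewrite ?exprn_ge0 ?invr_ge0 ?cmod_ge0//; last first.
  by rewrite lef_pV2 ?posrE//; exact: lt_le_trans (hc t).
apply: lerXn2r; rewrite ?nnegrE ?invr_ge0//.
rewrite ler_pdivrMr; last exact: lt_le_trans (Qm t).
by have := Qm t; have := fQ t; rewrite /m; lra.
Qed.

End Wiener.

(** * Hahn-Banach for sequences and the dual of the quotient by the span of P f *)

Section HahnBanach.
Variable R : realType.
Implicit Types (c d : nat -> R).

Definition supp_lt n c := forall i, (n <= i)%N -> c i = 0.

(* Values of the functional on the first n basis vectors, chosen one at a time. *)
Fixpoint hb_vals (N : (nat -> R) -> R) n : seq R :=
  if n is n'.+1 then
    let t := hb_vals N n' in
    rcons t (sup [set \sum_(i < n') c i * nth 0 t i - N (fun i => c i - (i == n')%:R)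
                 | c in supp_lt n'])
  else [::].

(** With a countable basis the extension goes one vector at a time: subadditivity puts every lower
    bound for the next value below every upper bound ([key]), and the supremum of the lower ones is
    taken. A general c is reduced to these bounds by dividing by the absolute value of its last
    coordinate. *)
Lemma hahn_banach_seq (N : (nat -> R) -> R) :
  (forall n c d, supp_lt n c -> supp_lt n d -> N (fun i => c i + d i) <= N c + N d) ->
  (forall n c (k : R), supp_lt n c -> k != 0 -> N (fun i => k * c i) = `|k| * N c) ->
  N (fun=> 0) = 0 ->
  exists t : nat -> R, `|t 0%N| = `|N (fun i => (i == 0%N)%:R)| /\
    forall n c, supp_lt n c -> \sum_(i < n) c i * t i <= N c.
Proof.
move=> Nsub Nhom N0; pose t i := nth 0 (hb_vals N i.+1) i.
have sz n : size (hb_vals N n) = n by elim: n => //= n IH; rewrite size_rcons IH.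
have tE n i : (i < n)%N -> nth 0 (hb_vals N n) i = t i.
  elim: n => // n IH; rewrite ltnS leq_eqVlt => /predU1P[->//|ni].
  by rewrite /= nth_rcons sz ni IH.
pose e n : nat -> R := fun i => (i == n)%:R.
have tS n : t n = sup [set \sum_(i < n) c i * t i - N (fun i => c i - (i == n)%:R) | c in supp_lt n].
  rewrite {1}/t /= nth_rcons sz ltnn eqxx; congr sup; apply: eq_imagel => c _.
  by congr (_ - _); apply: eq_bigr => i _; rewrite tE.
have sW n c : supp_lt n c -> supp_lt n.+1 c by move=> h i ni; apply: h; exact: ltnW.
have se n k : supp_lt n.+1 (fun i => k * (i == n)%:R).
  by move=> i ni; rewrite gtn_eqF ?mulr0.
have NN n c : supp_lt n c -> N (fun i => - c i) = N c.
  move=> h; have := Nhom n c (-1) h; rewrite normrN1 mul1r => <-; last by rewrite oppr_eq0 oner_eq0.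
  by congr N; apply/funext => i; rewrite mulN1r.
exists t; split.
  (* At stage 0 the supremum runs over the single number - N e_0, so up to sign the functional
     attains N at the first vector. *)
  rewrite tS (_ : [set _ | c in _] = [set - N (e 0%N)]) ?sup1 ?normrN//.
  apply/seteqP; split=> [_ [c h <-]|_ ->].
    rewrite big_ord0 sub0r /=; congr (- _); rewrite -(NN 1%N (e 0%N)); last first.
      by move=> i i0; rewrite /e gtn_eqF.
    by congr N; apply/funext => i; rewrite h// sub0r.
  exists (fun=> 0) => //; rewrite big_ord0 sub0r; congr (- _).
  rewrite -(NN 1%N (e 0%N)); last by move=> i i0; rewrite /e gtn_eqF.
  by congr N; apply/funext => i; rewrite sub0r.
elim=> [|n IH] c hc.
  rewrite big_ord0 (_ : c = fun=> 0) ?N0//.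
  by apply/funext => i; rewrite hc.
have key c1 c2 : supp_lt n c1 -> supp_lt n c2 ->
    \sum_(i < n) c1 i * t i - N (fun i => c1 i - (i == n)%:R) <=
    N (fun i => c2 i + (i == n)%:R) - \sum_(i < n) c2 i * t i.
  move=> h1 h2; rewrite lerBlDr -addrAC lerBrDr -big_split /=.
  have h12 : supp_lt n (fun i => c1 i + c2 i) by move=> i ni; rewrite h1// h2// addr0.
  have -> : \sum_(i < n) (c1 i * t i + c2 i * t i) = \sum_(i < n) (c1 i + c2 i) * t i.
    by apply: eq_bigr => i _; rewrite mulrDl.
  apply: (le_trans (IH _ h12)); rewrite [leRHS]addrC.
  have := Nsub n.+1 (fun i => c1 i - (i == n)%:R) (fun i => c2 i + (i == n)%:R).
  rewrite (_ : (fun i => c1 i - (i == n)%:R + (c2 i + (i == n)%:R)) = fun i => c1 i + c2 i).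
    by apply; move=> i ni; rewrite ?h1 ?h2 ?(ltnW ni)// gtn_eqF// ?subr0 ?addr0.
  by apply/funext => i; ring.
have z0 : supp_lt n (fun=> 0 : R) by [].
pose A := [set \sum_(i < n) c i * t i - N (fun i => c i - (i == n)%:R) | c in supp_lt n].
have ubA : ubound A (N (fun i => 0 + (i == n)%:R) - \sum_(i < n) 0 * t i).
  by move=> _ [c1 h1 <-]; exact: key.
have A0 : A !=set0 by exists (\sum_(i < n) 0 * t i - N (fun i => 0 - (i == n)%:R)), (fun=> 0).
have lo c1 : supp_lt n c1 -> \sum_(i < n) c1 i * t i - N (fun i => c1 i - (i == n)%:R) <= t n.
  by move=> h1; rewrite tS; apply: ub_le_sup; [exists (N (fun i => 0 + (i == n)%:R) - \sum_(i < n) 0 * t i)|exists c1].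
have hi c2 : supp_lt n c2 -> t n <= N (fun i => c2 i + (i == n)%:R) - \sum_(i < n) c2 i * t i.
  by move=> h2; rewrite tS; apply: ge_sup => // _ [c1 h1 <-]; exact: key.
rewrite big_ord_recr /=; set l := c n.
pose c' i := if (i < n)%N then c i else 0.
have hc' : supp_lt n c' by move=> i ni; rewrite /c' ltnNge ni.
have cE : c = fun i => c' i + l * (i == n)%:R.
  apply/funext => i; rewrite /c'; case: (ltngtP i n) => [ni|ni|->]; rewrite ?mulr0 ?addr0 ?mulr1 ?add0r//.
  by rewrite hc.
have sumE : \sum_(i < n) c i * t i = \sum_(i < n) c' i * t i.
  by apply: eq_bigr => i _; rewrite /c' ltn_ord.
rewrite sumE; have [l0|l0|l0] := ltgtP l 0.
- have hd : supp_lt n (fun i => (- l)^-1 * c' i) by move=> i ni; rewrite hc'// mulr0.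
  have := lo _ hd; rewrite -(ler_pM2l (x := - l)) ?oppr_gt0// mulrBr.
  have nl : - l != 0 by rewrite oppr_eq0 lt_eqF.
  have sw : supp_lt n.+1 (fun i => (- l)^-1 * c' i - (i == n)%:R).
    by move=> i ni; rewrite hc' ?(ltnW ni)// gtn_eqF// mulr0 subr0.
  have := Nhom n.+1 _ (- l) sw nl; rewrite ger0_norm ?oppr_ge0 ?(ltW l0)// => <-.
  have -> : (fun i => - l * ((- l)^-1 * c' i - (i == n)%:R)) = c.
    by apply/funext => i; rewrite mulrBr mulVKf// cE mulNr opprK.
  rewrite mulr_sumr (eq_bigr (fun i : 'I_n => c' i * t i)); last by move=> i _; rewrite -mulrA mulVKf.
  by rewrite mulNr; lra.
- have hd : supp_lt n (fun i => l^-1 * c' i) by move=> i ni; rewrite hc'// mulr0.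
  have := hi _ hd; rewrite -(ler_pM2l l0) mulrBr.
  have nl : l != 0 by rewrite gt_eqF.
  have sw : supp_lt n.+1 (fun i => l^-1 * c' i + (i == n)%:R).
    by move=> i ni; rewrite hc' ?(ltnW ni)// gtn_eqF// mulr0 addr0.
  have := Nhom n.+1 _ l sw nl; rewrite ger0_norm ?(ltW l0)// => <-.
  have -> : (fun i => l * (l^-1 * c' i + (i == n)%:R)) = c.
    by apply/funext => i; rewrite mulrDr mulVKf// cE.
  rewrite mulr_sumr (eq_bigr (fun i : 'I_n => c' i * t i)); last by move=> i _; rewrite -mulrA mulVKf.
  by lra.
- rewrite l0 mul0r addr0; have -> : c = c'; last exact: IH.
  by rewrite cE l0; apply/funext => i; rewrite mul0r addr0.
Qed.

Definition int_dec (k : nat) : int := if odd k then Negz k./2 else k./2%:Z.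
Definition int_code (m : int) : nat := match m with Posz j => j.*2 | Negz j => j.*2.+1 end.

Lemma int_codeK : cancel int_code int_dec.
Proof.
case=> j; rewrite /int_dec /= ?odd_double /= ?uphalf_double ?doubleK//.
Qed.
Lemma int_decK : cancel int_dec int_code.
Proof.
move=> k; rewrite /int_dec; case: ifP => o /=; have := odd_double_half k; rewrite o; lia.
Qed.

Definition restr (F : seq int) (a : int -> R[i]) m := if m \in F then a m else 0.

(** Real and imaginary parts of each coordinate are separate real basis vectors, enumerated from n0
    so that N is attained at n0. With s = t_even - i t_odd the real functional is the real part of
    the pairing; testing it on multiples by 1, -1, i and -i bounds the modulus, with a factor 2. *)
Lemma hahn_banach_int (N : (int -> R[i]) -> R) (n0 : int) :
  (forall F a b, N (fun m => restr F a m + restr F b m) <= N (restr F a) + N (restr F b)) ->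
  (forall F a (z : R[i]), z != 0 -> N (fun m => z * restr F a m) = cmod z * N (restr F a)) ->
  N (fun=> 0) = 0 -> 0 < N (fun m => (m == n0)%:R) ->
  exists s : int -> R[i], s n0 != 0 /\
    forall F a, uniq F -> cmod (\sum_(m <- F) a m * s m) <= 2 * N (restr F a).
Proof.
move=> Nsub Nhom N0 Npos.
pose k m := int_code (m - n0).
pose A (c : nat -> R) m : R[i] := c (k m).*2 +i* c (k m).*2.+1.
have A_restr n c : supp_lt n c -> A c = restr [seq int_dec j + n0 | j <- iota 0 n] (A c).
  move=> h; apply/funext => m; rewrite /restr; case: ifPn => // hm.
  have hk : (n <= k m)%N.
    rewrite leqNgt; apply: contra hm => kn; apply/mapP; exists (k m); first by rewrite mem_iota.
    by rewrite /k int_codeK subrK.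
  by rewrite /A !h//; lia.
have [|||t [t0 ht]] := @hahn_banach_seq (fun c => N (A c)).
- move=> n c d hc hd; have -> : A (fun i => c i + d i) = fun m => A c m + A d m.
    by apply/funext.
  by rewrite (A_restr _ _ hc) (A_restr _ _ hd); exact: Nsub.
- move=> n c r hc r0; have -> : A (fun i => r * c i) = fun m => r%:C * A c m.
    by apply/funext => m; rewrite /A; simpc.
  rewrite (A_restr _ _ hc) Nhom ?cmod_real//.
  by apply: contra r0 => /eqP /complexI ->.
- by rewrite (_ : A _ = fun=> 0).
- pose s m : R[i] := t (k m).*2 -i* t (k m).*2.+1.
  have AE : A (fun i => (i == 0)%N%:R) = fun m => (m == n0)%:R.
    apply/funext => m; rewrite /A /=; have -> : (m == n0) = ((k m).*2 == 0)%N.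
      rewrite double_eq0 /k -[RHS](inj_eq (can_inj int_decK)) int_codeK /int_dec /=.
      by rewrite subr_eq0.
    by case: (_ == _).
  exists s; split.
    apply/eqP => s0; have : t 0%N = 0.
      by have := congr1 (@complex.Re R) s0; rewrite /= /k subrr.
    move=> t00; move: t0; rewrite t00 normr0 AE gtr0_norm//; lra.
  have reE F a : uniq F -> complex.Re (\sum_(m <- F) a m * s m) <= N (restr F a).
    move=> uF; pose c i := if odd i then complex.Im (restr F a (int_dec i./2 + n0))
      else complex.Re (restr F a (int_dec i./2 + n0)).
    have Ac : A c = restr F a.
      apply/funext => m; rewrite /A /c /= odd_double /= uphalf_double doubleK /k int_codeK subrK.
      by case: (restr F a m).
    pose K := (\max_(m <- F) (k m).+1)%N.
    have KF m : m \in F -> (k m < K)%N.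
      by move=> mF; exact: (@leq_bigmax_seq _ F xpredT (fun m => (k m).+1) m).
    have cK : supp_lt K.*2 c.
      move=> i Ki; have : int_dec i./2 + n0 \notin F.
        apply/negP => /KF; rewrite /k addrK int_decK; lia.
      by rewrite /c /restr => /negbTE ->; case: ifP.
    rewrite -Ac (le_trans _ (ht _ _ cK))// le_eqVlt; apply/orP; left; apply/eqP.
    transitivity (complex.Re (\sum_(j <- iota 0 K) restr F a (int_dec j + n0) * s (int_dec j + n0))).
      congr complex.Re; rewrite -(big_map (fun j => int_dec j + n0) xpredT (fun m => restr F a m * s m)).
      rewrite [RHS](bigID (mem F)) /= [X in _ + X]big1 ?addr0; last first.
        by move=> m mF; rewrite /restr (negbTE mF) mul0r.
      rewrite -[RHS]big_filter big_seq [RHS]big_seq.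
      transitivity (\sum_(m <- F | m \in F) restr F a m * s m).
        by apply: eq_bigr => m mF; rewrite /restr mF.
      rewrite -!big_seq; apply: perm_big; apply: uniq_perm => //.
        by rewrite filter_uniq// map_inj_uniq ?iota_uniq// => x y /addIr /(can_inj int_decK).
      move=> m; rewrite mem_filter andb_idr// => mF; apply/mapP; exists (k m).
        by rewrite mem_iota KF.
      by rewrite /k int_codeK subrK.
    elim: K {KF cK} => [|K IH]; first by rewrite !big_nil big_ord0.
    rewrite -addn1 iotaD big_cat big_seq1 ReD IH addn1 doubleS !big_ord_recr /= -addrA; congr (_ + _).
    rewrite add0n /c /= odd_double /= uphalf_double doubleK ReM /s /k addrK int_decK /=; ring.
  move=> F a uF; set S := \sum_(m <- F) _.
  have scal z : z != 0 -> complex.Re (z * S) <= cmod z * N (restr F a).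
    move=> z0; rewrite -Nhom// (_ : (fun m => z * restr F a m) = restr F (fun m => z * a m)); last first.
      by apply/funext => m; rewrite /restr; case: ifP; rewrite ?mulr0.
    have -> : z * S = \sum_(m <- F) (z * a m) * s m.
      by rewrite mulr_sumr; apply: eq_bigr => m _; rewrite mulrA.
    exact: reE.
  have n1 : (-1 : R[i]) != 0 by rewrite oppr_eq0 oner_eq0.
  have ni : ('i : R[i]) != 0 by rewrite eq_complex /= oner_eq0 andbF.
  have := scal 1 (oner_neq0 _); have := scal (-1) n1; have := scal 'i ni.
  have := scal (- 'i) ltac:(by rewrite oppr_eq0).
  rewrite !cmodN !cmod1 (_ : cmod 'i = 1); last by rewrite cmodE /= expr0n expr1n add0r sqrtr1.
  rewrite mulN1r !mul1r => h1 h2 h3 h4.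
  rewrite (le_trans (cmod_le_ReIm _))// mulr_natl mulr2n; apply: lerD; rewrite ler_norml.
    by move: h3 h4; case: (S) => x y /=; lra.
  by move: h1 h2; case: (S) => x y /=; lra.
Qed.

End HahnBanach.

(** * Weighted l^p norms of coefficient sequences; trigonometric polynomials *)

Section Norms.
Variable R : realType.
Implicit Types (f g P : R -> R[i]) (z : R[i]) (n m : int) (s e p b : R) (a : int -> R[i]).

(* Np p b a C : the p-th power of the norm of a in the weighted l^p space is at most C. *)
Definition Np p b a (C : R) := bnd (fun n => cmod (a n) `^ p * w R n `^ (p * b)) C.

Lemma esum_bnd (x : int -> R) C : (forall n, 0 <= x n) ->
  (\esum_(n in [set: int]) (x n)%:E <= C%:E)%E <-> bnd x C.
Proof.
move=> x0; split=> [h F uF|h].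
  have : ((\sum_(n <- F) x n)%:E <= C%:E)%E.
    apply: le_trans h; apply: esum_ge; exists [set` F].
      by split => //; exact: finite_seq.
    by rewrite -fsbig_seq// sumEFin.
  by rewrite lee_fin.
apply: ub_ereal_sup => _ [A [fA _] <-].
rewrite fsbig_finite//= sumEFin lee_fin; apply: h.
exact: finmap.fset_uniq.
Qed.

Lemma Anorm_ltP p b S e : 0 < p -> 0 < e -> (Anorm p b S < e%:E)%E -> Np p b (fourier S) (e `^ p).
Proof.
move=> p0 e0; rewrite /Anorm; set X := (\esum_(_ in _) _)%E => h.
apply/esum_bnd => [n|]; first by rewrite mulr_ge0 ?powR_ge0.
have X0 : (0 <= X)%E by apply: esum_ge0 => n _; rewrite lee_fin mulr_ge0 ?powR_ge0.
rewrite -/X; have [r XE] : exists r, X = r%:E.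
  move: X X0 h => [r|//|//] _; first by exists r.
  by rewrite /= (negbTE (lt0r_neq0 _)) ?invr_gt0// ltNge leey.
move: h X0; rewrite XE poweR_EFin lte_fin !lee_fin => h r0.
rewrite -[leLHS]powRr1// -(mulVf (lt0r_neq0 p0)) powRrM.
by rewrite ge0_ler_powR ?nnegrE ?powR_ge0 ?(ltW p0) ?(ltW e0) ?(ltW h).
Qed.

Lemma Anorm_lt_ooP p b S : 0 < p -> (Anorm p b S < +oo)%E -> exists C, Np p b (fourier S) C.
Proof.
move=> p0 h; have : exists2 e : R, 0 < e & (Anorm p b S < e%:E)%E.
  move: h; case: (Anorm p b S) => [r _|//|_]; last by exists 1; rewrite ?ltNyr.
  by exists (`|r| + 1); rewrite ?ltr_wpDl// lte_fin (le_lt_trans (ler_norm r))// ltrDl.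
by move=> [e e0 h']; exists (e `^ p); exact: Anorm_ltP.
Qed.

Lemma Np_Anorm p b S e : 0 < p -> 0 < e -> Np p b (fourier S) (e `^ p) -> (Anorm p b S <= e%:E)%E.
Proof.
move=> p0 e0 /esum_bnd h.
have -> : e%:E = ((e `^ p)%:E `^ p^-1)%E.
  by rewrite poweR_EFin -powRrM mulfV ?gt_eqF// powRr1// ltW.
rewrite /Anorm; apply: gt0_ler_poweR; rewrite ?in_itv /= ?leey ?andbT ?invr_ge0 ?(ltW p0)//.
- by apply: esum_ge0 => n _; rewrite lee_fin mulr_ge0 ?powR_ge0.
- by rewrite lee_fin powR_ge0.
- by apply: h => n; rewrite mulr_ge0 ?powR_ge0.
Qed.

Lemma convex_pow p (x y l : R) : 1 <= p -> 0 <= x -> 0 <= y -> 0 <= l <= 1 ->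
  (l * x + (1 - l) * y) `^ p <= l * x `^ p + (1 - l) * y `^ p.
Proof.
move=> p1 x0 y0 l01.
have := @convex_powR R p p1 (Itv01 (proj1 (andP l01)) (proj2 (andP l01))) x y.
rewrite !inE /= !in_itv /= !andbT => /(_ x0 y0).
by rewrite !convRE.
Qed.

(** Minkowski's inequality from the convexity of the p-th power, applied to x / C and y / D with the
    weights C / (C + D) and D / (C + D). *)
Lemma minkowski_bnd p (W x y v : int -> R) (C D : R) : 1 <= p -> 0 < C -> 0 < D ->
  (forall n, 0 <= W n) -> (forall n, 0 <= x n) -> (forall n, 0 <= y n) ->
  (forall n, 0 <= v n <= x n + y n) ->
  bnd (fun n => x n `^ p * W n) (C `^ p) -> bnd (fun n => y n `^ p * W n) (D `^ p) ->
  bnd (fun n => v n `^ p * W n) ((C + D) `^ p).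
Proof.
move=> p1 C0 D0 W0 x0 y0 hv bx by_ F uF.
have p0 : 0 <= p by lra.
have CD0 : 0 < C + D by rewrite addr_gt0.
pose l := C / (C + D).
have l01 : 0 <= l <= 1 by rewrite divr_ge0 ?(ltW C0) ?(ltW CD0)//= ler_pdivrMr// mul1r; lra.
have pt n : v n `^ p <= (C + D) `^ p * (l / C `^ p * x n `^ p + (1 - l) / D `^ p * y n `^ p).
  have h := convex_pow p1 (divr_ge0 (x0 n) (ltW C0)) (divr_ge0 (y0 n) (ltW D0)) l01.
  have e1 : v n <= (C + D) * (l * (x n / C) + (1 - l) * (y n / D)).
    have -> : (C + D) * (l * (x n / C) + (1 - l) * (y n / D)) = x n + y n.
      by rewrite /l; field; rewrite !gt_eqF.
    by case/andP: (hv n).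
  have v0 : 0 <= v n by case/andP: (hv n).
  have m0 : 0 <= l * (x n / C) + (1 - l) * (y n / D).
    by rewrite addr_ge0// mulr_ge0 ?divr_ge0 ?(ltW C0) ?(ltW D0)//; lra.
  rewrite (@le_trans _ _ (((C + D) * (l * (x n / C) + (1 - l) * (y n / D))) `^ p))//.
    by rewrite ge0_ler_powR ?nnegrE// mulr_ge0// ltW.
  rewrite powRM ?(ltW CD0)// ler_wpM2l ?powR_ge0// (le_trans h)//.
  have iv (c : R) : 0 < c -> c^-1 `^ p = (c `^ p)^-1.
    by move=> c0; rewrite -(powR_inv1 (ltW c0)) -powRrM mulN1r powRN.
  rewrite (powRM _ (x0 n)) ?(powRM _ (y0 n)) ?invr_ge0 ?(ltW C0) ?(ltW D0)//.
  rewrite (iv _ C0) (iv _ D0).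
  by rewrite !mulrA [l * _ * _]mulrAC [(1 - l) * _ * _]mulrAC.
have Cp : 0 < C `^ p by rewrite powR_gt0.
have Dp : 0 < D `^ p by rewrite powR_gt0.
rewrite (@le_trans _ _ (\sum_(n <- F) (C + D) `^ p * (l / C `^ p * (x n `^ p * W n) + (1 - l) / D `^ p * (y n `^ p * W n))))//.
  by apply: ler_sum => n _; rewrite (le_trans (ler_wpM2r (W0 n) (pt n)))// le_eqVlt; apply/orP; left; apply/eqP; ring.
rewrite -mulr_sumr -[leRHS]mulr1 ler_wpM2l ?powR_ge0// big_split /= -!mulr_sumr.
have := bx F uF; have := by_ F uF => h1 h2.
have k1 : l / C `^ p * \sum_(n <- F) x n `^ p * W n <= l.
  by rewrite -mulrA ler_piMr//; [lra|rewrite mulrC ler_pdivrMr// mul1r].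
have k2 : (1 - l) / D `^ p * \sum_(n <- F) y n `^ p * W n <= 1 - l.
  by rewrite -mulrA ler_piMr//; [lra|rewrite mulrC ler_pdivrMr// mul1r].
lra.
Qed.

Lemma Np_add p b a1 a2 (C D : R) : 1 <= p -> 0 < C -> 0 < D ->
  Np p b a1 (C `^ p) -> Np p b a2 (D `^ p) -> Np p b (fun n => a1 n + a2 n) ((C + D) `^ p).
Proof.
move=> p1 C0 D0 h1 h2; apply: minkowski_bnd h1 h2 => // n; rewrite ?powR_ge0 ?cmod_ge0//.
by rewrite cmodD.
Qed.

Lemma Np_scale p b a z (C : R) : 0 <= C -> Np p b a (C `^ p) ->
  Np p b (fun n => z * a n) ((cmod z * C) `^ p).
Proof.
move=> C0 h F uF; rewrite powRM ?cmod_ge0// (le_trans _ (ler_wpM2l (powR_ge0 _ _) (h F uF)))//.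
by rewrite mulr_sumr; apply: ler_sum => n _; rewrite mulrA cmodM powRM ?cmod_ge0.
Qed.

Lemma powR_split (x p : R) : x != 0 -> 0 <= x -> x `^ p = x * x `^ (p - 1).
Proof.
move=> xn0 x0; rewrite -{2}(powRr1 x0) -powRD; last by rewrite xn0 implybT.
by rewrite addrCA subrr addr0.
Qed.

(** Each weighted term y is at most C, so y^p <= y C^(p-1). This is the embedding of A^1_b into
    A^p_b. *)
Lemma l1_Np p b a (C : R) : 1 <= p -> 0 < C -> bnd (fun n => cmod (a n) * w R n `^ b) C ->
  Np p b a (C `^ p).
Proof.
move=> p1 C0 h F uF.
have le1 n : cmod (a n) * w R n `^ b <= C.
  by have := h [:: n] isT; rewrite big_seq1.
have x0 n : 0 <= cmod (a n) * w R n `^ b by rewrite mulr_ge0 ?cmod_ge0 ?wt_ge0.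
rewrite (powR_split p (lt0r_neq0 C0) (ltW C0)).
rewrite (le_trans _ (ler_wpM2r (powR_ge0 _ _) (h F uF)))// mulr_suml.
apply: ler_sum => n _.
rewrite [p * b]mulrC powRrM -powRM ?cmod_ge0 ?wt_ge0//.
move: (x0 n) (le1 n); move: (_ * _) => y y0 yC.
have [->|yn0] := eqVneq y 0; first by rewrite powR0 ?mul0r//; lra.
by rewrite (powR_split p yn0 y0) ler_wpM2l// ge0_ler_powR ?nnegrE ?(ltW C0)//; lra.
Qed.

(* The frequencies x.1 may be repeated. *)
Definition tp P := exists F : seq (int * R[i]), forall t, P t = \sum_(x <- F) x.2 * expi x.1 t.

Lemma tp_trig P : tp P -> trig_poly P.
Proof.
move=> [F hF]; exists (undup [seq x.1 | x <- F]), (fun n => \sum_(x <- F | x.1 == n) x.2) => t.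
rewrite hF; under [RHS]eq_bigr do rewrite mulr_suml.
rewrite (exchange_big_dep xpredT)//= big_seq [RHS]big_seq.
apply: eq_bigr => x xF; rewrite [RHS]big_mkcond (bigD1_seq x.1) ?undup_uniq ?mem_undup ?map_f//=.
by rewrite eqxx big1 ?addr0// => n; rewrite eq_sym => /negbTE ->.
Qed.
Lemma tp_contp P : tp P -> contp P.
Proof.
move=> [F hF]; rewrite (_ : P = fun t => \sum_(x <- F) x.2 * expi x.1 t); last by apply/funext.
by apply: contp_sum => x; apply: contpM; [exact: contp_cst|exact: contp_expi].
Qed.
Lemma tpD P Q : tp P -> tp Q -> tp (fun t => P t + Q t).
Proof. by move=> [F hF] [G hG]; exists (F ++ G) => t; rewrite big_cat hF hG. Qed.
Lemma tpZ z P : tp P -> tp (fun t => z * P t).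
Proof.
move=> [F hF]; exists [seq (x.1, z * x.2) | x <- F] => t.
by rewrite hF big_map mulr_sumr; apply: eq_bigr => x _; rewrite mulrA.
Qed.
Lemma tp0 : tp (fun=> 0).
Proof. by exists [::] => t; rewrite big_nil. Qed.
Lemma tp_psum a N : tp (psum a N).
Proof. by exists [seq (n, a n) | n <- zr N] => t; rewrite big_map. Qed.
Lemma trig_tp P : trig_poly P -> tp P.
Proof. by move=> [r [a h]]; exists [seq (n, a n) | n <- r] => t; rewrite big_map. Qed.

End Norms.

Section Distance.
Variable R : realType.
Variables (p b : R) (f : R -> R[i]).
Hypotheses (p1 : 1 < p) (cf : contp f).
Implicit Types (g P : R -> R[i]) (z : R[i]) (n m : int) (e : R) (a : int -> R[i]).

Let p0 : 0 < p. Proof. exact: lt_trans ltr01 p1. Qed.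

(* The distance from the sequence a to the closed span of the sequences of
   Fourier coefficients of the products P f is at most C. *)
Definition near_span a (C : R) := 0 < C /\
  exists P, tp P /\ Np p b (fun n => a n - hat (fun t => P t * f t) n) (C `^ p).

Definition dist_span a : R := inf [set C | near_span a C].

Lemma near_span_mono a (C D : R) : C <= D -> near_span a C -> near_span a D.
Proof.
move=> CD [C0 [P [tP h]]]; split; first exact: lt_le_trans CD.
exists P; split=> //; apply: bnd_leC h.
by rewrite ge0_ler_powR ?nnegrE ?(ltW p0) ?(ltW C0)// (le_trans (ltW C0)).
Qed.

Lemma near_span0 e : 0 < e -> near_span (fun=> 0) e.
Proof.
move=> e0; split=> //; exists (fun=> 0); split; first exact: tp0.
move=> F _; rewrite big1 ?powR_ge0// => n _.
rewrite (_ : (fun t => 0 * f t) = fun=> 0); last by apply/funext => t; rewrite mul0r.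
rewrite (_ : hat _ n = 0); last first.
  by rewrite /hat -[RHS]tint0; congr tint; apply/funext => t; rewrite mul0r.
by rewrite subrr cmod0 powR0 ?mul0r// gt_eqF.
Qed.

Lemma contp_tpM P : tp P -> contp (fun t => P t * f t).
Proof. by move=> /tp_contp cP; exact: contpM. Qed.

Lemma near_spanD a1 a2 (C D : R) : near_span a1 C -> near_span a2 D ->
  near_span (fun n => a1 n + a2 n) (C + D).
Proof.
move=> [C0 [P [tP hP]]] [D0 [Q [tQ hQ]]]; split; first exact: addr_gt0.
exists (fun t => P t + Q t); split; first exact: tpD.
have := Np_add (ltW p1) C0 D0 hP hQ; congr (Np p b _ _); apply/funext => n.
rewrite (_ : (fun t => (P t + Q t) * f t) = fun t => P t * f t + Q t * f t).
  by rewrite hatD ?(contp_tpM _).2//; [ring|case: (contp_tpM tP)|case: (contp_tpM tQ)].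
by apply/funext => t; rewrite mulrDl.
Qed.

Lemma near_spanZ z a (C : R) : z != 0 -> near_span a C -> near_span (fun n => z * a n) (cmod z * C).
Proof.
move=> z0 [C0 [P [tP hP]]].
have cz : 0 < cmod z.
  by rewrite lt_neqAle cmod_ge0 andbT eq_sym; apply: contra z0 => /eqP /cmod_eq0 ->.
split; first by rewrite mulr_gt0.
exists (fun t => z * P t); split; first exact: tpZ.
have := Np_scale z (ltW C0) hP; congr (Np p b _ _); apply/funext => n.
rewrite (_ : (fun t => z * P t * f t) = fun t => z * (P t * f t)).
  by rewrite hatZ ?mulrBr//; case: (contp_tpM tP).
by apply/funext => t; rewrite mulrA.
Qed.

Lemma hat_zeroM n : hat (fun t => 0 * f t) n = 0.
Proof.
rewrite (_ : (fun t => 0 * f t) = fun=> 0); last by apply/funext => t; rewrite mul0r.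
by rewrite /hat -[RHS]tint0; congr tint; apply/funext => t; rewrite mul0r.
Qed.

Lemma near_span_fin F a (C : R) : uniq F -> 0 < C ->
  \sum_(n <- F) cmod (a n) `^ p * w R n `^ (p * b) <= C `^ p -> near_span (restr F a) C.
Proof.
move=> uF C0 h; split=> //; exists (fun=> 0); split; first exact: tp0.
move=> G uG; apply: (le_trans _ h).
rewrite (bigID (mem F)) /= [X in _ + X]big1 ?addr0.
  rewrite -big_filter (@le_trans _ _ (\sum_(n <- [seq x <- G | x \in F]) cmod (a n) `^ p * w R n `^ (p * b)))//.
    rewrite big_seq [leRHS]big_seq; apply: ler_sum => n; rewrite mem_filter => /andP[nF _].
    by rewrite /restr nF hat_zeroM subr0.
  apply: ler_sum_sub; [by move=> n; rewrite mulr_ge0 ?powR_ge0|exact: filter_uniq|].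
  by move=> n; rewrite mem_filter => /andP[].
by move=> n nF; rewrite /restr (negbTE nF) hat_zeroM subr0 cmod0 powR0 ?mul0r ?gt_eqF.
Qed.

Lemma near_span_restr F a : exists C, near_span (restr F a) C.
Proof.
pose S := \sum_(n <- undup F) cmod (a n) `^ p * w R n `^ (p * b).
have S0 : 0 <= S by apply: sumr_ge0 => n _; rewrite mulr_ge0 ?powR_ge0.
have C0 : 0 < (S + 1) `^ p^-1 by rewrite powR_gt0// ltr_wpDl.
exists ((S + 1) `^ p^-1).
rewrite (_ : restr F a = restr (undup F) a); last by apply/funext => n; rewrite /restr mem_undup.
apply: near_span_fin => //; first exact: undup_uniq.
by rewrite -powRrM mulVf ?gt_eqF// powRr1 ?addr_ge0// lerDl.
Qed.

Lemma dist_span_ge0 a : 0 <= dist_span a.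
Proof.
have [h|/set0P h] := eqVneq [set C | near_span a C] set0.
  by rewrite /dist_span h inf0.
by apply: lb_le_inf => // C [/ltW].
Qed.

Lemma dist_span_le a (C : R) : near_span a C -> dist_span a <= C.
Proof. by move=> h; apply: ge_inf => //; exists 0 => D [/ltW]. Qed.

Lemma dist_span_adh a e : (exists C, near_span a C) -> 0 < e -> near_span a (dist_span a + e).
Proof.
move=> ne e0; have hi : has_inf [set C | near_span a C].
  by split=> //; exists 0 => D [/ltW].
have [C hC hlt] := inf_adherent e0 hi.
exact: near_span_mono (ltW hlt) hC.
Qed.

Lemma dist_spanD F a1 a2 :
  dist_span (fun m => restr F a1 m + restr F a2 m) <= dist_span (restr F a1) + dist_span (restr F a2).
Proof.
apply/ler_addgt0Pr => e e0.
have e2 : 0 < e / 2 by lra.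
have h1 := dist_span_adh (near_span_restr F a1) e2.
have h2 := dist_span_adh (near_span_restr F a2) e2.
by have := dist_span_le (near_spanD h1 h2); rewrite addrACA -splitr.
Qed.

Lemma dist_spanZ_le F a z : z != 0 -> dist_span (fun m => z * restr F a m) <= cmod z * dist_span (restr F a).
Proof.
move=> z0; have cz : 0 < cmod z.
  by rewrite lt_neqAle cmod_ge0 andbT eq_sym; apply: contra z0 => /eqP /cmod_eq0 ->.
apply/ler_addgt0Pr => e e0.
have h := dist_span_adh (near_span_restr F a) (divr_gt0 e0 cz).
by have := dist_span_le (near_spanZ z0 h); rewrite mulrDr [X in _ + X]mulrC divfK ?gt_eqF.
Qed.

Lemma dist_spanZ F a z : z != 0 -> dist_span (fun m => z * restr F a m) = cmod z * dist_span (restr F a).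
Proof.
move=> z0; apply/eqP; rewrite eq_le dist_spanZ_le//=.
have cz : 0 < cmod z.
  by rewrite lt_neqAle cmod_ge0 andbT eq_sym; apply: contra z0 => /eqP /cmod_eq0 ->.
have zE : (fun m => z * restr F a m) = restr F (fun m => z * a m).
  by apply/funext => m; rewrite /restr; case: ifP; rewrite ?mulr0.
have := @dist_spanZ_le F (fun m => z * a m) z^-1; rewrite invr_eq0 -zE => /(_ z0).
rewrite (_ : (fun m => z^-1 * (z * restr F a m)) = restr F a); last first.
  by apply/funext => m; rewrite mulKf.
by rewrite cmodV ler_pdivlMl.
Qed.

Lemma dist_span0 : dist_span (fun=> 0) = 0.
Proof.
apply/eqP; rewrite eq_le dist_span_ge0 andbT; apply/ler_addgt0Pr => e e0; rewrite add0r.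
exact/dist_span_le/near_span0.
Qed.

(** A general U is cut to finitely many frequencies and each of them is approximated separately; e/4
    + e/4 leaves room for the strict inequality. *)
Lemma cyclic_of_dist : (forall n, dist_span (fun m => (m == n)%:R) = 0) ->
  cyclic p b (distr_of_fun f).
Proof.
move=> H.
have dl n : (fun m => (m == n)%:R) = restr [:: n] (fun=> 1 : R[i]).
  by apply/funext => m; rewrite /restr inE; case: (_ == _).
have ND n e : 0 < e -> near_span (fun m => (m == n)%:R) e.
  move=> e0; have := @dist_span_adh (fun m => (m == n)%:R) e.
  by rewrite H add0r; apply => //; rewrite dl; exact: near_span_restr.
have NR F a e : 0 < e -> uniq F -> near_span (restr F a) e.
  elim: F e => [|n F IH] e e0 /=.
    by move=> _; rewrite (_ : restr [::] a = fun=> 0); [exact: near_span0|exact/funext].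
  move=> /andP[nF uF].
  have -> : restr (n :: F) a = fun m => a n * (m == n)%:R + restr F a m.
    apply/funext => m; rewrite /restr inE; case: eqP => [->|_] /=.
      by rewrite (negbTE nF) mulr1 addr0.
    by rewrite mulr0 add0r.
  have -> : e = e / 2 + e / 2 by lra.
  apply: near_spanD; last by apply: IH => //; lra.
  have [->|a0] := eqVneq (a n) 0.
    rewrite (_ : (fun m => 0 * _) = fun=> 0); last by apply/funext => m; rewrite mul0r.
    by apply: near_span0; lra.
  have cz : 0 < cmod (a n).
    by rewrite lt_neqAle cmod_ge0 andbT eq_sym; apply: contra a0 => /eqP /cmod_eq0 ->.
  have := near_spanZ a0 (ND n (e / 2 / cmod (a n)) ltac:(by rewrite !divr_gt0)).
  by rewrite mulrC divfK ?gt_eqF.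
move=> U [_ hU] e e0.
have [C hC] := Anorm_lt_ooP p0 hU.
have e40 : 0 < e / 4 by rewrite divr_gt0.
have e4 : 0 < (e / 4) `^ p by exact: powR_gt0.
have [|N0 hN0] := bnd_tail _ hC e4; first by move=> n; rewrite mulr_ge0 ?powR_ge0.
have [_ [P [tP hP]]] := NR (zr N0) (fourier U) (e / 4) e40 (zr_uniq N0).
exists P; split; first exact: tp_trig.
apply: (@le_lt_trans _ _ (e / 4 + e / 4)%:E); last first.
  by rewrite lte_fin -mulrDr [X in _ < X](splitr e) mulrDr; lra.
apply: Np_Anorm => //; first exact: addr_gt0.
have tl : Np p b (fun n => fourier U n - restr (zr N0) (fourier U) n) ((e / 4) `^ p).
  move=> F uF; rewrite (bigID (mem (zr N0))) /= big1 ?add0r.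
    rewrite -big_filter (@le_trans _ _ (\sum_(n <- [seq x <- F | x \notin zr N0]) cmod (fourier U n) `^ p * w R n `^ (p * b)))//.
      rewrite big_seq [leRHS]big_seq; apply: ler_sum => n; rewrite mem_filter => /andP[nN _].
      by rewrite /restr (negbTE nN) subr0.
    apply: hN0; first exact: filter_uniq.
    by move=> n; rewrite mem_filter mem_zr -ltnNge => /andP[].
  by move=> n nN; rewrite /restr nN subrr cmod0 powR0 ?mul0r// gt_eqF.
have := Np_add (ltW p1) e40 e40 tl hP; congr (Np p b _ _); apply/funext => n.
rewrite addrA subrK /fourier /distr_mul; congr (_ - _).
rewrite /hat /distr_of_fun tintE; congr tint; apply/funext => t; ring.
Qed.

End Distance.

Section Lipschitz.
Variable R : realType.
Implicit Types (f g : R -> R[i]) (E : set R).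

Lemma lip_cont f (L : R) : lip f L -> cont f.
Proof.
move=> h.
have H (k : R[i] -> R) : (forall z1 z2, k z1 - k z2 = k (z1 - z2)) ->
    (forall z, `|k z| <= cmod z) -> continuous (fun t => k (f t)).
  move=> kB kle t; apply/cvgrPdist_le => e e0.
  have L1 : 0 < `|L| + 1 by rewrite ltr_wpDl.
  apply/nbhs_ballP; exists (e / (`|L| + 1)); first by rewrite /= divr_gt0.
  move=> x; rewrite /ball /= => tx; rewrite kB (le_trans (kle _))// (le_trans (h _ _))//.
  rewrite (@le_trans _ _ ((`|L| + 1) * `|t - x|))//.
    by rewrite ler_wpM2r// (le_trans (ler_norm L))// lerDl.
  by rewrite mulrC -ler_pdivlMr// ltW.
by split; apply: H; [case=> ? ? []|exact: Re_le_cmod|case=> ? ? []|exact: Im_le_cmod].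
Qed.

(* Positive exactly at the points at distance less than d from E;
   sup of the empty set is 0, so chi vanishes when E is empty. *)
Definition chi E (d x : R) : R := sup [set Num.max 0 (d - `|x - y|) | y in E].

Lemma chi_ub E d x : 0 < d -> ubound [set Num.max 0 (d - `|x - y|) | y in E] d.
Proof.
move=> d0 _ [y _ <-]; rewrite ge_max (ltW d0)/=.
by rewrite gerBl.
Qed.

Lemma chi_ge E d x y : 0 < d -> E y -> d - `|x - y| <= chi E d x.
Proof.
move=> d0 Ey; apply: (@le_trans _ _ (Num.max 0 (d - `|x - y|))); first by rewrite le_max lexx orbT.
by apply: ub_le_sup; [exists d; exact: chi_ub|exists y].
Qed.

Lemma chi_ge0 E d x : 0 < d -> 0 <= chi E d x.
Proof.
move=> d0; have [->|/set0P[y Ey]] := eqVneq E set0; first by rewrite /chi image_set0 sup0.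
rewrite (@le_trans _ _ (Num.max 0 (d - `|x - y|)))//; first by rewrite le_max lexx.
by apply: ub_le_sup; [exists d; exact: chi_ub|exists y].
Qed.

Lemma chi_le E d x : 0 < d -> chi E d x <= d.
Proof.
move=> d0; have [->|/set0P[y Ey]] := eqVneq E set0; first by rewrite /chi image_set0 sup0 ltW.
by apply: ge_sup; [exists (Num.max 0 (d - `|x - y|)), y|exact: chi_ub].
Qed.

Lemma chi_pos E d x : 0 < d -> chi E d x != 0 -> exists2 y, E y & `|x - y| < d.
Proof.
move=> d0; apply: contra_neqP => /forall2NP h.
apply/eqP; rewrite eq_le chi_ge0// andbT.
have [->|/set0P[y Ey]] := eqVneq E set0; first by rewrite /chi image_set0 sup0.
apply: ge_sup; first by exists (Num.max 0 (d - `|x - y|)), y.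
move=> _ [z Ez <-]; rewrite ge_max lexx /= subr_le0 leNgt; apply/negP => zd.
by case: (h z).
Qed.

Lemma chi_lip E d : 0 < d -> lip (fun x => (chi E d x)%:C) 1.
Proof.
move=> d0; have H x y : chi E d x <= chi E d y + `|x - y|.
  have [->|/set0P[z Ez]] := eqVneq E set0.
    by rewrite /chi !image_set0 sup0 add0r.
  apply: ge_sup; first by exists (Num.max 0 (d - `|x - z|)), z.
  move=> _ [z' Ez' <-]; rewrite ge_max addr_ge0 ?chi_ge0//=.
  have := @chi_ge E d y z' d0 Ez'; have := ler_distD x y z'; rewrite [`|y - x|]distrC; lra.
move=> x y; rewrite -rmorphB /= cmod_real mul1r ler_norml.
have := H x y; have := H y x; rewrite [`|y - x|]distrC; lra.
Qed.

Lemma chi_period E d : periodic_set E -> forall x, chi E d (x + 2 * pi) = chi E d x.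
Proof.
move=> pE x; congr sup; apply/seteqP; split => _ [y Ey <-].
  exists (y - 2 * pi); first by rewrite -pE subrK.
  by congr (Num.max _ (_ - `|_|)); ring.
exists (y + 2 * pi); first by rewrite pE.
by congr (Num.max _ (_ - `|_|)); ring.
Qed.

End Lipschitz.

(** * Annihilating sequences and division by f through Wiener's lemma *)

Section Dual.
Variable R : realType.
Variables (p q b Cf : R) (f : R -> R[i]).
Hypotheses (p1 : 1 < p) (qE : q = p / (p - 1)) (b01 : 0 <= b < 1 / 2) (fA : A1 b f Cf).
Implicit Types (g h G P : R -> R[i]) (z : R[i]) (n m : int) (e C : R) (a s : int -> R[i]).

Let p0 : 0 < p. Proof. exact: lt_trans ltr01 p1. Qed.
Let b0 : 0 <= b. Proof. by case/andP: b01. Qed.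

(** Bounding the pairing by the distance to the span encodes two things at once: s is a bounded
    functional on the weighted l^p space, and it annihilates the products P f, in the limit of
    truncations. *)
Definition dual s := forall F a C, uniq F -> near_span p b f (restr F a) C ->
  cmod (\sum_(m <- F) a m * s m) <= 2 * C.

Lemma exists_dual n : 0 < dist_span p b f (fun m => (m == n)%:R) ->
  exists s, s n != 0 /\ dual s.
Proof.
move=> h; have [||||s [s0 hs]] := @hahn_banach_int R (dist_span p b f) n.
- by move=> F a1 a2; apply: dist_spanD => //; case: fA.
- by move=> F a z z0; apply: dist_spanZ => //; case: fA.
- by apply: dist_span0.
- exact: h.
exists s; split=> // F a C uF hC.
by rewrite (le_trans (hs F a uF))// ler_pM2l// dist_span_le.
Qed.

(** The test sequence |s|^(q-2) conj(s) w^(-qb) on F is the extremal one of Hölder's inequality: its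
    pairing with s and the p-th power of its norm are the same number X, so X <= 2 X^(1/p). *)
Lemma dual_bound s : dual s -> bnd (fun n => cmod (s n) `^ q * w R n `^ (- (q * b))) (2 `^ q).
Proof.
move=> ds F uF; set X := \sum_(n <- F) _.
have p1' : p - 1 != 0 by rewrite gt_eqF// subr_gt0.
have q1 : 1 < q by rewrite qE ltr_pdivlMr ?subr_gt0// mul1r; lra.
have qn0 : q != 0 by rewrite gt_eqF//; lra.
have qp : (q - 1) * p = q by rewrite qE; field.
have X0 : 0 <= X by apply: sumr_ge0 => n _; rewrite mulr_ge0 ?powR_ge0.
have [X00|Xn0] := eqVneq X 0; first by rewrite X00 powR_ge0.
have Xp : 0 < X by rewrite lt_neqAle eq_sym Xn0.
pose a n := (cmod (s n) `^ (q - 2) * w R n `^ (- (q * b)))%:C * conjc (s n).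
have ca n : cmod (a n) = cmod (s n) `^ (q - 1) * w R n `^ (- (q * b)).
  rewrite cmodM cmod_real cmodJ ger0_norm ?mulr_ge0 ?powR_ge0// mulrAC; congr (_ * _).
  have [->|sn] := eqVneq (cmod (s n)) 0.
    by rewrite mulr0 powR0// gt_eqF// subr_gt0.
  rewrite -{2}[cmod (s n)]powRr1 ?cmod_ge0// -powRD; last by rewrite sn implybT.
  by congr (_ `^ _); ring.
have as_ n : a n * s n = (cmod (s n) `^ q * w R n `^ (- (q * b)))%:C.
  rewrite /a -mulrA [conjc _ * _]mulrC mulcJ_cmod -rmorphM /= mulrAC; congr ((_ * _)%:C).
  have [->|sn] := eqVneq (cmod (s n)) 0; first by rewrite expr0n mulr0 powR0.
  rewrite -powR_mulrn ?cmod_ge0// -powRD; last by rewrite sn implybT.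
  by congr (_ `^ _); ring.
have ap n : cmod (a n) `^ p * w R n `^ (p * b) = cmod (s n) `^ q * w R n `^ (- (q * b)).
  rewrite ca powRM ?powR_ge0// -powRrM qp -mulrA; congr (_ * _).
  rewrite -powRrM -powRD; last by apply/implyP => _; rewrite gt_eqF ?w_gt0.
  have qp2 : q * p = q + p by move: qp; rewrite mulrBl mul1r => /eqP; rewrite subr_eq => /eqP.
  congr (_ `^ _); rewrite (_ : - (q * b) * p = - (b * (q * p))); last by ring.
  by rewrite qp2; ring.
have nX : near_span p b f (restr F a) (X `^ p^-1).
  apply: near_span_fin => //; first exact: powR_gt0.
  rewrite -powRrM mulVf ?gt_eqF// powRr1//.
  by under eq_bigr do rewrite ap.
have := ds F a _ uF nX.
have -> : \sum_(m <- F) a m * s m = X%:C.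
  by rewrite /X rmorph_sum; apply: eq_bigr => n _; rewrite as_.
rewrite cmod_real ger0_norm// => hX.
have ppq : p^-1 + q^-1 = 1.
  by rewrite qE invf_div -[X in X + _]div1r -mulrDl addrCA subrr addr0 mulfV ?gt_eqF.
have XE : X = X `^ p^-1 * X `^ q^-1.
  by rewrite -powRD ?Xn0 ?implybT// ppq powRr1.
have Xq : X `^ q^-1 <= 2.
  rewrite -(ler_pM2l (powR_gt0 p^-1 Xp)) -XE mulrC; exact: hX.
have -> : X = (X `^ q^-1) `^ q by rewrite -powRrM mulVf// powRr1.
by rewrite ge0_ler_powR ?nnegrE ?powR_ge0//; lra.
Qed.

(** The partial sums of h are admissible multipliers and converge to h in the algebra A^1_b; the
    coefficients of G are truncated because [dual] speaks of finite sums. *)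
Lemma near_span_prod G h D : A1 b h D -> (forall t, G t = h t * f t) -> forall e, 0 < e ->
  exists N0, forall N, (N0 <= N)%N -> near_span p b f (restr (zr N) (hat G)) e.
Proof.
move=> hA Gh e e0.
have GA : A1 b G (D * Cf) by rewrite (_ : G = fun t => h t * f t); [exact: A1M|exact/funext].
have Cf0 := bnd_ge0 fA.2.
have e2 : 0 < e / 2 by rewrite divr_gt0.
have [N0 hN0] := A1_approx e2 GA.
have d0 : 0 < e / 2 / (Cf + 1) by rewrite divr_gt0// ltr_wpDl.
have [M /(_ M (leqnn _)) hM] := A1_approx d0 hA.
exists N0 => N NN; split=> //; exists (psum (hat h) M); split; first exact: tp_psum.
apply: l1_Np; [exact: ltW|by []|].
have cG : contp G by case: GA.
have H : A1 b (fun t => (h t - psum (hat h) M t) * f t - (G t - psum (hat G) N t)) e.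
  rewrite (splitr e); apply: A1B; last exact: hN0.
  apply: A1_leC (A1M b0 hM fA).
  by rewrite mulrAC ler_pdivrMr ?ltr_wpDl// ler_pM2l// lerDl.
apply: bnd_le H.2 => n; rewrite ler_wpM2r ?wt_ge0//.
rewrite (_ : (fun t => (h t - psum (hat h) M t) * f t - (G t - psum (hat G) N t)) =
   fun t => psum (hat G) N t - psum (hat h) M t * f t); last first.
  by apply/funext => t; rewrite Gh; ring.
rewrite hatB; last 2 first.
- by case: (contp_psum (hat G) N).
- by case: (contpM (contp_psum (hat h) M) fA.1).
by rewrite hat_psum /restr mem_zr.
Qed.

Definition vanish_near E G := exists2 d : R, 0 < d & forall x y : R, E y -> `|x - y| < d -> G x = 0.

Lemma zeros_periodic : periodic_set (zeros f).
Proof. by move=> t; rewrite /zeros /=; case: fA => -[pf _] _; rewrite pf. Qed.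

Lemma vanish_prod G D : A1 b G D -> vanish_near (zeros f) G ->
  exists h, (exists D', A1 b h D') /\ forall t, G t = h t * f t.
Proof.
move=> GA [d d0 Gd].
have [K K0 hK] := bernstein b01.
have cA : A1 b (fun x => (chi (zeros f) d x)%:C) (K * (d + 1)).
  apply: hK; last exact: chi_lip.
    by split; [move=> t; rewrite chi_period//; exact: zeros_periodic|exact: (lip_cont (chi_lip (zeros f) d0))].
  by move=> t; rewrite cmod_real ger0_norm ?chi_ge0// chi_le.
pose F t := f t * conjc (f t) + (chi (zeros f) d t)%:C.
have FA : A1 b F (Cf * Cf + K * (d + 1)) by apply: A1D => //; apply: A1M => //; exact: A1J.
have F0 t : F t != 0.
  apply/eqP; rewrite /F mulcJ_cmod -rmorphD /= => /complexI h0.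
  have c0 := @chi_ge0 R (zeros f) d t d0.
  have f0 : cmod (f t) ^+ 2 = 0 by have := sqr_ge0 (cmod (f t)); lra.
  have ft : f t = 0 by apply: cmod_eq0; apply/eqP; rewrite -sqrf_eq0 f0.
  have := @chi_ge R (zeros f) d t t d0 ft; rewrite subrr normr0 subr0; lra.
have [D' FiA] := A1_inv b01 FA F0.
exists (fun t => G t * conjc (f t) * (F t)^-1); split.
  exists (D * Cf * D'); apply: A1M => //.
  by apply: (@A1M _ _ G (fun t => conjc (f t))) => //; exact: A1J.
move=> t; have [c0|cn0] := eqVneq (chi (zeros f) d t) 0.
  have FE : F t = conjc (f t) * f t by rewrite /F c0 rmorph0 addr0 mulrC.
  by rewrite mulrAC -[G t * _ * f t]mulrA -FE mulfK.
have [y Ey ty] := chi_pos d0 cn0.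
by rewrite (Gd t y Ey ty) !mul0r.
Qed.

Lemma dual_vanish s G D : dual s -> A1 b G D -> vanish_near (zeros f) G ->
  forall e, 0 < e -> exists N0, forall N, (N0 <= N)%N -> cmod (\sum_(n <- zr N) hat G n * s n) <= e.
Proof.
move=> ds GA Gv e e0; have [h [[D' hA] Gh]] := vanish_prod GA Gv.
have e2 : 0 < e / 2 by rewrite divr_gt0.
have [N0 hN0] := near_span_prod hA Gh e2; exists N0 => N NN.
by rewrite (le_trans (ds _ _ _ (zr_uniq N) (hN0 N NN)))// mulrC divfK.
Qed.

End Dual.

(** * Powers of an annihilator and the criterion for cyclicity *)

Section Criterion.
Variable R : realType.
Implicit Types (f g h G P : R -> R[i]) (z : R[i]) (n m : int) (e C : R) (a s : int -> R[i]) (E : set R).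

(* The sum E + ... + E of j + 1 copies of E. *)
Fixpoint sumset E (j : nat) : set R :=
  if j is j'.+1 then [set x | exists (y z : R), [/\ E y, sumset E j' z & x = y + z]] else E.

(** Cauchy-Schwarz with a free parameter l, which avoids square roots of sums. *)
Lemma sum_cond_le (x y : int -> R) (l : R) F : 0 < l ->
  (forall n, 0 <= x n) -> (forall n, 0 <= y n) ->
  \sum_(n <- F) x n * y n <= (\sum_(n <- F) x n ^+ 2) / l + l * \sum_(n <- F) y n ^+ 2.
Proof.
move=> l0 x0 y0; rewrite mulr_suml mulr_sumr -big_split /=; apply: ler_sum => n _.
have h : 0 <= (x n - l * y n) ^+ 2 / l by rewrite divr_ge0 ?sqr_ge0// ltW.
have h2 : 0 <= x n * y n by rewrite mulr_ge0.
have e1 : (x n - l * y n) ^+ 2 / l = x n ^+ 2 / l + l * y n ^+ 2 - 2 * (x n * y n).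
  by field; rewrite gt_eqF.
by move: h; rewrite e1; lra.
Qed.

Lemma small_of_all (x : R) (H : forall e, 0 < e -> x <= e) : x <= 0.
Proof. by apply/ler_addgt0Pr => e e0; rewrite add0r; exact: H. Qed.

Variables (p q b Cf : R) (f : R -> R[i]).
Hypotheses (p1 : 1 < p) (qE : q = p / (p - 1)) (b01 : 0 <= b < 1 / 2) (fA : A1 b f Cf).

Let b0 : 0 <= b. Proof. by case/andP: b01. Qed.
Let q0 : 0 < q. Proof. by rewrite qE divr_gt0 ?subr_gt0// (lt_trans _ p1). Qed.

Lemma dual_pointwise s n : dual p b f s -> cmod (s n) <= 2 * w R n `^ b.
Proof.
move=> ds; have := dual_bound p1 qE ds (F := [:: n]) isT; rewrite big_seq1 => h.
have wq : 0 < w R n `^ (q * b) by exact: wt_gt0.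
have h2 : cmod (s n) `^ q <= (2 * w R n `^ b) `^ q.
  rewrite powRM ?wt_ge0// -powRrM [b * q]mulrC.
  have -> : cmod (s n) `^ q = cmod (s n) `^ q * w R n `^ (- (q * b)) * w R n `^ (q * b).
    by rewrite powRN mulfVK// gt_eqF.
  by rewrite ler_pM2r.
have := @ge0_ler_powR R q^-1 ltac:(by rewrite invr_ge0 ltW) _ _ _ _ h2.
rewrite !nnegrE !powR_ge0 => /(_ isT isT).
by rewrite -!powRrM mulfV ?gt_eqF// !powRr1 ?cmod_ge0 ?mulr_ge0 ?wt_ge0.
Qed.

(** Induction that trades one factor s for one summand of the sumset. Let G have the coefficients of
    g times s^(j+1). Its value at x is the pairing of s^(j+1) with the translate t -> g(t + x); for
    x near a zero of f this translate vanishes near the sum of j + 1 copies of the zero set, so G(x)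
    = 0 by induction, and [dual_vanish] applies to G. Each factor s costs a weight w^b, whence the
    space of g. *)
Lemma dual_power s j : dual p b f s -> forall g D, A1 (j.+1%:R * b) g D ->
  vanish_near (sumset (zeros f) j) g ->
  forall e, 0 < e -> exists N0, forall N, (N0 <= N)%N ->
    cmod (\sum_(n <- zr N) hat g n * s n ^+ j.+1) <= e.
Proof.
move=> ds; elim: j => [|j IH] g D gA [d d0 gv] e e0.
  have g1 : A1 b g D by rewrite mul1r in gA.
  have [N0 h] := dual_vanish p1 b01 fA ds g1 (ex_intro2 _ _ d d0 gv) e0.
  by exists N0 => N NN; under eq_bigr do rewrite expr1; exact: h.
pose a n := hat g n * s n ^+ j.+1.
have aw n : cmod (a n) * w R n `^ b <= 2 ^+ j.+1 * (cmod (hat g n) * w R n `^ (j.+2%:R * b)).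
  have -> : w R n `^ (j.+2%:R * b) = (w R n `^ b) ^+ j.+1 * w R n `^ b.
    rewrite -exprSr -powR_mulrn ?wt_ge0// -powRrM; congr (_ `^ _); exact: mulrC.
  rewrite cmodM cmodX mulrCA -!mulrA ler_wpM2l ?cmod_ge0// [leRHS]mulrA -exprMn.
  rewrite ler_wpM2r ?wt_ge0//; apply: lerXn2r; rewrite ?nnegrE ?cmod_ge0 ?mulr_ge0 ?wt_ge0//.
  exact: dual_pointwise.
have ab : bnd (fun n => cmod (a n) * w R n `^ b) (2 ^+ j.+1 * D).
  move=> F uF; rewrite (le_trans (ler_sum _ (fun n _ => aw n)))// -mulr_sumr ler_wpM2l ?exprn_ge0//.
  exact: gA.2.
have ab1 : bnd (fun n => cmod (a n)) (2 ^+ j.+1 * D).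
  by apply: bnd_le ab => n; rewrite ler_peMr ?cmod_ge0// wt_ge1.
have [G [cG hG GN]] := synth ab1.
have GA : A1 b G (2 ^+ j.+1 * D).
  by split=> //; apply: bnd_le ab => n; rewrite hG.
have Gv : vanish_near (zeros f) G.
  exists (d / 2); first by rewrite divr_gt0.
  move=> x y Ey xy; apply: cmod_eq0; apply/eqP; rewrite eq_le cmod_ge0 andbT.
  apply: small_of_all => e' e'0; have e2 : 0 < e' / 2 by rewrite divr_gt0.
  pose gx t := g (t + x).
  have gxA : A1 (j.+1%:R * b) gx D.
    split; first by apply: contp_shift; case: gA.
    apply: bnd_le gA.2 => n; rewrite hat_shift; last by case: gA.
    rewrite cmodM cmod_expi mul1r ler_wpM2l ?cmod_ge0// wt_mono// ler_wpM2r// ler_nat//.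
  have gxv : vanish_near (sumset (zeros f) j) gx.
    exists (d / 2); first by rewrite divr_gt0.
    move=> t u Eu tu; apply: (gv _ (y + u)); first by exists y, u.
    rewrite (_ : t + x - (y + u) = (t - u) + (x - y)); last by ring.
    by rewrite (le_lt_trans (ler_normD _ _))//; lra.
  have [N1 h1] := IH gx D gxA gxv (e' / 2) e2.
  have [N2 h2] := GN (e' / 2) e2.
  have k1 := h1 (maxn N1 N2) (leq_maxl _ _); have k2 := h2 (maxn N1 N2) (leq_maxr _ _) x.
  rewrite -[G x](subrK (psum a (maxn N1 N2) x)) (le_trans (cmodD _ _))//.
  rewrite (splitr e') lerD// (_ : psum a _ x = \sum_(n <- zr (maxn N1 N2)) hat gx n * s n ^+ j.+1)//.
  rewrite /psum; apply: eq_bigr => n _; rewrite /a hat_shift; last by case: gA.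
  by ring.
have [N0 h] := dual_vanish p1 b01 fA ds GA Gv e0; exists N0 => N NN.
rewrite (_ : \sum_(n <- zr N) _ = \sum_(n <- zr N) hat G n * s n)//; first exact: h.
by apply: eq_bigr => n _; rewrite hG /a exprSr mulrA.
Qed.

(* There is a cutoff equal to 1 near A of small weighted l^2 norm; such a set carries
   no nonzero element of the dual of that space. *)
Definition null_set (c : R) (A : set R) := forall e, 0 < e -> exists phi : R -> R[i],
  [/\ contp phi, (exists L : R, lip phi L),
   (exists2 d : R, 0 < d & forall x y : R, A y -> `|x - y| < d -> phi x = 1) &
   bnd (fun n => cmod (hat phi n) ^+ 2 * w R n `^ (2 * c)) e].

(** For s m different from 0, test s^(j+1) against [expi m] times 1 - phi. Up to a small error, s m
    ^ (j+1) is then the pairing of s^(j+1) with [expi m] times phi, which Cauchy-Schwarz bounds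
    through the small norm of phi. The Lipschitz condition on phi puts the test function into the
    space required by [dual_power]. *)
Lemma cyclic_criterion (j : nat) (c : R) : 0 <= c -> j.+1%:R * b < 1 / 2 ->
  (forall s, bnd (fun n => cmod (s n) `^ q * w R n `^ (- (q * b))) (2 `^ q) ->
     exists B, bnd (fun n => cmod (s n) ^+ (2 * j.+1) * w R n `^ (- (2 * c))) B) ->
  null_set c (sumset (zeros f) j) ->
  cyclic p b (distr_of_fun f).
Proof.
move=> c0 jb s2 nullE; apply: cyclic_of_dist => //; first by case: fA.
move=> m; apply/eqP; rewrite eq_le dist_span_ge0 andbT leNgt; apply/negP => dpos.
have [s [sm ds]] := exists_dual p1 fA dpos.
have jb01 : 0 <= j.+1%:R * b < 1 / 2 by rewrite jb andbT mulr_ge0.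
have [B hB] := s2 s (dual_bound p1 qE ds).
have B0 := bnd_ge0 hB.
have [K K0 hK] := bernstein jb01.
suff : cmod (s m ^+ j.+1) <= 0.
  rewrite cmodX => h.
  have h0 : cmod (s m) ^+ j.+1 = 0.
    by apply/eqP; rewrite eq_le h exprn_ge0// cmod_ge0.
  by move/eqP: h0; rewrite expf_eq0 /= => /eqP /cmod_eq0 /eqP; rewrite (negbTE sm).
apply: small_of_all => e e0.
(* [l] and [ep] make each of the two terms of [sum_cond_le] at most e / 4; the power of [w R m] in
   [ep] pays for the shift of the coefficients of phi by m. *)
pose l := e / (4 * (B + 1)); have l0 : 0 < l by rewrite divr_gt0// mulr_gt0// ltr_wpDl.
pose ep := e * l / (4 * w R m `^ (2 * c)).
have wm : 0 < w R m `^ (2 * c) by exact: wt_gt0.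
have ep0 : 0 < ep by apply: divr_gt0; apply: mulr_gt0.
have [phi [cphi [L phiL] [d d0 phi1] phib]] := nullE ep ep0.
have [M M0 phiM] := contp_bnd cphi.
have phiA := hK _ _ _ cphi phiM phiL.
pose g t := expi m t * (1 - phi t).
have gA : exists D, A1 (j.+1%:R * b) g D.
  have jb0 : 0 <= j.+1%:R * b by rewrite mulr_ge0.
  by eexists; apply: A1_expiM => //; apply: A1B; [exact: A1_cst|exact: phiA].
have [D {}gA] := gA.
have gv : vanish_near (sumset (zeros f) j) g.
  by exists d => // x y Ey xy; rewrite /g (phi1 x y Ey xy) subrr mulr0.
have [N0 hN] := dual_power ds gA gv (divr_gt0 e0 (ltr0n _ 2)).
pose N := maxn N0 `|m|%N.
have mN : m \in zr N by rewrite mem_zr leq_maxr.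
have hg n : hat g n = (m == n)%:R - hat phi (n - m).
  rewrite /g (_ : (fun t => expi m t * (1 - phi t)) = fun t => expi m t - expi m t * phi t).
    rewrite hatB; [|exact: cont_expi|by apply: contM; [exact: cont_expi|case: cphi]].
    by rewrite hat_expi hatM_expi.
  by apply/funext => t; ring.
have sE : s m ^+ j.+1 = \sum_(n <- zr N) hat g n * s n ^+ j.+1 +
    \sum_(n <- zr N) hat phi (n - m) * s n ^+ j.+1.
  rewrite -big_split /= (bigD1_seq m) ?zr_uniq//= big1 ?addr0 => [|n nm].
    by rewrite hg eqxx -mulrDl subrK mul1r.
  by rewrite hg eq_sym (negbTE nm) sub0r -mulrDl addNr mul0r.
rewrite sE (le_trans (cmodD _ _))// (splitr e) lerD//; first exact: (hN N (leq_maxl _ _)).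
rewrite (le_trans (cmod_sum _ _ _))//.
pose x n := cmod (hat phi (n - m)) * w R n `^ c.
pose y n := cmod (s n) ^+ j.+1 * w R n `^ (- c).
rewrite (@le_trans _ _ (\sum_(n <- zr N) x n * y n))//.
  apply: ler_sum => n _; rewrite cmodM cmodX /x /y mulrACA.
  by rewrite -powRD ?subrr ?powRr0 ?mulr1//; apply/implyP => _; rewrite gt_eqF ?w_gt0.
rewrite (le_trans (@sum_cond_le x y l _ l0 _ _))//.
- by move=> n; rewrite mulr_ge0 ?cmod_ge0 ?wt_ge0.
- by move=> n; rewrite mulr_ge0 ?exprn_ge0 ?cmod_ge0 ?wt_ge0.
have xs : \sum_(n <- zr N) x n ^+ 2 <= w R m `^ (2 * c) * ep.
  have uz : uniq [seq n - m | n <- zr N] by rewrite map_inj_uniq ?zr_uniq// => ? ? /addIr.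
  have := phib _ uz; rewrite big_map => hx.
  rewrite (le_trans _ (ler_wpM2l (ltW wm) hx))// mulr_sumr; apply: ler_sum => n _.
  rewrite /x exprMn [leRHS]mulrCA ler_wpM2l ?sqr_ge0//.
  rewrite -powR_mulrn ?wt_ge0// -powRrM [c * _]mulrC.
  by rewrite -{1}(subrK m n) addrC wtD// mulr_ge0.
have ys : \sum_(n <- zr N) y n ^+ 2 <= B.
  have := hB _ (zr_uniq N); congr (_ <= _); apply: eq_bigr => n _.
  rewrite /y exprMn -exprM mulnC; congr (_ * _).
  by rewrite -powR_mulrn ?wt_ge0// -powRrM mulNr mulrC.
have x2 : (\sum_(n <- zr N) x n ^+ 2) / l <= e / 4.
  rewrite ler_pdivrMr// (le_trans xs)// /ep le_eqVlt; apply/orP; left; apply/eqP.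
  by field; rewrite gt_eqF.
have y2 : l * (\sum_(n <- zr N) y n ^+ 2) <= e / 4.
  rewrite (le_trans (ler_wpM2l (ltW l0) ys))// /l.
  rewrite (_ : e / (4 * (B + 1)) * B = e / 4 * (B / (B + 1))); last by field; rewrite gt_eqF// ltr_wpDl.
  by rewrite ler_piMr ?divr_ge0 ?(ltW e0)// ler_pdivrMr ?ltr_wpDl// mul1r lerDl.
lra.
Qed.

End Criterion.

(** * Cutoffs and Hausdorff measure *)

Section TorusDist.
Variable R : realType.
Implicit Types (x y r h c t : R) (n : int).

Definition tdist x : R := inf [set `|x + 2 * pi * n%:~R| | n in [set: int]].

Lemma tdist_set x : has_inf [set `|x + 2 * pi * n%:~R| | n in [set: int]].
Proof.
split; first by exists `|x + 2 * pi * 0%:~R|, 0.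
by exists 0 => _ [n _ <-].
Qed.

Lemma tdist_le x n : tdist x <= `|x + 2 * pi * n%:~R|.
Proof. by apply: ge_inf; [case: (tdist_set x)|exists n]. Qed.

Lemma tdist_le0 x : tdist x <= `|x|.
Proof. by have := tdist_le x 0; rewrite mulr0 addr0. Qed.

Lemma tdist_lt x r : tdist x < r -> exists n, `|x + 2 * pi * n%:~R| < r.
Proof.
move=> h; have e0 : 0 < r - tdist x by rewrite subr_gt0.
have [_ [n _ <-] hn] := inf_adherent e0 (tdist_set x).
by exists n; move: hn; rewrite -[X in _ < X + _]/(tdist x) [X in _ < X]addrC subrK.
Qed.

Lemma tdist_lip x y : tdist x <= tdist y + `|x - y|.
Proof.
rewrite -lerBlDr; apply: lb_le_inf; first by case: (tdist_set y).
move=> _ [n _ <-]; rewrite lerBlDr (le_trans (tdist_le x n))//.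
by rewrite (_ : x + _ = y + 2 * pi * n%:~R + (x - y)) ?ler_normD//; ring.
Qed.

Lemma tdist_period x : tdist (x + 2 * pi) = tdist x.
Proof.
congr inf; apply/seteqP; split => _ [n _ <-].
  by exists (n + 1) => //; congr `|_|; rewrite intrD; ring.
by exists (n - 1) => //; congr `|_|; rewrite intrB; ring.
Qed.

Lemma tdist_fund t r : 0 <= t <= 2 * pi -> tdist t < r -> t < r \/ 2 * pi - t < r.
Proof.
move=> ht /tdist_lt [n]; have p0 := twopi_gt0 R.
have [n0|n0] := lerP 0 n.
  have : 0 <= n%:~R :> R by rewrite ler0z.
  by move=> n0' H; left; move: H; rewrite ger0_norm; nra.
have n1 : n%:~R <= -1 :> R by rewrite -[-1](intrN R 1) ler_int; lia.
by move=> H; right; move: H; rewrite ler0_norm; nra.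
Qed.

Definition clamp (u : R) := Num.max 0 (Num.min 1 u).

Lemma clamp01 (u : R) : 0 <= clamp u <= 1.
Proof. by rewrite /clamp le_max lexx /= ge_max ler01 ge_min lexx. Qed.

Lemma clamp_lip (u v : R) : `|clamp u - clamp v| <= `|u - v|.
Proof.
have H (x y : R) : clamp x <= clamp y + `|x - y|.
  rewrite /clamp ge_max addr_ge0//= ?le_max ?lexx//.
  have [h|h] := leP 1 y.
    by rewrite (@le_trans _ _ 1) ?ge_min ?lexx// ler_wpDr// le_max lexx orbT.
  rewrite (@le_trans _ _ (y + `|x - y|))//; last by rewrite lerD2r le_max lexx orbT.
  by rewrite ge_min (_ : x <= y + `|x - y|) ?orbT// -lerBlDl ler_norm.
rewrite ler_norml; have := H u v; have := H v u; rewrite [`|v - u|]distrC; lra.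
Qed.

(** Height 1 up to distance 2 r and 0 beyond 3 r: the margin r makes it equal to 1 on a whole
    neighbourhood of the interval of radius r. *)
Definition tent r t := clamp (3 - tdist t / r).

Lemma tent01 r t : 0 <= tent r t <= 1. Proof. exact: clamp01. Qed.

Lemma tent_eq1 r t : 0 < r -> tdist t <= 2 * r -> tent r t = 1.
Proof.
move=> r0 h; rewrite /tent /clamp; have : tdist t / r <= 2 by rewrite ler_pdivrMr.
move=> h2; rewrite min_l; last by lra.
by rewrite max_r.
Qed.

Lemma tent_eq0 r t : 0 < r -> 3 * r <= tdist t -> tent r t = 0.
Proof.
move=> r0 h; rewrite /tent /clamp; have : 3 <= tdist t / r by rewrite ler_pdivlMr.
move=> h2; rewrite min_r; last by lra.
by rewrite max_l//; lra.
Qed.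

Lemma tent_lip r x y : 0 < r -> `|tent r x - tent r y| <= r^-1 * `|x - y|.
Proof.
move=> r0; apply: (le_trans (clamp_lip _ _)).
rewrite (_ : 3 - tdist x / r - (3 - tdist y / r) = r^-1 * (tdist y - tdist x)); last by ring.
rewrite normrM ger0_norm ?invr_ge0 ?(ltW r0)// ler_pM2l ?invr_gt0//.
rewrite ler_norml; have := tdist_lip x y; have := tdist_lip y x; rewrite [`|y - x|]distrC; lra.
Qed.

Lemma tent_period r t : tent r (t + 2 * pi) = tent r t.
Proof. by rewrite /tent tdist_period. Qed.

Lemma rlip_cont (u : R -> R) (L : R) : (forall x y, `|u x - u y| <= L * `|x - y|) -> continuous u.
Proof.
move=> h; have [] : cont (fun t => (u t)%:C); last by [].
by apply: (@lip_cont _ _ L) => x y; rewrite -rmorphB /= cmod_real.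
Qed.

Lemma tent_cont r : 0 < r -> continuous (tent r).
Proof. by move=> r0; apply: (@rlip_cont _ r^-1) => x y; exact: tent_lip. Qed.

(** The arc of radius r around 0 has normalised length r / pi, at most r. *)
Lemma mean_local (u : R -> R) (M r : R) : continuous u -> 0 < r -> 0 <= M ->
  (forall t, u t <= M) -> (forall t, r <= tdist t -> u t <= 0) -> mean u <= M * r.
Proof.
move=> cu r0 M0 uM u0; have p0 := twopi_gt0 R; have p2 := pi_ge2 R.
have [rp|rp] := leP pi r.
  rewrite (@le_trans _ _ M)//; last by rewrite ler_peMr//; lra.
  by rewrite -[leRHS]mean_cst; apply: mean_le => //; exact: cst_continuous.
rewrite /mean mulrC ler_pdivrMr//.
rewrite (@integral_split _ u 0 r (2 * pi))//; [|lra|lra].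
rewrite (@integral_split _ u r (2 * pi - r) (2 * pi))//; [|lra|lra].
have h1 := @integral_le_cst _ u 0 r M cu (ltW r0) (fun t _ => uM t).
have h2 := @integral_le_cst _ u r (2 * pi - r) 0 cu ltac:(lra).
have h3 := @integral_le_cst _ u (2 * pi - r) (2 * pi) M cu ltac:(lra) (fun t _ => uM t).
have : Rintegral lebesgue_measure `[r, 2 * pi - r] u <= 0.
  rewrite -[leRHS](mul0r (2 * pi - r - r)); apply: h2 => t ht.
  apply: u0; rewrite leNgt; apply/negP => /tdist_fund; rewrite (_ : 0 <= t <= 2 * pi); last by lra.
  by move=> /(_ isT) [|]; lra.
rewrite subr0 in h1; rewrite (_ : 2 * pi - (2 * pi - r) = r) in h3; last by ring.
have z0 : 0 <= M * r by rewrite mulr_ge0// ltW.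
have : M * r * 2 <= M * r * (2 * pi) by rewrite ler_wpM2l//; lra.
lra.
Qed.

Lemma mean_tent r : 0 < r -> mean (tent r) <= 3 * r.
Proof.
move=> r0; rewrite -[leRHS]mul1r; apply: mean_local => //; [exact: tent_cont|by rewrite mulr_gt0| |].
  by move=> t; case/andP: (tent01 r t).
by move=> t /(tent_eq0 r0) ->.
Qed.

Lemma cont_shiftr (u : R -> R) h : continuous u -> continuous (fun t => u (t + h)).
Proof. by move=> cu; have [] := @cont_shift R _ h (cont_real cu). Qed.

Lemma cont_sqrB (u v : R -> R) : continuous u -> continuous v -> continuous (fun t => (u t - v t) ^+ 2).
Proof.
move=> cu cv t; under eq_fun do rewrite expr2.
by apply: cvgM; apply: cvgB; [exact: cu|exact: cv|exact: cu|exact: cv].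
Qed.

(** Both tents have mean O(r); for h <= r their difference is at most h / r and lives on an arc of
    radius 4 r. The first bound serves for frequencies below 1 / r, the second for those above. *)
Lemma tent_modulus r h : 0 < r -> 0 <= h ->
  mean (fun t => (tent r (t + h) - tent r t) ^+ 2) <= 6 * Num.min r (h ^+ 2 / r).
Proof.
move=> r0 h0; have ct := tent_cont r0; have cth := cont_shiftr (h := h) ct.
have c2 := cont_sqrB cth ct.
have H1 : mean (fun t => (tent r (t + h) - tent r t) ^+ 2) <= 6 * r.
  have -> : 6 * r = 3 * r + 3 * r by ring.
  rewrite (le_trans _ (lerD (mean_tent r0) (mean_tent r0)))//.
  rewrite -{1}(mean_shift h ct (tent_period r)) -mean_D//.
  apply: mean_le => //; first by move=> t; apply: cvgD; [exact: cth|exact: ct].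
  move=> t _; have := tent01 r (t + h); have := tent01 r t; nra.
rewrite minr_pMr// le_min H1 /=.
have [hr|hr] := leP r h.
  rewrite (le_trans H1)// ler_pM2l// ler_pdivlMr//; nra.
rewrite (@le_trans _ _ ((h / r) ^+ 2 * (4 * r)))//; last first.
  rewrite (_ : (h / r) ^+ 2 * (4 * r) = 4 * (h ^+ 2 / r)); last by field; rewrite gt_eqF.
  by rewrite ler_wpM2r ?ler_nat// divr_ge0 ?sqr_ge0 ?(ltW r0).
apply: mean_local => //; [by rewrite mulr_gt0|by rewrite sqr_ge0| |].
  move=> t; have := @tent_lip r (t + h) t r0; rewrite (_ : t + h - t = h) ?(ger0_norm h0); last by ring.
  move=> hl.
  rewrite -[leLHS]real_normK ?num_real//; apply: lerXn2r; rewrite ?nnegrE ?divr_ge0 ?(ltW r0)//.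
  by rewrite mulrC.
move=> t ht; rewrite !tent_eq0 ?subrr ?expr0n//; first by lra.
have := tdist_lip t (t + h); rewrite opprD addrA subrr sub0r normrN ger0_norm//; lra.
Qed.

End TorusDist.

Section Cutoff.
Variable R : realType.

Lemma powRD_pos (x a b : R) : 0 < x -> x `^ (a + b) = x `^ a * x `^ b.
Proof. by move=> x0; rewrite powRD// (gt_eqF x0) implybT. Qed.

Lemma powRV_pos (x a : R) : 0 < x -> x^-1 `^ a = x `^ (- a).
Proof. by move=> x0; rewrite -(powR_inv1 (ltW x0)) -powRrM mulN1r. Qed.

Implicit Types (x y r h c t s : R) (n : int) (l : seq (R * R)).

Lemma powR_expn (x a : R) k : 0 <= x -> (x ^+ k) `^ a = (x `^ a) ^+ k.
Proof.
by move=> x0; rewrite -[x ^+ k]powR_mulrn// -powRrM mulrC powRrM powR_mulrn ?powR_ge0.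
Qed.

Lemma exists_dyadic r : 0 < r <= 1 -> exists i : nat, r^-1 <= 2 ^+ i <= 2 * r^-1.
Proof.
move=> /andP[r0 r1].
have ex : exists i : nat, r^-1 <= 2 ^+ i :> R.
  exists (Num.truncn r^-1).+1.
  rewrite (le_trans (ltW (truncnS_gt r^-1)))// -natrX ler_nat ltnW// ltn_expl//.
exists (ex_minn ex); case: ex_minnP => -[|i] hi hmin; rewrite hi /=.
  by rewrite expr0 ler_pdivlMr//; lra.
rewrite exprS ler_pM2l// leNgt; apply/negP => /ltW /hmin; by rewrite ltnn.
Qed.

(** The sum splits where 2^i reaches 1 / r. Below, the minimum is at most r and the terms grow
    geometrically since A > 1, which gives 2 / (A - 1) in the constant; above, they decay
    geometrically since A <= 2, which gives 8. Both parts have the size r^(1 - 2c) of the term at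
    the crossing, which is the s-content of the interval for s = 1 - 2c. *)
Lemma tent_series c : 0 < c < 1 / 2 -> exists2 C : R, 0 < C & forall r (I : nat), 0 < r <= 1 ->
  \sum_(i < I) (2 `^ (2 * c)) ^+ i * Num.min r ((2 / 2 ^+ i) ^+ 2 / r) <= C * r `^ (1 - 2 * c).
Proof.
move=> c01; set A := 2 `^ (2 * c).
have A1 : 1 < A.
  by rewrite -(powRr0 2) /A /powR pnatr_eq0 /= ltr_expR ltr_pM2r ?ln_gt0//; lra.
have A2 : A <= 2 by rewrite -[leRHS]powRr1// /A ler_powR//; lra.
have A0 : 0 <= A by lra.
exists (2 / (A - 1) + 8); first by rewrite ltr_wpDl// divr_ge0//; lra.
move=> r I /[dup] r01 /andP[r0 r1].
have [k hk] := exists_dyadic r01.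
pose y i := A ^+ i * Num.min r ((2 / 2 ^+ i) ^+ 2 / r).
have y0 i : 0 <= y i.
  by rewrite mulr_ge0 ?exprn_ge0// le_min (ltW r0) /= divr_ge0 ?sqr_ge0// ltW.
have P2 (j : nat) : A ^+ j = (2 ^+ j) `^ (2 * c).
  by rewrite powR_expn.
have rp : 0 < r `^ (1 - 2 * c) by rewrite powR_gt0.
have rE : r `^ (1 - 2 * c) = r * r^-1 `^ (2 * c).
  by rewrite powRD_pos// powRr1 ?(ltW r0)// powRV_pos.
have Ak : A ^+ k <= 2 * r^-1 `^ (2 * c).
  rewrite P2 (@le_trans _ _ ((2 * r^-1) `^ (2 * c)))//.
    by rewrite ge0_ler_powR ?nnegrE ?exprn_ge0 ?mulr_ge0 ?invr_ge0 ?(ltW r0)//; [lra|case/andP: hk].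
  by rewrite powRM ?invr_ge0 ?(ltW r0)// ler_wpM2r ?powR_ge0.
rewrite -(big_mkord xpredT y).
rewrite (@le_trans _ _ (\sum_(0 <= i < k + I) y i))//.
  by rewrite addnC [leRHS](big_cat_nat _ (n := I)) ?leq_addr//= lerDl sumr_ge0.
rewrite (big_cat_nat _ (n := k)) ?leq_addr//= mulrDl lerD//.
  rewrite (@le_trans _ _ (\sum_(0 <= i < k) A ^+ i * r))//.
    by apply: ler_sum => i _; rewrite ler_wpM2l ?exprn_ge0// ge_min lexx.
  rewrite -mulr_suml big_mkord.
  have := subrX1 A k => hA.
  have -> : \sum_(i < k) A ^+ i = (A ^+ k - 1) / (A - 1).
    by rewrite hA mulrC mulKf// gt_eqF// subr_gt0.
  rewrite rE (_ : (A ^+ k - 1) / (A - 1) * r = (A ^+ k - 1) * (r / (A - 1))); last by ring.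
  rewrite (_ : 2 / (A - 1) * _ = (2 * r^-1 `^ (2 * c)) * (r / (A - 1))); last by ring.
  rewrite ler_wpM2r ?divr_ge0 ?(ltW r0)//; lra.
rewrite -{1}(add0n k) big_addn (_ : (k + I - k = I)%N) ?addKn//.
rewrite (@le_trans _ _ (\sum_(0 <= i < I) A ^+ k * (4 / (2 ^+ k) ^+ 2 / r) * 2^-1 ^+ i))//.
  apply: ler_sum => i _; rewrite /y (@le_trans _ _ (A ^+ (i + k) * ((2 / 2 ^+ (i + k)) ^+ 2 / r)))//.
    by rewrite ler_wpM2l ?exprn_ge0// ge_min lexx orbT.
  have -> : A ^+ (i + k) * ((2 / 2 ^+ (i + k)) ^+ 2 / r) =
     A ^+ k * (4 / (2 ^+ k) ^+ 2 / r) * (A ^+ i / (2 ^+ i) ^+ 2).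
    have u0 : 2 ^+ i != 0 :> R by rewrite expf_neq0.
    have v0 : 2 ^+ k != 0 :> R by rewrite expf_neq0.
    have rn0 : r != 0 by rewrite gt_eqF.
    by rewrite !exprD; field; rewrite ?u0 ?v0 ?rn0.
  rewrite ler_wpM2l//.
    by rewrite mulr_ge0 ?exprn_ge0// divr_ge0 ?(ltW r0)// divr_ge0 ?exprn_ge0.
  rewrite ler_pdivrMr ?exprn_gt0// exprVn expr2 mulrA mulVf ?mul1r ?expf_neq0//.
  by apply: lerXn2r; rewrite ?nnegrE.
rewrite -mulr_sumr big_mkord.
have g2 := @geo_sum R 2^-1 I ltac:(by apply/andP; split; lra).
have g3 : \sum_(i < I) 2^-1 ^+ i <= 2 :> R by move: g2; rewrite (_ : (1 - 2^-1)^-1 = 2 :> R)//; field.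
rewrite (le_trans (ler_wpM2l _ g3))//.
  by rewrite mulr_ge0 ?exprn_ge0// divr_ge0 ?(ltW r0)// divr_ge0 ?exprn_ge0.
(* A ^ k / 4 ^ k = (2 ^ k) ^ (2 c - 2) <= r ^ (2 - 2 c) *)
have k0 : 0 < 2 ^+ k :> R by rewrite exprn_gt0.
have AkE : A ^+ k / (2 ^+ k) ^+ 2 <= r `^ (2 - 2 * c).
  have -> : A ^+ k / (2 ^+ k) ^+ 2 = ((2 ^+ k)^-1) `^ (2 - 2 * c).
    rewrite P2 powRV_pos// opprB [2 * c - 2]addrC powRD_pos// mulrC powRN powR_mulrn ?(ltW k0)//.
  rewrite ge0_ler_powR ?nnegrE ?invr_ge0 ?(ltW k0) ?(ltW r0)//; first by lra.
  by rewrite -[leRHS]invrK lef_pV2 ?posrE ?invr_gt0//; case/andP: hk.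
have r2E : r `^ (2 - 2 * c) = r * r `^ (1 - 2 * c).
  rewrite (_ : 2 - 2 * c = 1 + (1 - 2 * c)); last by ring.
  by rewrite powRD_pos// powRr1 ?(ltW r0).
have -> : A ^+ k * (4 / (2 ^+ k) ^+ 2 / r) * 2 = 8 * (A ^+ k / (2 ^+ k) ^+ 2 / r).
  by field; rewrite gt_eqF// gt_eqF.
by rewrite ler_pM2l// ler_pdivrMr// [leRHS]mulrC -r2E.
Qed.

End Cutoff.

(** * Sets of zero content are null for a weighted l^2 space *)

Section NullSets.
Variable R : realType.
Implicit Types (r h c t s e : R) (n : int) (l : seq (R * R)) (A : set R).

(* A has s-dimensional Hausdorff content zero, with finite covers. *)
Definition cov s A := forall e, 0 < e -> exists l, [/\ forall x, x \in l -> 0 < x.2,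
  forall t, A t -> exists2 x, x \in l & `|t - x.1| <= x.2 & \sum_(x <- l) x.2 `^ s <= e].

Lemma min_radius l : (forall x, x \in l -> 0 < x.2) ->
  exists2 d : R, 0 < d & forall x, x \in l -> d <= x.2.
Proof.
elim: l => [_|y l IH l0]; first by exists 1.
have [|d d0 dl] := IH; first by move=> x xl; apply: l0; rewrite inE xl orbT.
exists (Num.min d y.2); first by rewrite lt_min d0 l0// mem_head.
by move=> x; rewrite inE => /predU1P[->|/dl h]; rewrite ge_min ?lexx ?orbT// h.
Qed.

(** A maximum keeps the cutoff between 0 and 1, while its squared increments are still at most the
    sum of those of the single tents ([maxtent_sqr]). *)
Definition maxtent l t : R := \big[Num.max/0]_(x <- l) tent x.2 (t - x.1).

Lemma maxtent01 l t : 0 <= maxtent l t <= 1.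
Proof.
rewrite /maxtent; elim/big_ind: _ => //; first by rewrite lexx ler01.
  by move=> x y /andP[x0 x1] /andP[y0 y1]; rewrite le_max x0 ge_max x1 y1.
by move=> x _; exact: tent01.
Qed.

Lemma maxtent_ge l t x : x \in l -> tent x.2 (t - x.1) <= maxtent l t.
Proof.
rewrite /maxtent; elim: l => // y l IH; rewrite inE big_cons le_max => /predU1P[->|/IH ->].
  by rewrite lexx.
by rewrite orbT.
Qed.

Lemma maxtent_sum l t : maxtent l t <= \sum_(x <- l) tent x.2 (t - x.1).
Proof.
rewrite /maxtent; elim: l => [|y l IH]; first by rewrite !big_nil.
rewrite !big_cons ge_max lerDl; apply/andP; split.
  by apply: sumr_ge0 => x _; case/andP: (tent01 x.2 (t - x.1)).
by rewrite (le_trans IH)// lerDr; case/andP: (tent01 y.2 (t - y.1)).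
Qed.

Lemma max_dist (a b M N : R) :
  `|Num.max a M - Num.max b N| <= `|a - b| \/ `|Num.max a M - Num.max b N| <= `|M - N|.
Proof.
have k1 := ler_norm (a - b); have k2 := ler_norm (b - a); rewrite distrC in k2.
have k3 := ler_norm (M - N); have k4 := ler_norm (N - M); rewrite distrC in k4.
have [aM|Ma] := leP a M; have [bN|Nb] := leP b N; [by right| | |by left].
  by have [bM|Mb] := leP b M; [right|left]; rewrite ler_norml; apply/andP; split; lra.
by have [aN|Na] := leP a N; [right|left]; rewrite ler_norml; apply/andP; split; lra.
Qed.

Lemma max_sqr (a b M N : R) : (Num.max a M - Num.max b N) ^+ 2 <= (a - b) ^+ 2 + (M - N) ^+ 2.
Proof.
have sq (x y : R) : `|x| <= `|y| -> x ^+ 2 <= y ^+ 2.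
  by move=> h; rewrite -real_normK ?num_real// -[leRHS]real_normK ?num_real// lerXn2r ?nnegrE.
by have [/sq h|/sq h] := max_dist a b M N; rewrite (le_trans h)// ?lerDl ?lerDr sqr_ge0.
Qed.

Lemma maxtent_sqr l t t' :
  (maxtent l t - maxtent l t') ^+ 2 <= \sum_(x <- l) (tent x.2 (t - x.1) - tent x.2 (t' - x.1)) ^+ 2.
Proof.
rewrite /maxtent; elim: l => [|y l IH]; first by rewrite !big_nil subrr expr0n.
by rewrite !big_cons (le_trans (max_sqr _ _ _ _))// lerD2l.
Qed.

Lemma maxtent_lip l : (forall x, x \in l -> 0 < x.2) ->
  lip (fun t => (maxtent l t)%:C) (\sum_(x <- l) x.2^-1).
Proof.
move=> l0 t t'; rewrite -rmorphB /= cmod_real /maxtent.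
elim: l l0 => [|y l IH] l0; first by rewrite !big_nil subrr normr0 mul0r.
rewrite !big_cons mulrDl.
have hl x : x \in l -> 0 < x.2 by move=> xl; apply: l0; rewrite inE xl orbT.
have {IH} := IH hl; have := @tent_lip R y.2 (t - y.1) (t' - y.1) (l0 y (mem_head _ _)).
rewrite (_ : t - y.1 - (t' - y.1) = t - t'); last by ring.
move=> h1 h2; set u := Num.max _ _ - Num.max _ _.
have := normr_ge0 (t - t'); set d := `|t - t'| in h1 h2 *; move=> d0.
have y0 : 0 <= y.2^-1 * d by rewrite mulr_ge0// invr_ge0 ltW// l0// mem_head.
have L0 := le_trans (normr_ge0 _) h2.
by have [h|h] := max_dist (tent y.2 (t - y.1)) (tent y.2 (t' - y.1))
  (\big[Num.max/0]_(x <- l) tent x.2 (t - x.1)) (\big[Num.max/0]_(x <- l) tent x.2 (t' - x.1));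
  rewrite (le_trans h)// ?(le_trans h1)// ?(le_trans h2)// ?lerDl ?lerDr.
Qed.

Lemma maxtent_period l t : maxtent l (t + 2 * pi) = maxtent l t.
Proof. by rewrite /maxtent; apply: eq_bigr => x _; rewrite addrAC tent_period. Qed.

Lemma mean_sum (T : eqType) (l : seq T) (F : T -> R -> R) : (forall x, x \in l -> continuous (F x)) ->
  mean (fun t => \sum_(x <- l) F x t) = \sum_(x <- l) mean (F x) /\
  continuous (fun t => \sum_(x <- l) F x t).
Proof.
elim: l => [|y l IH] cF.
  rewrite big_nil; under eq_fun do rewrite big_nil.
  by rewrite mean_cst; split=> //; exact: cst_continuous.
have [|IH1 IH2] := IH; first by move=> x xl; apply: cF; rewrite inE xl orbT.
have cy : continuous (F y) by apply: cF; exact: mem_head.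
rewrite big_cons -IH1 -mean_D//; under eq_fun do rewrite big_cons.
by split=> // t; apply: cvgD; [exact: cy|exact: IH2].
Qed.

(** The cutoff is the maximum of the tents over a finite cover. On each dyadic block its energy is
    at most the sum of the energies of the tents, and [tent_series] sums these over the blocks to a
    multiple of r^s for each radius r, in total a multiple of the content. Tents being periodic, A'
    may differ from A by translations. *)
Lemma cov_null s c A A' : 0 < c < 1 / 2 -> s = 1 - 2 * c -> cov s A ->
  (forall x, A' x -> exists n, A (x + 2 * pi * n%:~R)) -> null_set c A'.
Proof.
move=> c01 sE covA AA' e e0.
have s01 : 0 < s < 1 by rewrite sE; lra.
have [C C0 hC] := tent_series c01.
(* 3 accounts for the coefficient at 0 and 24 C for the dyadic blocks. Below, content at most 1
   forces all radii to be at most 1, as [tent_series] requires. *)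
pose K := 3 + 24 * C; have K0 : 0 < K by rewrite addr_gt0// mulr_gt0.
pose e1 := Num.min 1 (e / K).
have e10 : 0 < e1 by rewrite lt_min ltr01 divr_gt0.
have [l [l0 lA lS]] := covA e1 e10.
have rS x : x \in l -> x.2 `^ s <= e1.
  move=> xl; rewrite (le_trans _ lS)// (big_rem x)//= lerDl sumr_ge0// => y _.
  exact: powR_ge0.
have r1 x : x \in l -> x.2 <= 1.
  move=> xl; rewrite leNgt; apply/negP => h.
  have : 1 < x.2 `^ s.
    have : 1 `^ s < x.2 `^ s by apply: gt0_ltr_powR; rewrite ?nnegrE//; lra.
    by rewrite powR1.
  by have := rS x xl; rewrite le_min => /andP[h1 _]; lra.
pose phi t := (maxtent l t)%:C : R[i].
have phiL := maxtent_lip l0.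
have cphi : contp phi.
  by split; [move=> t; rewrite /phi maxtent_period|exact: lip_cont phiL].
have cm : continuous (maxtent l) by case: cphi => _ [].
have pos x t : x \in l -> continuous (fun t => tent x.2 (t - x.1)).
  by move=> xl; apply: cont_shiftr; apply: tent_cont; exact: l0.
exists phi; split=> //.
- by exists (\sum_(x <- l) x.2^-1).
- have [d d0 dl] := min_radius l0.
  exists d => // x y Ay xy; have [n An] := AA' y Ay; have [z zl hz] := lA _ An.
  rewrite /phi; congr (_%:C); apply/eqP; rewrite eq_le; have /andP[_ ->] := maxtent01 l x.
  rewrite (le_trans _ (maxtent_ge x zl))// tent_eq1 ?l0//.
  have := tdist_lip (x - z.1) (y - z.1); rewrite (_ : x - z.1 - (y - z.1) = x - y); last by ring.
  have := tdist_le (y - z.1) n; rewrite (_ : y - z.1 + _ = y + 2 * pi * n%:~R - z.1); last by ring.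
  by have := dl z zl; lra.
pose Sr := \sum_(x <- l) x.2 `^ s.
move=> F uF; have [I FI] := seq_lt_pow F.
pose B i := 2 `^ (2 * c) * (2 `^ (2 * c)) ^+ i * (3 * \sum_(x <- l) Num.min x.2 ((2 / 2 ^+ i) ^+ 2 / x.2)).
have hB i G : uniq G -> (forall n, n \in G -> block i n) ->
    \sum_(n <- G) cmod (hat phi n) ^+ 2 * w R n `^ (2 * c) <= B i.
  move=> uG GB; set h := pi / 2 ^+ i.+1 : R.
  have h0 : 0 <= h by rewrite divr_ge0 ?pi_ge0 ?exprn_ge0.
  have h2 : h <= 2 / 2 ^+ i.
    rewrite /h exprS invfM mulrA ler_wpM2r ?invr_ge0 ?exprn_ge0//.
    by rewrite ler_pdivrMr//; have := pihalf_lt2 R; lra.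
  have b1 := block_bessel cphi uG GB; rewrite -/h in b1.
  have b2 : mean (fun t => cmod (phi (t + h) - phi t) ^+ 2) <=
      6 * \sum_(x <- l) Num.min x.2 ((2 / 2 ^+ i) ^+ 2 / x.2).
    have cF x : x \in l -> continuous (fun t => (tent x.2 (t + h - x.1) - tent x.2 (t - x.1)) ^+ 2).
      move=> xl; apply: cont_sqrB; last exact: pos.
      by apply: (@cont_shiftr _ (fun t => tent x.2 (t - x.1))); exact: pos.
    have [ms cs] := mean_sum cF.
    rewrite (@le_trans _ _ (mean (fun t => \sum_(x <- l) (tent x.2 (t + h - x.1) - tent x.2 (t - x.1)) ^+ 2)))//.
      have -> : (fun t => cmod (phi (t + h) - phi t) ^+ 2) = fun t => (maxtent l (t + h) - maxtent l t) ^+ 2.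
        by apply/funext => t; rewrite /phi -rmorphB /= cmod_real real_normK ?num_real.
      apply: mean_le => //; last by move=> t _; exact: maxtent_sqr.
      by apply: cont_sqrB => //; exact: cont_shiftr.
    rewrite ms mulr_sumr big_seq [leRHS]big_seq; apply: ler_sum => x xl.
    have x0 := l0 x xl.
    have ct := tent_cont x0; have cth := cont_shiftr (h := h) ct.
    pose D t := (tent x.2 (t + h) - tent x.2 t) ^+ 2.
    have -> : (fun t => (tent x.2 (t + h - x.1) - tent x.2 (t - x.1)) ^+ 2) = fun t => D (t + - x.1).
      by apply/funext => t; rewrite /D addrAC.
    rewrite (@mean_shift _ D (- x.1)); last 2 first.
    - exact: cont_sqrB.
    - by move=> t; rewrite /D addrAC !tent_period.
    rewrite (le_trans (tent_modulus x0 h0))// ler_pM2l// le_min !ge_min lexx /=.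
    rewrite ler_pM2r ?invr_gt0//; apply/orP; right; by apply: lerXn2r; rewrite ?nnegrE// divr_ge0 ?exprn_ge0.
  rewrite (@le_trans _ _ (\sum_(n <- G) cmod (hat phi n) ^+ 2 * (2 `^ (2 * c) * (2 `^ (2 * c)) ^+ i)))//.
    rewrite big_seq [leRHS]big_seq; apply: ler_sum => n nG; rewrite ler_wpM2l ?sqr_ge0//.
    have wb := block_w R (GB n nG).
    rewrite -exprS (@le_trans _ _ ((2 ^+ i.+1) `^ (2 * c)))//.
      by rewrite ge0_ler_powR ?nnegrE ?exprn_ge0 ?(ltW (w_gt0 _ _))//; lra.
    by rewrite powR_expn.
  rewrite -mulr_suml /B [leLHS]mulrC ler_wpM2l ?mulr_ge0 ?exprn_ge0 ?powR_ge0//.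
  rewrite (le_trans b1)// ler_pdivrMr// (le_trans b2)// le_eqVlt; apply/orP; left; apply/eqP; ring.
have y0 : 0 <= cmod (hat phi 0) ^+ 2 * w R 0 `^ (2 * c) by rewrite mulr_ge0 ?sqr_ge0 ?wt_ge0.
rewrite (le_trans (block_sum hB y0 uF FI))//.
have z1 : cmod (hat phi 0) ^+ 2 * w R 0 `^ (2 * c) <= 3 * Sr.
  rewrite /w absz0 addr0 powR1 mulr1 hat0 /phi tint_real cmod_real.
  have m0 : 0 <= mean (maxtent l) by apply: mean_ge0 => t; case/andP: (maxtent01 l t).
  have m1 : mean (maxtent l) <= 1.
    rewrite -[leRHS]mean_cst; apply: mean_le => //; first exact: cst_continuous.
    by move=> t _; case/andP: (maxtent01 l t).
  have m2 : mean (maxtent l) <= 3 * Sr.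
    have [ms cs] := mean_sum (pos^~ 0).
    rewrite (@le_trans _ _ (mean (fun t => \sum_(x <- l) tent x.2 (t - x.1))))//.
      by apply: mean_le => // t _; exact: maxtent_sum.
    rewrite ms /Sr mulr_sumr big_seq [leRHS]big_seq; apply: ler_sum => x xl.
    have x0 := l0 x xl.
    rewrite (@mean_shift _ (tent x.2)); [|exact: tent_cont|exact: tent_period].
    rewrite (le_trans (mean_tent x0))// ler_pM2l// ger1_powR ?x0 ?r1//; lra.
  by rewrite ger0_norm//; nra.
have z2 : \sum_(i < I) B i <= 24 * C * Sr.
  have -> : \sum_(i < I) B i = 3 * 2 `^ (2 * c) *
      \sum_(x <- l) \sum_(i < I) (2 `^ (2 * c)) ^+ i * Num.min x.2 ((2 / 2 ^+ i) ^+ 2 / x.2).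
    rewrite exchange_big /= mulr_sumr; apply: eq_bigr => i _; rewrite /B -mulr_sumr; ring.
  have A2 : 2 `^ (2 * c) <= 2 :> R by rewrite -[leRHS]powRr1// ler_powR//; lra.
  have S1 : \sum_(x <- l) \sum_(i < I) (2 `^ (2 * c)) ^+ i * Num.min x.2 ((2 / 2 ^+ i) ^+ 2 / x.2) <= C * Sr.
    rewrite /Sr mulr_sumr big_seq [leRHS]big_seq; apply: ler_sum => x xl.
    by rewrite sE hC// l0// r1.
  have CS : 0 <= C * Sr by rewrite mulr_ge0 ?(ltW C0)// sumr_ge0// => x _; exact: powR_ge0.
  rewrite (@le_trans _ _ (3 * 2 `^ (2 * c) * (C * Sr)))//.
    by rewrite ler_wpM2l// mulr_ge0 ?powR_ge0.
  rewrite (_ : 24 * C * Sr = (24 : R) * (C * Sr)); last by ring.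
  by rewrite ler_wpM2r//; lra.
have z3 : K * Sr <= e.
  by rewrite mulrC -ler_pdivlMr// (le_trans lS)// ge_min lexx orbT.
by apply: le_trans z3; rewrite (mulrDl 3 (24 * C)); apply: lerD.
Qed.

End NullSets.

(** * Hausdorff measure zero and finite covers by intervals *)

Section Hausdorff.
Variable R : realType.
Implicit Types (s e d r t : R) (A E U : set R).

Lemma finite_nat_bound (A : set nat) : finite_set A -> exists N, forall i, A i -> (i < N)%N.
Proof.
move=> /finite_seqP[l ->]; exists (\max_(i <- l) i).+1 => i /= il.
by rewrite ltnS; apply: leq_bigmax_seq.
Qed.

Lemma diam_ge0 A : (0 <= diam A)%E.
Proof. by rewrite /diam le_max lexx. Qed.

Lemma diam_dist A x y : A x -> A y -> (`|x - y|%:E <= diam A)%E.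
Proof.
move=> Ax Ay; rewrite /diam le_max; apply/orP; right.
by apply: ereal_sup_ubound; exists x, y.
Qed.

Lemma diam_le A r : 0 <= r -> (forall x y, A x -> A y -> `|x - y| <= r) ->
  (diam A <= r%:E)%E.
Proof.
move=> r0 h; rewrite /diam ge_max lee_fin r0 /=.
by apply: ge_ereal_sup => _ [x [y [Ax Ay ->]]]; rewrite lee_fin h.
Qed.

Lemma powRVK s r : 0 < s -> 0 <= r -> (r `^ s^-1) `^ s = r.
Proof. by move=> s0 r0; rewrite -powRrM mulVf ?gt_eqF// powRr1. Qed.

Lemma lt_powR_inv s r x : 0 < s -> 0 <= r -> 0 <= x -> r `^ s < x -> r < x `^ s^-1.
Proof.
move=> s0 r0 x0 h; rewrite ltNge; apply/negP => h2.
have : (x `^ s^-1) `^ s <= r `^ s by rewrite ge0_ler_powR ?nnegrE ?powR_ge0// ltW.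
by rewrite powRVK// leNgt h.
Qed.

Lemma le_powR_inv s r x : 0 < s -> 0 <= r -> 0 <= x -> r `^ s <= x -> r <= x `^ s^-1.
Proof.
move=> s0 r0 x0 h; rewrite leNgt; apply/negP => h2.
have : (x `^ s^-1) `^ s < r `^ s by rewrite gt0_ltr_powR ?nnegrE ?powR_ge0.
by rewrite powRVK// ltNge h.
Qed.

Lemma diam_interval s e U : 0 < s -> 0 < e -> (diam U <= 1)%E ->
  exists x : R * R, [/\ 0 < x.2, forall t, U t -> `|x.1 - t| < x.2 &
    ((x.2 `^ s)%:E <= diam U `^ s + e%:E)%E].
Proof.
move=> s0 e0 U1; have dU0 := diam_ge0 U.
have [d dE] : exists d, diam U = d%:E.
  by move: U1 dU0; case: (diam U) => [d _ _|//|//]; exists d.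
have d0 : 0 <= d by rewrite dE lee_fin in dU0.
have q0 : 0 < d `^ s + e by rewrite ltr_wpDl ?powR_ge0.
have [[c Uc]|nU] := pselect (exists c, U c); last first.
  exists (0, (d `^ s + e) `^ s^-1); split=> /=; first exact: powR_gt0.
    by move=> t Ut; exfalso; apply: nU; exists t.
  by rewrite powRVK ?(ltW q0)// dE poweR_EFin.
exists (c, (d `^ s + e) `^ s^-1); split=> /=; first exact: powR_gt0.
  move=> t Ut; rewrite (@le_lt_trans _ _ d)//.
    by rewrite -lee_fin -dE diam_dist.
  by apply: lt_powR_inv; rewrite ?(ltW q0)// ltrDl.
by rewrite powRVK ?(ltW q0)// dE poweR_EFin.
Qed.

Lemma hausdorff_premeasure_ge0 s d A : (0 <= hausdorff_premeasure s d A)%E.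
Proof.
apply: le_ereal_inf_tmp => _ [U [_ _ ->]].
by apply: nneseries_ge0 => n _ _; exact: poweR_ge0.
Qed.

Lemma sum_geo2 (n : nat) : \sum_(i < n) (2^-1 : R) ^+ i.+1 <= 1.
Proof.
suff -> : \sum_(i < n) (2^-1 : R) ^+ i.+1 = 1 - 2^-1 ^+ n by rewrite gerBl exprn_ge0.
elim: n => [|n IH]; first by rewrite big_ord0 expr0 subrr.
by rewrite big_ord_recr /= IH exprS; field.
Qed.

(** Compactness extracts a finite cover from slightly enlarged open balls, the enlargements costing
    at most e / 3 in total. *)
Lemma hausdorff_cov s E : 0 < s -> closed_torus E ->
  hausdorff_measure s (E `&` `[0, 2 * pi[) = 0%E -> cov s (E `&` `[0, 2 * pi[).
Proof.
move=> s0 [pE cE] H0 e e0; set A := E `&` _.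
have e30 : 0 < e / 3 by rewrite divr_gt0.
have : (hausdorff_premeasure s 1 A < (e / 3)%:E)%E.
  rewrite (@le_lt_trans _ _ 0%E) ?lte_fin// -H0.
  by apply: ereal_sup_ubound; exists 1 => //; rewrite /= ltr01.
move=> /ereal_inf_lt[_ [U [AU dU ->]] sU].
have pos i : 0 < e / 3 * 2^-1 ^+ i.+1 by rewrite mulr_gt0// exprn_gt0 ?invr_gt0.
have [x hx] := choice (fun i => diam_interval s0 (pos i) (dU i)).
(* An extra ball at 2 pi, paid by another third of e, covers the endpoint missing from [[0, 2 *
   pi[], so that compactness can be used on the closed interval. *)
pose y i := if i is j.+1 then x j else (2 * pi, (e / 3) `^ s^-1).
have y0 i : 0 < (y i).2 by case: i => [|i] /=; [exact: powR_gt0|case: (hx i)].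
have cA : compact (E `&` `[0, 2 * pi]).
  by rewrite setIC; apply: compact_closedI => //; exact: segment_compact.
rewrite compact_cover in cA.
have [i _|t [Et]|D _ DA] := cA nat setT (fun i => ball (y i).1 (y i).2).
- by apply: ball_open; exact: y0.
- rewrite /= in_itv /= => /andP[t0]; rewrite le_eqVlt => /predU1P[->|t1].
    by exists 0%N => //=; rewrite /ball /= subrr normr0 powR_gt0.
  have [|i _ Ui] := AU t; first by split=> //=; rewrite in_itv /= t0.
  by exists i.+1 => //=; case: (hx i) => _ /(_ _ Ui).
have [N DN] := finite_nat_bound (finite_fset D).
exists [seq y i | i <- iota 0 N.+1]; split.
- by move=> _ /mapP[i _ ->]; exact: y0.
- move=> t [Et]; rewrite /= in_itv /= => /andP[t0 t1].
  have [|i iD] := DA t; first by split=> //=; rewrite in_itv /= t0 ltW.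
  rewrite /ball /= => h; exists (y i); last by rewrite distrC ltW.
  by apply: (@map_f _ _ y (iota 0 N.+1)); rewrite mem_iota add0n leq0n ltnS (ltnW (DN _ iD)).
rewrite big_map -[iota _ _]/(index_iota 0 N.+1) big_mkord big_ord_recl /= powRVK ?(ltW e30)//.
have h1 : ((\sum_(i < N) (x i).2 `^ s)%:E <= (e / 3)%:E + (e / 3)%:E)%E.
  rewrite -sumEFin (@le_trans _ _ (\sum_(i < N) (diam (U i) `^ s + (e / 3 * 2^-1 ^+ i.+1)%:E))%E)//.
    by apply: lee_sum => i _; case: (hx i).
  rewrite big_split /=; apply: leeD.
    rewrite (le_trans _ (ltW sU))// -(big_mkord xpredT (fun i => diam (U i) `^ s)%E).
    by apply: nneseries_lim_ge => n *; exact: poweR_ge0.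
  by rewrite sumEFin lee_fin -mulr_sumr ler_piMr ?(ltW e30)// sum_geo2.
rewrite -EFinD lee_fin in h1.
have -> : \sum_(i < N) (x (0 + i)%N).2 `^ s = \sum_(i < N) (x i).2 `^ s by [].
by lra.
Qed.

Lemma cov_hausdorff s A : 0 < s -> cov s A -> hausdorff_measure s A = 0%E.
Proof.
move=> s0 cA; apply/eqP; rewrite eq_le; apply/andP; split; last first.
  rewrite (le_trans (hausdorff_premeasure_ge0 s 1 A))//.
  by apply: ereal_sup_ubound; exists 1 => //; rewrite /= ltr01.
apply: ge_ereal_sup => _ [d /= d0 <-]; apply/lee_addgt0Pr => e e0; rewrite add0e.
(* The first bound compensates for diameters being up to twice the radii, the second keeps every
   diameter at most d. *)
pose e1 := Num.min (e / 2 `^ s) ((d / 2) `^ s).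
have e10 : 0 < e1 by rewrite lt_min divr_gt0 ?powR_gt0//= divr_gt0.
have [l [l0 lA lS]] := cA _ e10.
pose U i := if (i < size l)%N then [set t | `|t - (nth (0, 0) l i).1| <= (nth (0, 0) l i).2] else set0.
have ln i : (i < size l)%N -> 0 < (nth (0, 0) l i).2 by move=> il; apply: l0; exact: mem_nth.
have dU i : (diam (U i) <= (if (i < size l)%N then 2 * (nth (0, 0) l i).2 else 0)%:E)%E.
  apply: diam_le; first by case: ifP => // /ln h; lra.
  rewrite /U; case: ifP => //= il x y h1 h2.
  have := ler_distD (nth (0,0) l i).1 x y; rewrite (distrC (nth (0,0) l i).1 y); lra.
have dU0 i : (size l <= i)%N -> diam (U i) = 0%E.
  by move=> il; apply/eqP; rewrite eq_le diam_ge0 andbT; have := dU i; rewrite ltnNge il.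
rewrite (@le_trans _ _ (\sum_(0 <= i <oo) diam (U i) `^ s)%E)//.
  apply: ereal_inf_lbound; exists U; split=> //.
    move=> t /lA[x xl h]; exists (index x l) => //.
    by rewrite /U index_mem xl /= nth_index.
  move=> i; rewrite (le_trans (dU i))// lee_fin; case: ifP => [il|]; last by rewrite ltW.
  rewrite mulrC -ler_pdivlMr//; have d2 : 0 < d / 2 by rewrite divr_gt0.
  have -> : d / 2 = ((d / 2) `^ s) `^ s^-1 by rewrite -powRrM mulfV ?gt_eqF// powRr1 ?(ltW d2).
  apply: le_powR_inv; rewrite ?powR_ge0 ?(ltW (ln _ il))//.
  apply: le_trans (le_trans lS _); last by rewrite ge_min lexx orbT.
  have xl := mem_nth (0,0) il.
  rewrite (big_rem _ xl)/= lerDl sumr_ge0// => y _; exact: powR_ge0.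
rewrite (nneseries_split _ (size l)); last by move=> i _; exact: poweR_ge0.
rewrite add0n [X in (_ + X)%E]eseries0 ?adde0; last first.
  by move=> i il _; rewrite dU0// poweR_EFin powR0// gt_eqF.
rewrite (@le_trans _ _ (\sum_(0 <= i < size l) ((2 * (nth (0,0) l i).2) `^ s)%:E)%E)//.
  rewrite !big_mkord; apply: lee_sum => i _; rewrite -poweR_EFin.
  apply: gt0_ler_poweR; rewrite ?in_itv /= ?lee_fin ?diam_ge0 ?(ltW s0)//.
  - by rewrite leey.
  - by have := ln _ (ltn_ord i) => h; rewrite leey andbT; lra.
  - by have := dU i; rewrite ltn_ord.
rewrite sumEFin lee_fin.
under eq_big_nat => i /andP[_ il] do rewrite powRM ?(ltW (ln _ il))//.
rewrite -mulr_sumr -(big_nth (0,0) xpredT (fun x => x.2 `^ s)) mulrC -ler_pdivlMr ?powR_gt0//.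
by rewrite (le_trans lS)// ge_min lexx.
Qed.

Lemma dimT_le s E : 0 < s -> cov s (E `&` `[0, 2 * pi[) -> (dimT E <= s%:E)%E.
Proof.
move=> s0 c; apply: ereal_inf_lbound; exists s => //; split=> //.
exact: cov_hausdorff.
Qed.

Lemma dimT_lt s E : closed_torus E -> (dimT E < s%:E)%E ->
  exists2 s' : R, 0 < s' < s & cov s' (E `&` `[0, 2 * pi[).
Proof.
move=> cE /ereal_inf_lt[_ [s' [s0 H0]] <-]; rewrite lte_fin => ss.
by exists s'; [rewrite s0|exact: hausdorff_cov].
Qed.

Lemma dimT_ge s E : closed_torus E ->
  (forall s', 0 < s' < s -> ~ cov s' (E `&` `[0, 2 * pi[)) -> (s%:E <= dimT E)%E.
Proof.
move=> cE h; rewrite leNgt; apply/negP => /(dimT_lt cE)[s' s0 c].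
exact: (h s').
Qed.

Lemma dimT_ge0 E : (0 <= dimT E)%E.
Proof. by apply: le_ereal_inf_tmp => _ [s [s0 _] <-]; rewrite lee_fin ltW. Qed.

End Hausdorff.

(** * Summability of powers of dual sequences; zero sets of small dimension *)

Section DualSums.
Variable R : realType.
Implicit Types (s : int -> R[i]) (b c q v x y sg la : R).

Lemma wt_sum sg : 1 < sg -> exists C, bnd (fun n => w R n `^ (- sg)) C.
Proof.
move=> s1; pose r : R := 2 `^ (1 - sg).
have r01 : 0 <= r < 1.
  rewrite powR_ge0 /= -(powRr0 2) /r /powR pnatr_eq0 /= ltr_expR ltr_pM2r ?ln_gt0//; lra.
exists (1 + 4 * (1 - r)^-1) => F uF; have [I FI] := seq_lt_pow F.
have hB i G : uniq G -> (forall n, n \in G -> block i n) ->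
    \sum_(n <- G) w R n `^ (- sg) <= 4 * r ^+ i.
  move=> uG GB; have i0 : 0 < 2 ^+ i :> R by rewrite exprn_gt0.
  rewrite (@le_trans _ _ (\sum_(n <- G) (2 ^+ i) `^ (- sg)))//.
    rewrite big_seq [leRHS]big_seq; apply: ler_sum => n nG.
    have /andP[h _] := GB n nG.
    rewrite -!powRV_pos ?w_gt0// ge0_ler_powR ?nnegrE ?invr_ge0 ?(ltW (w_gt0 _ _)) ?(ltW i0)//.
      by lra.
    rewrite lef_pV2 ?posrE ?w_gt0// /w -natrX ler_wpDl// ler_nat//.
  rewrite big_const_seq count_predT iter_addr_0 -[leLHS]mulr_natl.
  rewrite /r -powR_expn// powRD_pos// powRr1 ?(ltW i0)// mulrA ler_wpM2r ?powR_ge0//.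
  by rewrite -natrX -natrM ler_nat block_size.
rewrite (le_trans (block_sum hB _ uF FI)) ?powR_ge0//.
rewrite /w absz0 addr0 powR1 lerD2l -mulr_sumr ler_pM2l//.
exact: geo_sum.
Qed.

Lemma powR_interp la x y : 0 <= la <= 1 -> 0 <= x -> 0 <= y ->
  x `^ la * y `^ (1 - la) <= x + y.
Proof.
move=> l01 x0 y0; set m := Num.max x y.
have m0 : 0 <= m by rewrite le_max x0.
rewrite (@le_trans _ _ (m `^ la * m `^ (1 - la)))//.
  by apply: ler_pM; rewrite ?powR_ge0// ge0_ler_powR ?nnegrE// ?le_max ?lexx ?orbT//; lra.
rewrite -powRD; last by rewrite subrKC oner_eq0.
by rewrite subrKC powRr1// /m ge_max; lra.
Qed.

(* The first alternative interpolates between the q-th powers and a summable power of w,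
   the second one uses that s n * w n ^ (- b) is bounded. *)
Lemma dual_sums q b c s (K : nat) : 0 < q -> (0 < K)%N ->
  2 * K%:R < q /\ 1 - 2 * c < 2 * K%:R / q * (1 - b * q) \/ q <= 2 * K%:R /\ K%:R * b <= c ->
  bnd (fun n => cmod (s n) `^ q * w R n `^ (- (q * b))) (2 `^ q) ->
  exists B, bnd (fun n => cmod (s n) ^+ (2 * K) * w R n `^ (- (2 * c))) B.
Proof.
move=> q0 K0 hc sq.
have pow n : cmod (s n) ^+ (2 * K) = cmod (s n) `^ (2 * K%:R).
  by rewrite -natrM powR_mulrn ?cmod_ge0.
have kk : (0 : R) < K%:R by rewrite ltr0n.
case: hc => [[Kq hc]|[qK hc]].
  pose la := 2 * K%:R / q.
  have qn0 := gt_eqF q0.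
  have l01 : 0 <= la <= 1.
    by rewrite divr_ge0 ?mulr_ge0// ?(ltW q0)//= ler_pdivrMr// mul1r (ltW Kq).
  have l1 : 0 < 1 - la by rewrite subr_gt0 ltr_pdivrMr// mul1r.
  pose sg := (2 * c - 2 * K%:R * b) / (1 - la).
  have [|C hC] := @wt_sum sg.
    rewrite ltr_pdivlMr// mul1r /la.
    have : 2 * K%:R / q * (1 - b * q) = 2 * K%:R / q - 2 * K%:R * b by field; rewrite qn0.
    by lra.
  exists (2 `^ q + C) => F uF.
  apply: le_trans (lerD (sq F uF) (hC F uF)); rewrite -big_split /=.
  apply: ler_sum => n _; apply: le_trans (powR_interp l01 _ _); rewrite ?mulr_ge0 ?powR_ge0//.
  rewrite powRM ?powR_ge0// -!powRrM -mulrA -powRD_pos ?w_gt0// pow.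
  have -> : q * la = 2 * K%:R by rewrite /la; field; rewrite qn0.
  have -> // : - (q * b) * la + - sg * (1 - la) = - (2 * c).
  by rewrite (_ : - sg * (1 - la) = - (2 * c - 2 * K%:R * b));
    [rewrite /la; field; rewrite qn0|rewrite mulNr /sg divfK// gt_eqF].
exists (2 `^ q * 2 `^ (2 * K%:R - q)) => F uF.
rewrite (le_trans _ (ler_wpM2r (powR_ge0 _ _) (sq F uF)))// mulr_suml; apply: ler_sum => n _.
pose x := cmod (s n) * w R n `^ (- b).
have x0 : 0 <= x by rewrite mulr_ge0 ?cmod_ge0 ?powR_ge0.
have xq : cmod (s n) `^ q * w R n `^ (- (q * b)) = x `^ q.
  by rewrite /x powRM ?cmod_ge0 ?powR_ge0// -powRrM mulNr (mulrC b).
have x2 : x <= 2.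
  have := sq [:: n] isT; rewrite big_seq1 xq => h; rewrite leNgt; apply/negP => h2.
  have : 2 `^ q < x `^ q by rewrite gt0_ltr_powR ?nnegrE.
  by rewrite ltNge h.
have qK' : 0 <= 2 * K%:R - q by rewrite subr_ge0.
rewrite xq (@le_trans _ _ (x `^ q * x `^ (2 * K%:R - q)))//; last first.
  by rewrite ler_wpM2l ?powR_ge0// ge0_ler_powR ?nnegrE.
rewrite -powRD; last by rewrite subrKC gt_eqF// mulr_gt0.
rewrite subrKC /x powRM ?cmod_ge0 ?powR_ge0// -powRrM pow ler_wpM2l ?powR_ge0//.
by apply: wt_mono; lra.
Qed.

Lemma fun_in_A_A1 b (f : R -> R[i]) : fun_in_A 1 b f -> exists C, A1 b f C.
Proof.
move=> [/contpT cf [_ /(Anorm_lt_ooP ltr01)[C hC]]]; exists C; split=> // F uF.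
rewrite (le_trans _ (hC F uF))// ler_sum// => n _.
by rewrite hatE// powRr1 ?cmod_ge0// mul1r.
Qed.

Lemma cyclic_null (p q b c Cf : R) f (j : nat) :
  1 < p -> q = p / (p - 1) -> 2 < q -> 0 < b -> b * q <= 1 -> A1 b f Cf -> 0 <= c ->
  let K : R := j.+1%:R in K * b < 1 / 2 ->
  2 * K < q /\ 1 - 2 * c < 2 * K / q * (1 - b * q) \/ q <= 2 * K /\ K * b <= c ->
  null_set c (sumset (zeros f) j) -> cyclic p b (distr_of_fun f).
Proof.
move=> p1 qE q2 b0 bq fA c0 K Kb hc nl.
have b01 : 0 <= b < 1 / 2 by rewrite (ltW b0) /=; nra.
apply: (cyclic_criterion p1 qE b01 fA c0 Kb) nl => s sq.
by apply: dual_sums hc sq => //; lra.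
Qed.

Lemma periodic_setZ (E : set R) x (n : int) : periodic_set E -> E (x + 2 * pi * n%:~R) <-> E x.
Proof.
move=> pE; have pos (k : nat) y : E (y + 2 * pi * k%:R) <-> E y.
  elim: k => [|k IH]; first by rewrite mulr0 addr0.
  by rewrite -natr1 (_ : y + _ = y + 2 * pi * k%:R + 2 * pi) ?pE//; ring.
case: n => k; first exact: pos.
rewrite NegzE -[X in _ <-> E X](subrK (2 * pi * k.+1%:R)) pos.
by rewrite rmorphN /= mulrN.
Qed.

Lemma sumset_periodic (E : set R) j : periodic_set E -> forall x, sumset E j x ->
  exists n, sumset (E `&` `[0, 2 * pi[) j (x + 2 * pi * n%:~R).
Proof.
move=> pE; have base x : E x -> exists n, (E `&` `[0, 2 * pi[) (x + 2 * pi * n%:~R).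
  move=> Ex; have [n hn] := mod2pi x 0; exists n; split; first exact/periodic_setZ.
  by rewrite /= in_itv /= -[ltRHS]add0r.
elim: j => [|j IH] x //=; first exact: base.
move=> [y [z [Ey Sz ->]]]; have [n hn] := base y Ey; have [m hm] := IH z Sz.
exists (n + m); exists (y + 2 * pi * n%:~R), (z + 2 * pi * m%:~R); split=> //.
by rewrite rmorphD /=; ring.
Qed.

Lemma zeros_closed b f C : A1 b f C -> closed_torus (zeros f).
Proof.
move=> fA; split; first exact: (zeros_periodic fA).
have cf : continuous (fun t => cmod (f t)) by case: fA => -[_ cf] _; exact: cont_cmod.
have -> : zeros f = (fun t => cmod (f t)) @^-1` [set 0].
  by apply/seteqP; split=> t; rewrite /zeros /=; [move=> ->; exact: cmod0|move/cmod_eq0].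
exact: closed_comp (fun x _ => cf x) (@closed_eq _ _).
Qed.

Lemma cyclic_small_dim (p q b Cf : R) f :
  1 < p -> q = p / (p - 1) -> 2 < q -> 0 < b -> b * q <= 1 -> A1 b f Cf ->
  (dimT (zeros f) < (2 / q * (1 - b * q))%:E)%E -> cyclic p b (distr_of_fun f).
Proof.
move=> p1 qE q2 b0 bq fA /(dimT_lt (zeros_closed fA))[s s0 cs].
have q1 : 2 / q < 1 by rewrite ltr_pdivrMr; lra.
have q0 : 0 < 2 / q by rewrite divr_gt0//; lra.
have bq0 : 0 < b * q by rewrite mulr_gt0//; lra.
(* This is 1 - 2c = s, as [cov_null] asks; s being strictly below the threshold gives the strict
   inequality that the interpolation in [dual_sums] needs. *)
pose c := (1 - s) / 2.
have s1 : s < 1 by nra.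
apply: (cyclic_null (c := c) (j := 0) p1 qE q2 b0 bq fA).
- by rewrite /c; lra.
- by rewrite mul1r; nra.
- by left; rewrite mulr1 /c; lra.
apply: cov_null cs _; [rewrite /c; lra|rewrite /c; lra|].
by apply: (@sumset_periodic _ 0); case: (zeros_closed fA).
Qed.

End DualSums.

(** * Obstructions to cyclicity *)

Section NonCyclic.
Variable R : realType.
Implicit Types (f g h P u v : R -> R[i]) (z : R[i]) (n m : int) (e C : R).

Lemma test_fun_contp f : test_fun f -> contp f.
Proof.
move=> [pf h]; split=> //; split=> t; have [h1 h2] := h 0%N t.
  exact/differentiable_continuous/derivable1_diffP.
exact/differentiable_continuous/derivable1_diffP.
Qed.

Lemma in_A_cst p b : 1 < p -> in_A p b (distr_of_fun (fun=> (1 : R[i]))).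
Proof.
move=> p1; have p0 : 0 < p by lra.
split; first split.
- move=> a phi psi /test_fun_contp[_ c1] /test_fun_contp[_ c2].
  rewrite /distr_of_fun !tintE.
  under eq_fun do rewrite mul1r; under [in RHS]eq_fun do rewrite mul1r.
  under [X in _ + tint X]eq_fun do rewrite mul1r.
  rewrite tintD ?tintZ//; apply: contM => //; exact: cont_cst.
- exists 0%N, 2 => phi M /test_fun_contp[_ c1] hM; rewrite /distr_of_fun tintE.
  under eq_fun do rewrite mul1r; apply: cmod_tint_le => // t.
  have := hM 0%N t isT; rewrite /cderiven /=.
  by rewrite (_ : _ +i* _ = phi t)//; rewrite /re /im; case: (phi t).
have N1 : Np p b (fourier (distr_of_fun (fun=> (1 : R[i])))) (1 `^ p).
  rewrite (_ : fourier _ = hat (fun=> 1)); last by apply/funext => n; exact: hatE.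
  by apply: l1_Np => //; [exact: ltW|rewrite -[X in bnd _ X](cmod1 R); case: (A1_cst b (1 : R[i]))].
by rewrite (le_lt_trans (Np_Anorm p0 ltr01 N1))// ltry.
Qed.

Lemma A1_tpM s f C P : 0 <= s -> A1 s f C -> tp P -> exists C', A1 s (fun t => P t * f t) C'.
Proof.
move=> s0 fA [F hF]; rewrite (_ : P = fun t => \sum_(x <- F) x.2 * expi x.1 t); last by apply/funext.
elim: F {P hF} => [|x F [C' IH]].
  exists (cmod 0); rewrite (_ : (fun t => _) = fun=> 0); first exact: A1_cst.
  by apply/funext => t; rewrite big_nil mul0r.
have h1 := A1Z x.2 (A1_expiM x.1 s0 fA).
eexists; rewrite (_ : (fun t => _) = fun t => x.2 * (expi x.1 t * f t) +
  (\sum_(x <- F) x.2 * expi x.1 t) * f t); first exact: A1D h1 IH.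
by apply/funext => t; rewrite big_cons; ring.
Qed.

(** Common form of integration against a probability measure and against a density; the constant 2
    again comes from real and imaginary parts. *)
Definition functional (L : (R -> R[i]) -> R[i]) :=
  (forall z u v, contp u -> contp v -> L (fun t => z * u t + v t) = z * L u + L v) /\
  (forall u M, contp u -> (forall t, cmod (u t) <= M) -> cmod (L u) <= 2 * M).

Lemma functional0 L : functional L -> L (fun=> 0) = 0.
Proof.
move=> [LD _]; have := LD (-1) _ _ (contp_cst 0) (contp_cst 0).
by under eq_fun do rewrite mulN1r oppr0 addr0; rewrite mulN1r addNr.
Qed.

(** Boundedness in the sup norm and absolute convergence of the Fourier series of v allow L to be
    applied term by term. *)
Lemma functional_le L v C B : functional L -> contp v -> bnd (fun n => cmod (hat v n)) C ->
  (forall N, \sum_(n <- zr N) cmod (hat v n) * cmod (L (expi n)) <= B) -> cmod (L v) <= B.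
Proof.
move=> fL cv vC hB; have [LD LM] := fL.
have Lp F : L (fun t => \sum_(n <- F) hat v n * expi n t) = \sum_(n <- F) hat v n * L (expi n).
  elim: F => [|n F IH].
    by rewrite big_nil -[RHS](functional0 fL); congr L; apply/funext => x; rewrite big_nil.
  rewrite big_cons -IH -LD; [|exact: contp_expi|by apply: contp_sum => m; exact: contp_term].
  by congr L; apply/funext => x; rewrite big_cons.
apply/ler_addgt0Pr => e e0; have e2 : 0 < e / 2 by rewrite divr_gt0.
have [N hN] := inversion cv vC e2.
have Lr : cmod (L (fun x => v x - psum (hat v) N x)) <= 2 * (e / 2).
  by apply: LM => [|t]; [apply: contpB => //; exact: contp_psum|exact: hN].
have := LD 1 _ _ (contpB cv (contp_psum (hat v) N)) (contp_psum (hat v) N).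
rewrite mul1r (_ : (fun t => _) = v); last by apply/funext => x; ring.
move=> ->; rewrite (le_trans (cmodD _ _))// [leRHS]addrC lerD//; first by lra.
rewrite /psum Lp (le_trans (cmod_sum _ _ _))// (le_trans _ (hB N))// ler_sum// => n _.
by rewrite cmodM.
Qed.

(* Young's inequality turns the bound on the coefficients of L into a bound for L on
   A^p_b; since L nearly annihilates P f but not 1, P f stays away from 1. *)
Lemma not_cyclic (p q b C C0 : R) f : 1 < p -> q = p / (p - 1) -> 0 <= b -> A1 b f C ->
  (forall P e, tp P -> 0 < e -> exists L : (R -> R[i]) -> R[i],
    [/\ functional L,
        bnd (fun n => cmod (L (expi n)) `^ q * w R n `^ (- (q * b))) C0,
        cmod (L (fun t => P t * f t)) <= e &
        1 / 2 <= cmod (L (fun=> 1))]) ->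
  ~ cyclic p b (distr_of_fun f).
Proof.
move=> p1 qE b0 fA hL cyc; have p0 : 0 < p by lra.
have q0 : 0 < q by rewrite qE divr_gt0//; lra.
have [L0 [_ B0 _ _]] := hL _ 1 (tp0 R) ltr01.
have C00 := bnd_ge0 B0.
have pq : p^-1 + q^-1 = 1.
  by rewrite qE; field; apply/andP; split; rewrite gt_eqF//; lra.
have C16 : 0 < 16 * (C0 + 1) by lra.
(* With this t, Young's inequality bounds the pairing by (t eps)^p + t^-q C0 <= 1/4 + 1/16, whereas
   |L v| >= 1/2 - 1/8. *)
pose t := (16 * (C0 + 1)) `^ q^-1.
have t0 : 0 < t by rewrite powR_gt0.
have tq : t `^ q = 16 * (C0 + 1) by rewrite powRVK// ltW.
pose eps := (4 * t)^-1.
have e0 : 0 < eps by rewrite invr_gt0 mulr_gt0.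
have [P [/trig_tp tP hP]] := cyc _ (in_A_cst b p1) eps e0.
have [L [fL LB Lf L1]] := hL P (1 / 8) tP ltac:(lra).
have cP := tp_contp tP; have cf := fA.1.
have [C' PfA] := A1_tpM b0 fA tP.
pose v t := (-1) * (P t * f t) + 1.
have cPf : contp (fun t => P t * f t) by exact: contpM.
have [D vA] : exists D, A1 b v D.
  by eexists; apply: A1D; [apply: A1Z; exact: PfA|exact: A1_cst].
have Np_v : Np p b (hat v) (eps `^ p).
  have hv n : fourier (fun phi => distr_of_fun (fun=> 1) phi - distr_mul P (distr_of_fun f) phi) n = hat v n.
    rewrite /fourier /distr_mul /distr_of_fun !tintE /hat.
    rewrite -tintB; last 2 first.
    - by apply: contM; [exact: cont_cst|exact: cont_expi].
    - by apply: contM; [case: cf|apply: contM; [case: cP|exact: cont_expi]].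
    by congr tint; apply/funext => x; rewrite /v; ring.
  by rewrite -(funext hv); exact: Anorm_ltP.
have Lv : 3 / 8 <= cmod (L v).
  have := fL.1 (-1) _ _ cPf (contp_cst 1); rewrite -/v => ->.
  rewrite mulN1r addrC; have := cmod_dist (L (fun=> 1)) (L (fun t => P t * f t)); lra.
have : cmod (L v) <= 5 / 16; last by lra.
apply: functional_le fL vA.1 (A1_l1 b0 vA) _ => N0.
rewrite (@le_trans _ _ (\sum_(n <- zr N0) (t `^ p * (cmod (hat v n) `^ p * w R n `^ (p * b)) +
   t `^ (- q) * (cmod (L (expi n)) `^ q * w R n `^ (- (q * b))))))//.
  apply: ler_sum => n _.
  have w0 := wt_gt0 b n; have x0 := cmod_ge0 (hat v n); have y0 := cmod_ge0 (L (expi n)).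
  set x := cmod (hat v n) * w R n `^ b * t; set y := cmod (L (expi n)) * (w R n `^ (- b)) / t.
  have xx : 0 <= x by rewrite !mulr_ge0// ltW.
  have yy : 0 <= y by rewrite !mulr_ge0 ?powR_ge0 ?invr_ge0// ltW.
  have := conjugate_powR xx yy p0 q0 pq.
  have -> : x * y = cmod (hat v n) * cmod (L (expi n)).
    rewrite /x /y powRN; field; rewrite gt_eqF// gt_eqF//.
  have -> : x `^ p = t `^ p * (cmod (hat v n) `^ p * w R n `^ (p * b)).
    by rewrite /x !powRM ?mulr_ge0 ?powR_ge0 ?(ltW t0)// -powRrM (mulrC b); ring.
  have -> : y `^ q = t `^ (- q) * (cmod (L (expi n)) `^ q * w R n `^ (- (q * b))).
    rewrite /y !powRM ?mulr_ge0 ?powR_ge0 ?invr_ge0 ?(ltW t0)// -powRrM powRV_pos//.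
    by rewrite mulNr (mulrC b); ring.
  move=> h; apply: (le_trans h); apply: lerD.
    by rewrite ler_pdivrMr// ler_peMr ?mulr_ge0 ?powR_ge0// ltW.
  rewrite ler_pdivrMr// ler_peMr ?mulr_ge0 ?powR_ge0// qE ler_pdivlMr; lra.
rewrite big_split /= -!mulr_sumr.
have h1 : t `^ p * \sum_(n <- zr N0) cmod (hat v n) `^ p * w R n `^ (p * b) <= 1 / 4.
  rewrite (le_trans (ler_wpM2l (powR_ge0 _ _) (Np_v _ (zr_uniq N0))))//.
  rewrite -powRM ?(ltW t0) ?(ltW e0)// (_ : t * eps = 4^-1); last by rewrite /eps; field; rewrite gt_eqF.
  rewrite (le_trans (ge1r_powR _ (ltW p1)))//; lra.
have h2 : t `^ (- q) * \sum_(n <- zr N0) cmod (L (expi n)) `^ q * w R n `^ (- (q * b)) <= 1 / 16.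
  rewrite (le_trans (ler_wpM2l (powR_ge0 _ _) (LB _ (zr_uniq N0))))//.
  rewrite powRN tq mulrC ler_pdivrMr//; lra.
lra.
Qed.

End NonCyclic.

(** * Probability measures of finite energy *)

Section Capacity.
Variable R : realType.
Variable mu : probability (measurableTypeR R) R.
Implicit Types (f g h P u v : R -> R[i]) (z : R[i]) (n m : int) (e C M : R).

Notation Lmu := (cintegral mu setT).

Lemma Rint_cst M : Rintegral mu setT (fun=> M) = M.
Proof.
rewrite Rintegral_cst//= -[RHS]mulr1; congr (_ * _).
exact: (congr1 fine (probability_setT mu)).
Qed.

Lemma mu_integrable (u : R -> R) M : continuous u -> (forall t, `|u t| <= M) ->
  mu.-integrable setT (EFin \o u).
Proof.
move=> cu uM; apply: measurable_bounded_integrable => //.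
- by rewrite (@le_lt_trans _ _ 1%E) ?ltry// probability_le1.
- exact: continuous_measurable_fun.
- exists M; split; first exact: num_real.
  by move=> x Mx t _ /=; rewrite (le_trans (uM t))// ltW.
Qed.

Lemma contp_integrable u : contp u -> mu.-integrable setT (EFin \o re u) /\ mu.-integrable setT (EFin \o im u).
Proof.
move=> cu; have [B _ hB] := contp_bnd cu; have [_ [c1 c2]] := cu.
split; apply: mu_integrable => // t; apply: le_trans (hB t); [exact: Re_le_cmod|exact: Im_le_cmod].
Qed.

Lemma cint_lin z u v : contp u -> contp v -> Lmu (fun t => z * u t + v t) = z * Lmu u + Lmu v.
Proof.
move=> cu cv; have [u1 u2] := contp_integrable cu; have [v1 v2] := contp_integrable cv.
have czu : contp (fun t => z * u t) by apply: contpM => //; exact: contp_cst.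
have [w1 w2] := contp_integrable czu.
have cZ (c : R) (x : R -> R) : mu.-integrable setT (EFin \o x) -> mu.-integrable setT (EFin \o (fun t => c * x t)).
  by move=> h; have := integrableZl measurableT c h.
have cD (x y : R -> R) : mu.-integrable setT (EFin \o x) -> mu.-integrable setT (EFin \o y) ->
    mu.-integrable setT (EFin \o (fun t => x t + y t)).
  by move=> h1 h2; have := integrableD measurableT h1 h2.
rewrite /cintegral; set a := complex.Re z; set b := complex.Im z.
have -> : Rintegral mu setT (re (fun t => z * u t + v t)) =
   a * Rintegral mu setT (re u) - b * Rintegral mu setT (im u) + Rintegral mu setT (re v).
  rewrite -mulNr -!RintegralZl// -!RintegralD//; try solve [exact: cZ|by apply: cD; exact: cZ].
  by apply: eq_Rintegral => t _; rewrite /re ReD ReM /= /im -/a -/b; ring.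
have -> : Rintegral mu setT (im (fun t => z * u t + v t)) =
   a * Rintegral mu setT (im u) + b * Rintegral mu setT (re u) + Rintegral mu setT (im v).
  rewrite -!RintegralZl// -!RintegralD//; try solve [exact: cZ|by apply: cD; exact: cZ].
  by apply: eq_Rintegral => t _; rewrite /im ImD ImM /= /re -/a -/b; ring.
by rewrite (_ : z = a +i* b); [simpc|rewrite /a /b; case: (z)].
Qed.

Lemma Rint_bound (u : R -> R) M : continuous u -> (forall t, `|u t| <= M) ->
  `|Rintegral mu setT u| <= M.
Proof.
move=> cu uM; have iu := mu_integrable cu uM.
rewrite (le_trans (le_normr_Rintegral _ iu))//.
have mE : M = Rintegral mu setT (fun=> M) by rewrite Rint_cst.
rewrite mE; apply: le_Rintegral => //.
- by apply: (@mu_integrable (fun t => `|u t|) M) => [t|t]; [apply: cvg_norm; exact: cu|rewrite normr_id].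
- by apply: (@mu_integrable _ `|M|) => //; exact: cst_continuous.
Qed.

Lemma cint_bound u M : contp u -> (forall t, cmod (u t) <= M) -> cmod (Lmu u) <= 2 * M.
Proof.
move=> [_ [c1 c2]] uM; rewrite (le_trans (cmod_le_ReIm _))//= mulr_natl mulr2n lerD//.
  by apply: Rint_bound => // t; exact: le_trans (Re_le_cmod _) (uM t).
by apply: Rint_bound => // t; exact: le_trans (Im_le_cmod _) (uM t).
Qed.

Lemma cint_eq0 u (A : set R) : contp u -> measurable A -> mu A = 1%E -> (forall t, A t -> u t = 0) ->
  Lmu u = 0.
Proof.
move=> cu mA muA u0; have [u1 u2] := contp_integrable cu.
have key (x : R -> R) : mu.-integrable setT (EFin \o x) -> (forall t, A t -> x t = 0) -> Rintegral mu setT x = 0.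
  move=> ix x0; rewrite -(mul0r (fine (mu setT))) -Rintegral_cst// /Rintegral; congr fine.
  apply: ae_eq_integral => //; first by case/integrableP: ix.
  exists (~` A); split.
  - exact: measurableC.
  - by have := probability_setC mu mA; rewrite muA subee.
  - by move=> t /= h At; apply: h => _; rewrite /= x0.
by rewrite /cintegral !key// => t At; rewrite /re /im u0.
Qed.

(** Since q > 2 and the coefficients are bounded by 2, their q-th powers are at most 2^(q-2) times
    their squares. The energy of order 1 - b q carries exactly the weight w^(-bq), and negative
    frequencies repeat the positive ones by conjugation. *)
Lemma energy_bnd (p q b : R) : 1 < p < 2 -> q = p / (p - 1) -> 0 < b ->
  (energy (1 - b * q) mu < +oo)%E ->
  exists C0, bnd (fun n => cmod (Lmu (expi n)) `^ q * w R n `^ (- (q * b))) C0.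
Proof.
move=> p12 qE b0 en; have q2 : 2 < q by rewrite qE ltr_pdivlMr; lra.
have le2 n : cmod (Lmu (expi n)) <= 2.
  rewrite -[leRHS]mulr1; apply: cint_bound; first exact: contp_expi.
  by move=> t; rewrite cmod_expi.
have sym n : cmod (Lmu (expi (- n))) = cmod (Lmu (expi n)).
  rewrite -[in RHS]cmodJ; congr cmod; rewrite /cintegral /=.
  have -> : re (expi (- n)) = re (expi n) :> (R -> R).
    by apply/funext => t; rewrite /re /= rmorphN mulNr cosN.
  congr (_ +i* _); rewrite -mulN1r -RintegralZl//; last by case: (contp_integrable (contp_expi R n)).
  by apply: eq_Rintegral => t _; rewrite /im /= rmorphN mulNr sinN mulN1r.
have [E0 hE] : exists E0 : R, forall N, \sum_(1 <= n < N)
    cmod (Lmu (expi n%:Z)) ^+ 2 * w R n%:Z `^ (- (q * b)) <= E0.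
  have en0 : (0 <= energy (1 - b * q) mu)%E.
    apply: nneseries_ge0 => n _ _; rewrite lee_fin divr_ge0 ?powR_ge0// sqr_ge0//.
  have [E0 EE] : exists E0 : R, energy (1 - b * q) mu = E0%:E.
    by move: en en0; case: energy => [r _ _|//|//]; exists r.
  exists E0 => N; rewrite -lee_fin -EE -sumEFin.
  rewrite /energy; apply: le_trans (nneseries_lim_ge N _); last first.
    by move=> n *; rewrite lee_fin divr_ge0 ?powR_ge0// sqr_ge0.
  apply: lee_sum => n _; rewrite lee_fin /measure_fourier sym.
  by rewrite -powRN (_ : - (1 - (1 - b * q)) = - (q * b)); last by ring.
pose y n := cmod (Lmu (expi n)) `^ q * w R n `^ (- (q * b)).
pose x n := cmod (Lmu (expi n)) ^+ 2 * w R n `^ (- (q * b)).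
have yx n : y n <= 2 `^ (q - 2) * x n.
  have e0 := cmod_ge0 (Lmu (expi n)).
  rewrite /x mulrA ler_wpM2r ?powR_ge0// -powR_mulrn// mulrC.
  have -> : cmod (Lmu (expi n)) `^ q = cmod (Lmu (expi n)) `^ 2 * cmod (Lmu (expi n)) `^ (q - 2).
    by rewrite -powRD ?(subrKC 2 q)//; apply/implyP => /eqP; lra.
  by rewrite ler_wpM2l ?powR_ge0// ge0_ler_powR ?nnegrE//; lra.
have x0 n : 0 <= x n by rewrite mulr_ge0 ?sqr_ge0 ?powR_ge0.
have xN n : x (- n) = x n by rewrite /x sym wN.
have sumx N : \sum_(n <- zr N) x n <= 2 * E0 + x 0.
  rewrite (@le_trans _ _ (\sum_(n <- [seq (i%:Z) | i <- index_iota 1 N.+1] ++ [seq - (i%:Z) | i <- index_iota 1 N.+1] ++ [:: 0]) x n))//.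
    apply: ler_sum_sub => //; first exact: zr_uniq.
    move=> n; rewrite mem_zr !mem_cat inE => nN.
    case: n nN => [[|n]|n] nN.
    - by rewrite eqxx !orbT.
    - by rewrite (map_f (fun i : nat => i%:Z)) ?mem_index_iota.
    - by rewrite NegzE (map_f (fun i : nat => - i%:Z)) ?mem_index_iota ?orbT.
  rewrite !big_cat !big_map big_seq1 /=; under [X in _ + (X + _)]eq_bigr do rewrite xN.
  by rewrite mulr_natl mulr2n addrA lerD// lerD// hE.
exists (2 `^ (q - 2) * (2 * E0 + x 0)) => F uF.
rewrite (le_trans (ler_sum _ (fun n _ => yx n)))// -mulr_sumr ler_wpM2l ?powR_ge0//.
have [I FI] := seq_lt_pow F.
apply: le_trans (sumx (2 ^ I)%N); apply: ler_sum_sub => // n nF.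
by rewrite mem_zr ltnW// FI.
Qed.

Lemma energy_not_cyclic (p q b C : R) f : 1 < p < 2 -> q = p / (p - 1) -> 0 < b ->
  A1 b f C -> (energy (1 - b * q) mu < +oo)%E -> supported_in mu (zeros f) ->
  ~ cyclic p b (distr_of_fun f).
Proof.
move=> p12 qE b0 fA en [K' [[_ cK] Kf muK]].
have [C0 hC0] := energy_bnd p12 qE b0 en.
apply: (@not_cyclic _ p q b C C0) => //; [lra|exact: ltW|].
move=> P e tP e0; exists Lmu; split=> //.
- by split; [exact: cint_lin|exact: cint_bound].
- rewrite (cint_eq0 (A := K' `&` `[0, 2 * pi[)) ?cmod0 ?(ltW e0)//.
  + by apply: contpM; [exact: tp_contp|exact: fA.1].
  + by apply: measurableI => //; apply: closed_measurable.
  + by move=> t [Kt _]; rewrite (Kf t Kt) mulr0.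
rewrite (_ : Lmu _ = 1) ?cmod1; first by lra.
by rewrite /cintegral /re /im /= !Rint_cst.
Qed.

End Capacity.

Lemma capacity_not_cyclic (R : realType) (p q b C : R) f : 1 < p < 2 -> q = p / (p - 1) -> 0 < b ->
  A1 b f C -> (0 < capacity (1 - b * q) (zeros f))%E -> ~ cyclic p b (distr_of_fun f).
Proof.
move=> p12 qE b0 fA; rewrite /capacity; set I := ereal_inf _ => I0.
have : (I < +oo)%E.
  by rewrite ltey; apply/eqP => Ioo; rewrite Ioo invey ltxx in I0.
move=> /ereal_inf_lt[_ [mu smu <-]] en.
exact: energy_not_cyclic fA en smu.
Qed.

(** * Kaufman's densities *)

Section DivisorBound.
Local Open Scope nat_scope.

Definition ndiv (n : nat) := size (divisors n).

(** Every divisor is a power p^i with i <= [logn p n] times a divisor of the part of n prime to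
    p. *)
Lemma ndiv_strip p n : prime p -> 0 < n -> ndiv n <= (logn p n).+1 * ndiv n`_p^'.
Proof.
move=> pp n0; set e := logn p n; set m := n`_p^'.
have m0 : 0 < m by exact: part_gt0.
rewrite /ndiv (leq_trans (n := size [seq p ^ i * y | i <- iota 0 e.+1, y <- divisors m]))//.
  apply: uniq_leq_size; first exact: divisors_uniq.
  move=> x; rewrite -dvdn_divisors// => xn.
  have x0 : 0 < x := dvdn_gt0 n0 xn.
  apply/allpairsP; exists (logn p x, x`_p^'); split=> /=.
  - by rewrite -[0 :: _]/(iota 0 e.+1) mem_iota add0n ltnS dvdn_leq_log.
  - by rewrite -dvdn_divisors// partn_dvd.
  - by rewrite -p_part partnC.
by rewrite size_allpairs size_iota.
Qed.

Lemma pow_le_exp2 K : exists C, 0 < C /\ forall e, e.+1 ^ K <= C * 2 ^ e.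
Proof.
exists (K`! * 2 ^ K); split; first by rewrite muln_gt0 fact_gt0 expn_gt0.
move=> e; rewrite -mulnA -expnD addnC.
have h1 : e.+1 ^ K <= (e + K) ^_ K.
  elim: K => // K IH; rewrite addnS ffactSS expnS leq_mul//; lia.
have h2 m k : 'C(m, k) <= 2 ^ m.
  elim: m k => [|m IH] [|k]; rewrite ?bin0 ?expn_gt0//.
  by rewrite binS expnS mul2n -addnn leq_add.
by rewrite (leq_trans h1)// -bin_ffact mulnC leq_mul2l h2 orbT.
Qed.

Lemma part_prod p n : 0 < n -> n = p ^ logn p n * n`_p^'.
Proof. by move=> n0; rewrite -{1}(partnC p n0) p_part. Qed.

Lemma prime_dvd_part (p r n : nat) : prime r -> 0 < n -> r %| n`_p^' -> r %| n /\ r != p.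
Proof.
move=> pr n0 rn; split; first exact: dvdn_trans rn (dvdn_part _ _).
by have := pnat_dvd rn (part_pnat p^' n); rewrite pnatE// !inE.
Qed.

Lemma leq_exp2rW a b k : a <= b -> a ^ k <= b ^ k.
Proof. by case: k => // k ab; rewrite leq_exp2r. Qed.

(** A prime power p^e exactly dividing n contributes (e + 1)^K <= 2^(eK) <= p^e. *)
Lemma ndiv_bound_large K n : 0 < n -> (forall p, prime p -> p %| n -> 2 ^ K <= p) -> ndiv n ^ K <= n.
Proof.
elim/ltn_ind: n => n IH n0 hn.
have [n1|n1] := leqP n 1.
  have -> : n = 1 by lia.
  by rewrite /ndiv /= exp1n.
have pp := pdiv_prime n1; have pn := pdiv_dvd n; set p := pdiv n in pp pn.
have e0 : 0 < logn p n by rewrite logn_gt0 mem_primes pp n0.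
have p1 := prime_gt1 pp.
have m0 : 0 < n`_p^' by exact: part_gt0.
have nE := part_prod p n0.
have mn : n`_p^' < n.
  rewrite {2}nE -[X in X < _]mul1n ltn_mul2r m0 /=.
  by rewrite -[1](expn0 p) ltn_exp2l.
have Hm : ndiv n`_p^' ^ K <= n`_p^'.
  by apply: IH => // r pr rn; have [h1 _] := prime_dvd_part pr n0 rn; exact: hn.
rewrite (@leq_trans (((logn p n).+1 * ndiv n`_p^') ^ K))//.
  by rewrite leq_exp2rW// ndiv_strip.
rewrite expnMn [leqRHS]nE leq_mul// (@leq_trans ((2 ^ logn p n) ^ K))//.
  by rewrite leq_exp2rW// ltn_expl.
by rewrite -expnM mulnC expnM leq_exp2rW// hn.
Qed.

(* d(n)^K <= C n : the primes at least 2^K contribute a factor at most p^e each, so C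
   only has to pay for the finitely many smaller primes, removed one after the other. *)
Lemma ndiv_bound K : exists C, 0 < C /\ forall n, 0 < n -> ndiv n ^ K <= C * n.
Proof.
have [C [C0 hC]] := pow_le_exp2 K.
(* The parameter i says how far below 2^K the prime factors may reach; each unit of it costs at most
   one factor C. *)
suff H i n : 0 < n -> (forall p, prime p -> p %| n -> 2 ^ K <= p + i) -> ndiv n ^ K <= C ^ i * n.
  exists (C ^ 2 ^ K); split; first by rewrite expn_gt0 C0.
  by move=> n n0; apply: H => // p _ _; rewrite leq_addl.
elim: i n => [|i IH] n n0 hn.
  by rewrite mul1n ndiv_bound_large// => p pp pn; have := hn p pp pn; rewrite addn0.
have Ci : C ^ i * n <= C ^ i.+1 * n by rewrite expnS -mulnA leq_pmull.
have [Bi|Bi] := leqP (2 ^ K) i.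
  by apply: leq_trans Ci; apply: IH => // p _ _; rewrite (leq_trans Bi)// leq_addl.
pose p := 2 ^ K - i.+1; have pE : p + i.+1 = 2 ^ K by rewrite subnK.
have [pp|pp] := boolP (prime p); last first.
  apply: leq_trans Ci; apply: IH => // r pr rn; have := hn r pr rn.
  rewrite addnS leq_eqVlt => /predU1P[h|//]; exfalso.
  have rp : r = p by lia.
  by rewrite -rp pr in pp.
have m0 : 0 < n`_p^' by exact: part_gt0.
have nE := part_prod p n0.
have Hm : ndiv n`_p^' ^ K <= C ^ i * n`_p^'.
  apply: IH => // r pr rn; have [h1 h2] := prime_dvd_part pr n0 rn.
  have := hn r pr h1; rewrite addnS leq_eqVlt => /predU1P[h|//].
  by exfalso; move/eqP: h2; apply; lia.
rewrite (@leq_trans (((logn p n).+1 * ndiv n`_p^') ^ K))//.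
  by rewrite leq_exp2rW// ndiv_strip.
rewrite expnMn [in leqRHS]nE expnS.
have hp : (logn p n).+1 ^ K <= C * p ^ logn p n.
  by rewrite (leq_trans (hC _))// leq_mul2l leq_exp2rW ?orbT// prime_gt1.
by rewrite (leq_trans (leq_mul hp Hm))// leq_eqVlt; apply/orP; left; apply/eqP; ring.
Qed.

End DivisorBound.

(** * Fourier coefficients of tents, dilates and products *)

Section Dilation.
Variable R : realType.
Implicit Types (r h c t s e C x y : R) (n j : int) (u v f g H : R -> R[i]).

Lemma cont_abs (u : R -> R) : continuous u -> continuous (fun t => `|u t|).
Proof. by move=> cu t; apply: cvg_norm; exact: cu. Qed.

Lemma cont_subr (u v : R -> R) : continuous u -> continuous v -> continuous (fun t => u t - v t).
Proof. by move=> cu cv t; apply: cvgB; [exact: cu|exact: cv]. Qed.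

Lemma tent_L1 r h : 0 < r -> 0 <= h -> mean (fun t => `|tent r (t + h) - tent r t|) <= 6 * h.
Proof.
move=> r0 h0; have ct := tent_cont r0; have cth := cont_shiftr (h := h) ct.
have cD := cont_abs (cont_subr cth ct).
have [hr|hr] := leP h r.
  rewrite (@le_trans _ _ (h / r * (4 * r)))//; last first.
    by rewrite mulrCA divfK ?gt_eqF//; lra.
  apply: mean_local => //; [by rewrite mulr_gt0|by rewrite divr_ge0// ltW| |].
    move=> t; rewrite (le_trans (tent_lip _ _ r0))//.
    by rewrite (_ : t + h - t = h) 1?mulrC ?ger0_norm//; ring.
  move=> t ht; rewrite !tent_eq0 ?subrr ?normr0//; first by lra.
  have := tdist_lip t (t + h); rewrite opprD addrA subrr sub0r normrN ger0_norm//; lra.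
have cs : continuous (fun t => tent r (t + h) + tent r t) by move=> t; apply: cvgD; [exact: cth|exact: ct].
rewrite (@le_trans _ _ (mean (fun t => tent r (t + h) + tent r t)))//.
  apply: mean_le => // t _; rewrite (le_trans (ler_normB _ _))// !ger0_norm//; by case/andP: (tent01 r t); case/andP: (tent01 r (t + h)).
rewrite mean_D// (mean_shift _ ct (tent_period r)).
have := mean_tent r0; lra.
Qed.

Lemma mean_tent_ge r : 0 < r <= 1 -> r / 4 <= mean (tent r).
Proof.
move=> /andP[r0 r1]; have ct := tent_cont r0; have p0 := twopi_gt0 R; have p2 := pi_ge2 R.
have cN : continuous (fun t => (-1) * tent r t).
  by move=> t; apply: cvgM; [exact: cvg_cst|exact: ct].
suff : mean (fun t => (-1) * tent r t) <= - (r / 4) by rewrite mean_Z//; lra.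
rewrite /mean mulrC ler_pdivrMr// (@integral_split _ _ 0 (2 * r) (2 * pi))//; [|lra|lra].
have h1 := @integral_le_cst _ (fun t => (-1) * tent r t) 0 (2 * r) (-1) cN ltac:(lra) _.
have h2 := @integral_le_cst _ (fun t => (-1) * tent r t) (2 * r) (2 * pi) 0 cN ltac:(lra) _.
have {}h1 : Rintegral lebesgue_measure `[0, 2 * r] (fun t => (-1) * tent r t) <= -1 * (2 * r - 0).
  apply: h1 => t ht; rewrite tent_eq1 ?mulr1//.
  rewrite (le_trans (tdist_le0 _))// ger0_norm; lra.
have {}h2 : Rintegral lebesgue_measure `[2 * r, 2 * pi] (fun t => (-1) * tent r t) <= 0 * (2 * pi - 2 * r).
  by apply: h2 => t ht; case/andP: (tent01 r t) => a b; lra.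
have p4 : pi <= 4 :> R by have := pihalf_lt2 R; lra.
have : r * pi <= r * 4 by rewrite ler_pM2l.
lra.
Qed.

(** The shift by pi / |n| multiplies the n-th coefficient by -1, so the difference of the shifted
    and the original function has -2 times that coefficient. *)
Lemma hat_decay u n : contp u -> n != 0 ->
  cmod (hat u n) <= mean (fun t => cmod (u (t + pi / (`|n|%N)%:R) - u t)).
Proof.
move=> cu n0; set h : R := pi / _.
have nn : (`|n|%N)%:R != 0 :> R by rewrite pnatr_eq0 absz_eq0.
have eh : expi n h = -1.
  rewrite /expi /h; case: n n0 nn @h => k k0 kk /=.
    have -> : (Posz k)%:~R * (pi / k%:R) = pi :> R by rewrite -pmulrn mulrC divfK.
    by rewrite cospi sinpi; apply/eqP; rewrite eq_complex /= oppr0 !eqxx.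
  have -> : (Negz k)%:~R * (pi / k.+1%:R) = - pi :> R.
    by rewrite NegzE rmorphN /= -pmulrn mulNr mulrC divfK.
  by rewrite cosN sinN cospi sinpi oppr0; apply/eqP; rewrite eq_complex /= oppr0 !eqxx.
have cs : contp (fun t => u (t + h)) by exact: contp_shift.
have cd := contpB cs cu.
have hE : hat (fun t => u (t + h) - u t) n = - (2%:R * hat u n).
  by rewrite (@hatB _ (fun t => u (t + h)) u n cs.2 cu.2) hat_shift// eh; ring.
have := cmod_tint (contM cd.2 (cont_expi R (- n))).
have -> : tint (fun t => (u (t + h) - u t) * expi (- n) t) = hat (fun t => u (t + h) - u t) n by [].
rewrite hE cmodN cmodM.
have -> : cmod (2%:R : R[i]) = 2 by rewrite -(rmorph_nat (real_complex R)) cmod_real ger0_norm.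
under eq_fun do rewrite cmodM cmod_expi mulr1.
by rewrite ler_pM2l.
Qed.

Lemma contp_dilate u (m : nat) : contp u -> contp (fun t => u (m%:R * t)).
Proof.
move=> [pu [c1 c2]]; split.
  move=> t; rewrite mulrDr; move: (_ * t) => y.
  elim: m => [|m IH]; first by rewrite mul0r addr0.
  by rewrite -natr1 [_ * (2 * pi)]mulrDl mul1r addrA pu.
have cm : continuous (fun t : R => m%:R * t) by move=> t; apply: cvgM; [exact: cvg_cst|exact: cvg_id].
by split=> t; [exact: (continuous_comp (cm t) (c1 (m%:R * t)))|exact: (continuous_comp (cm t) (c2 (m%:R * t)))].
Qed.

(** Evident for partial sums, where [expi j] becomes [expi (j * m)]; inversion carries it over to u.
    That only multiples of m are charged is what brings in the divisors of n. *)
Lemma hat_dilate u (m : nat) n C : (0 < m)%N -> contp u -> bnd (fun n => cmod (hat u n)) C ->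
  hat (fun t => u (m%:R * t)) n = if (m%:Z %| n)%Z then hat u (n %/ m%:Z)%Z else 0.
Proof.
move=> m0 cu uC; set X := if _ then _ else _.
have ps N : hat (fun t => psum (hat u) N (m%:R * t)) n = \sum_(j <- zr N) hat u j * (j * m%:Z == n)%:R.
  rewrite /psum (_ : (fun t => _) = fun t => \sum_(j <- zr N) hat u j * expi (j * m%:Z) t).
    rewrite hat_sum; last by move=> j; case: (contpM (contp_cst (hat u j)) (contp_expi R (j * m%:Z))).
    by apply: eq_bigr => j _; rewrite hatZ ?hat_expi//; exact: cont_expi.
  apply/funext => t; apply: eq_bigr => j _; congr (_ * _).
  by rewrite /expi intrM mulrA.
have psX N : (`|n| <= N)%N -> hat (fun t => psum (hat u) N (m%:R * t)) n = X.
  move=> nN; rewrite ps /X; case: ifP => mn.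
    have nE := divzK mn; set k := (n %/ m)%Z in nE *.
    have kN : k \in zr N.
      rewrite mem_zr (leq_trans _ nN)// -[in leqRHS]nE abszM /= leq_pmulr//.
    rewrite (bigD1_seq k) ?zr_uniq//= nE eqxx mulr1 big1 ?addr0// => j jk.
    case: eqP => [jn|_]; last by rewrite mulr0.
    by exfalso; move/eqP: jk; apply; apply: (@mulIf _ m%:Z); [lia|rewrite jn nE].
  rewrite big1// => j _; case: eqP => [jn|_]; last by rewrite mulr0.
  by rewrite -jn dvdz_mull in mn.
apply/eqP; rewrite -subr_eq0; apply/eqP/cmod_eq0/eqP; rewrite eq_le cmod_ge0 andbT.
apply/ler_addgt0Pr => e e0; rewrite add0r; have e2 : 0 < e / 2 by rewrite divr_gt0.
have [N hN] := inversion cu uC e2.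
rewrite -(psX (maxn N `|n|)) ?leq_maxr// -[leRHS](divfK (_ : 2 != 0))// mulrC.
apply: hat_near; [exact: contp_dilate|by apply: contp_dilate; exact: contp_psum|].
by move=> t; apply: hN; rewrite leq_maxl.
Qed.

(** Functions with coefficients O(w^-a) form a module over A^1_a, by submultiplicativity of w;
    truncating G keeps the convolution finite. *)
Lemma hat_prod_sup a G H C S : 0 <= a -> A1 a G C -> contp H ->
  (forall n, cmod (hat H n) * w R n `^ a <= S) ->
  forall n, cmod (hat (fun t => G t * H t) n) * w R n `^ a <= C * S.
Proof.
move=> a0 [cG GC] cH HS n; have [B B0 HB] := contp_bnd cH.
have w0 := wt_gt0 a n.
have GC1 := A1_l1 a0 (conj cG GC).
apply/ler_addgt0Pr => e e0.
have e1 : 0 < e / (2 * B * w R n `^ a) by rewrite divr_gt0// !mulr_gt0.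
have [N hN] := inversion cG GC1 e1.
have cp := contpM (contp_psum (hat G) N) cH.
have near : cmod (hat (fun t => G t * H t) n - hat (fun t => psum (hat G) N t * H t) n) <= e / w R n `^ a.
  rewrite (_ : e / _ = 2 * (e / (2 * B * w R n `^ a) * B)); last by field; rewrite !gt_eqF.
  apply: hat_near => //; first exact: contpM.
  by move=> t; rewrite -mulrBl cmodM; apply: ler_pM; rewrite ?cmod_ge0//; exact: hN.
have main : cmod (hat (fun t => psum (hat G) N t * H t) n) * w R n `^ a <= C * S.
  have -> : hat (fun t => psum (hat G) N t * H t) n = \sum_(j <- zr N) hat G j * hat H (n - j).
    have -> : (fun t => psum (hat G) N t * H t) = fun t => \sum_(j <- zr N) hat G j * (expi j t * H t).
      by apply/funext => t; rewrite /psum mulr_suml; apply: eq_bigr => j _; rewrite mulrA.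
    have ce j : cont (fun t => expi j t * H t) by apply: contM; [exact: cont_expi|case: cH].
    rewrite hat_sum; last by move=> j; apply: contM; [exact: cont_cst|exact: ce].
    by apply: eq_bigr => j _; rewrite hatZ// hatM_expi.
  have S0 : 0 <= S by apply: le_trans (HS 0); rewrite mulr_ge0 ?cmod_ge0 ?powR_ge0.
  rewrite (le_trans (ler_wpM2r (ltW w0) (cmod_sum _ _ _)))// mulr_suml.
  rewrite (le_trans _ (ler_wpM2r S0 (GC _ (zr_uniq N))))// mulr_suml.
  apply: ler_sum => j _; rewrite cmodM.
  have wD : w R n `^ a <= w R j `^ a * w R (n - j) `^ a.
    by have := wtD j (n - j) a0; rewrite subrKC.
  rewrite (le_trans (ler_wpM2l _ wD)) ?mulr_ge0 ?cmod_ge0//.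
  rewrite (_ : _ * _ * (_ * _) = cmod (hat G j) * w R j `^ a * (cmod (hat H (n - j)) * w R (n - j) `^ a)); last by ring.
  by rewrite ler_wpM2l ?mulr_ge0 ?cmod_ge0 ?powR_ge0.
have := cmodD (hat (fun t => psum (hat G) N t * H t) n) (hat (fun t => G t * H t) n - hat (fun t => psum (hat G) N t * H t) n).
rewrite subrKC => /(ler_wpM2r (ltW w0)) h; rewrite (le_trans h)// mulrDl lerD//.
by rewrite -ler_pdivlMr.
Qed.

End Dilation.

Section Kaufman.
Variable R : realType.
Implicit Types (r h c t s e C x y a th eta : R) (n j : int) (u v g : R -> R) (f : R -> R[i]) (M m : nat).

Definition cplx u : R -> R[i] := fun t => (u t)%:C.

Definition Lip f := exists L : R, lip f L.

Lemma lipW f (L K : R) : L <= K -> lip f L -> lip f K.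
Proof. by move=> LK h x y; rewrite (le_trans (h x y))// ler_wpM2r. Qed.

Lemma Lip_ge0 f : Lip f -> exists2 L : R, 0 <= L & lip f L.
Proof.
move=> [L h]; exists `|L| => //.
by apply: lipW h; exact: ler_norm.
Qed.

Lemma Lip_cst z : Lip (fun=> z : R[i]).
Proof. by exists 0 => x y; rewrite subrr cmod0 mul0r. Qed.

Lemma LipD f f' : Lip f -> Lip f' -> Lip (fun t => f t + f' t).
Proof.
move=> [L h] [L' h']; exists (L + L') => x y.
rewrite (_ : _ - _ = (f x - f y) + (f' x - f' y)); last by ring.
by rewrite (le_trans (cmodD _ _))// mulrDl lerD.
Qed.

Lemma LipM f f' : contp f -> contp f' -> Lip f -> Lip f' -> Lip (fun t => f t * f' t).
Proof.
move=> /contp_bnd[B B0 hB] /contp_bnd[B' B0' hB'] /Lip_ge0[L L0 h] /Lip_ge0[L' L0' h'].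
exists (L * B' + B * L') => x y.
rewrite (_ : _ - _ = (f x - f y) * f' x + f y * (f' x - f' y)); last by ring.
rewrite (le_trans (cmodD _ _))// !cmodM mulrDl lerD//.
  by rewrite mulrAC; apply: ler_pM; rewrite ?cmod_ge0.
by rewrite -mulrA; apply: ler_pM; rewrite ?cmod_ge0.
Qed.

Lemma Lip_dilate f m : Lip f -> Lip (fun t => f (m%:R * t)).
Proof.
move=> [L h]; exists (L * m%:R) => x y; rewrite (le_trans (h _ _))//.
by rewrite -mulrBr normrM normr_nat mulrA.
Qed.

Lemma Lip_sum (I : eqType) (F : seq I) (f : I -> R -> R[i]) : (forall i, i \in F -> Lip (f i)) ->
  Lip (fun t => \sum_(i <- F) f i t).
Proof.
elim: F => [|i F IH] h.
  by rewrite (_ : (fun t => _) = fun=> 0); [exact: Lip_cst|apply/funext => t; rewrite big_nil].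
rewrite (_ : (fun t => _) = fun t => f i t + \sum_(i <- F) f i t).
  apply: LipD; first by apply: h; exact: mem_head.
  by apply: IH => k kF; apply: h; rewrite inE kF orbT.
by apply/funext => t; rewrite big_cons.
Qed.

Lemma Lip_A1 s f : 0 <= s < 1 / 2 -> contp f -> Lip f -> exists C, A1 s f C.
Proof.
move=> s01 cf [L h]; have [K K0 hK] := bernstein s01; have [B B0 hB] := contp_bnd cf.
by exists (K * (B + L)); apply: hK.
Qed.

Definition tri r t := tent r t / mean (tent r).

Lemma mean_tent_gt0 r : 0 < r <= 1 -> 0 < mean (tent r).
Proof. by move=> r01; apply: lt_le_trans (mean_tent_ge r01); lra. Qed.

Lemma tri_ge0 r t : 0 < r <= 1 -> 0 <= tri r t.
Proof. by move=> /mean_tent_gt0 m0; rewrite divr_ge0 ?(ltW m0)//; case/andP: (tent01 r t). Qed.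

Lemma tri_lip r : 0 < r <= 1 -> Lip (cplx (tri r)).
Proof.
move=> r01; have m0 := mean_tent_gt0 r01; exists (r^-1 / mean (tent r)) => x y.
rewrite /cplx -rmorphB cmod_real /tri -mulrBl normrM (ger0_norm (_ : 0 <= _^-1)) ?invr_ge0 ?(ltW m0)//.
by rewrite mulrAC ler_pM2r ?invr_gt0// tent_lip//; case/andP: r01.
Qed.

Lemma tri_contp r : 0 < r <= 1 -> contp (cplx (tri r)).
Proof.
move=> r01; have [L h] := tri_lip r01; split; last exact: lip_cont h.
by move=> t; rewrite /cplx /tri tent_period.
Qed.

Lemma tri_hat0 r : 0 < r <= 1 -> hat (cplx (tri r)) 0 = 1.
Proof.
move=> r01; have m0 := mean_tent_gt0 r01.
have ct : continuous (tent r) by apply: tent_cont; case/andP: r01.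
rewrite hat0 /cplx tint_real /tri; under eq_fun do rewrite mulrC.
by rewrite mean_Z// mulVf// gt_eqF.
Qed.

Lemma tri_hat_le2 r j : 0 < r <= 1 -> cmod (hat (cplx (tri r)) j) <= 2.
Proof.
move=> r01; have m0 := mean_tent_gt0 r01; have [_ ct] := tri_contp r01.
rewrite (le_trans (cmod_tint (contM ct (cont_expi R (- j)))))//.
under eq_fun do rewrite cmodM cmod_expi mulr1 /cplx cmod_real ger0_norm ?tri_ge0//.
have := tri_hat0 r01; rewrite hat0 /cplx tint_real => -[->].
by rewrite mulr1.
Qed.

(** The L^1 modulus of the tent is O(h) whatever r is, and the normalisation by its mean, of order
    r, costs 1 / r. *)
Lemma tri_decay r j : 0 < r <= 1 -> j != 0 ->
  cmod (hat (cplx (tri r)) j) <= 96 / ((`|j|%N)%:R * r).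
Proof.
move=> r01 j0; have m0 := mean_tent_gt0 r01; have /andP[r0 _] := r01.
rewrite (le_trans (hat_decay (tri_contp r01) j0))//; set h := pi / _.
have jj : 0 < (`|j|%N)%:R :> R by rewrite ltr0n absz_gt0.
have h0 : 0 <= h by rewrite divr_ge0 ?pi_ge0// ltW.
have ct := tent_cont r0; have cD := cont_abs (cont_subr (cont_shiftr (h := h) ct) ct).
have -> : (fun t => cmod (cplx (tri r) (t + h) - cplx (tri r) t)) =
    fun t => (mean (tent r))^-1 * `|tent r (t + h) - tent r t|.
  apply/funext => t; rewrite /cplx -rmorphB cmod_real /tri -mulrBl normrM mulrC.
  by rewrite (ger0_norm (_ : 0 <= _^-1)) ?invr_ge0 ?(ltW m0).
rewrite mean_Z//; have h1 := tent_L1 r0 h0; have h2 := mean_tent_ge r01.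
have p4 : pi <= 4 :> R by have := pihalf_lt2 R; lra.
rewrite mulrC ler_pdivrMr// (le_trans h1)//.
rewrite (@le_trans _ _ (96 / ((`|j|%N)%:R * r) * (r / 4)))//; last first.
  by rewrite ler_wpM2l// divr_ge0// mulr_ge0// ltW.
have -> : 96 / ((`|j|%N)%:R * r) * (r / 4) = 6 * (4 / (`|j|%N)%:R) by field; rewrite !gt_eqF.
by rewrite ler_pM2l// /h ler_pM2r ?invr_gt0.
Qed.

(* Kaufman's densities: they live where some multiple m t with M <= m < 2 M is close to
   2 pi Z, and since their n-th coefficient only sees the m that divide n, it is of size
   O(n ^ (e - th)) for the radii of [rad]. *)
Definition kauf M r t : R := M%:R^-1 * \sum_(M <= m < 2 * M) tri r (m%:R * t).

Lemma kauf_ge0 M r t : 0 < r <= 1 -> 0 <= kauf M r t.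
Proof. by move=> r01; rewrite mulr_ge0 ?invr_ge0// sumr_ge0// => m _; exact: tri_ge0. Qed.

Lemma kaufE M r : cplx (kauf M r) = fun t => M%:R^-1 * \sum_(M <= m < 2 * M) cplx (tri r) (m%:R * t).
Proof.
apply/funext => t; rewrite /cplx /kauf rmorphM /= fmorphV rmorph_nat; congr (_ * _).
by rewrite rmorph_sum.
Qed.

Lemma kauf_contp M r : 0 < r <= 1 -> contp (cplx (kauf M r)).
Proof.
move=> r01; rewrite kaufE; apply: contpM; first exact: contp_cst.
by apply: contp_sum => m; apply: contp_dilate; exact: tri_contp.
Qed.

Lemma kauf_Lip M r : 0 < r <= 1 -> Lip (cplx (kauf M r)).
Proof.
move=> r01; rewrite kaufE; apply: LipM.
- exact: contp_cst.
- by apply: contp_sum => m; apply: contp_dilate; exact: tri_contp.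
- exact: Lip_cst.
- by apply: Lip_sum => m _; apply: Lip_dilate; exact: tri_lip.
Qed.

Lemma kauf_hat M r n : (0 < M)%N -> 0 < r <= 1 -> hat (cplx (kauf M r)) n =
  M%:R^-1 * \sum_(M <= m < 2 * M | (m%:Z %| n)%Z) hat (cplx (tri r)) (n %/ m%:Z)%Z.
Proof.
move=> M0 r01; rewrite kaufE.
have cd m : cont (fun t => cplx (tri r) (m%:R * t)) by case: (contp_dilate m (tri_contp r01)).
rewrite hatZ; last by apply: cont_sum.
rewrite hat_sum//; congr (_ * _); rewrite [RHS]big_mkcond /=.
rewrite !big_seq; apply: eq_bigr => m; rewrite mem_index_iota => /andP[Mm _].
have [C [_ hC]] := Lip_A1 (s := 0) ltac:(lra) (tri_contp r01) (tri_lip r01).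
apply: (@hat_dilate _ _ m n C); [lia|exact: tri_contp|].
by apply: bnd_le hC => k; rewrite powRr0 mulr1.
Qed.

Lemma kauf_hat0 M r : (0 < M)%N -> 0 < r <= 1 -> hat (cplx (kauf M r)) 0 = 1.
Proof.
move=> M0 r01; rewrite kauf_hat// (eq_bigl xpredT) => [|m]; last by rewrite dvdz0.
under eq_bigr do rewrite div0z tri_hat0//.
rewrite big_const_nat iter_addr_0 (_ : (2 * M - M)%N = M); last by lia.
by rewrite mulVf// pnatr_eq0 -lt0n.
Qed.

Lemma kauf_hat_small M r n : (0 < M)%N -> 0 < r <= 1 -> (0 < `|n| < M)%N -> hat (cplx (kauf M r)) n = 0.
Proof.
move=> M0 r01 /andP[n0 nM]; rewrite kauf_hat// big_nat_cond big1 ?mulr0// => m.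
move=> /andP[/andP[Mm _]]; rewrite dvdzE /= => /(dvdn_leq n0) h; exfalso; lia.
Qed.

Lemma kauf_hat_le M r n B : (0 < M)%N -> 0 < r <= 1 -> n != 0 -> 0 <= B ->
  (forall m, (M <= m < 2 * M)%N -> (m%:Z %| n)%Z -> cmod (hat (cplx (tri r)) (n %/ m%:Z)%Z) <= B) ->
  cmod (hat (cplx (kauf M r)) n) <= (ndiv `|n|)%:R / M%:R * B.
Proof.
move=> M0 r01 n0 B0 hB; have MM : 0 < M%:R :> R by rewrite ltr0n.
have n00 : (0 < `|n|)%N by rewrite absz_gt0.
rewrite kauf_hat// cmodM (_ : cmod M%:R^-1 = M%:R^-1); last first.
  by rewrite -(rmorph_nat (real_complex R)) -fmorphV cmod_real ger0_norm// invr_ge0.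
rewrite [X in _ <= X * _]mulrC -mulrA ler_pM2l ?invr_gt0// (le_trans (cmod_sum _ _ _))//.
rewrite -big_filter; set s := [seq _ <- _ | _].
rewrite (@le_trans _ _ (\sum_(m <- s) B))//.
  rewrite big_seq [leRHS]big_seq; apply: ler_sum => m; rewrite mem_filter mem_index_iota => /andP[h1 h2].
  exact: hB.
rewrite big_const_seq count_predT iter_addr_0 -[leLHS]mulr_natl ler_wpM2r// ler_nat.
apply: uniq_leq_size; first by rewrite filter_uniq// iota_uniq.
by move=> m; rewrite mem_filter -dvdn_divisors// dvdzE => /andP[].
Qed.

End Kaufman.

Section KaufmanSeq.
Variable R : realType.
Implicit Types (r h c t s e C x y a th eta X : R) (n j : int) (u v g : R -> R) (f : R -> R[i]) (M m k i : nat).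

(** The exponent 1 - 1/th is dictated by the dimension: the points where m t is this close to 2 pi Z
    for some m of size M form about M^2 arcs of length about M^(-1/th), which corresponds to
    dimension 2 th. *)
Definition rad th M : R := M%:R / M%:R `^ th^-1.

Lemma rad_gt0 th M : (0 < M)%N -> 0 < rad th M.
Proof. by move=> M0; rewrite divr_gt0 ?powR_gt0 ?ltr0n. Qed.

Lemma rad01 th M : 0 < th < 1 -> (0 < M)%N -> 0 < rad th M <= 1.
Proof.
move=> /andP[t0 t1] M0; rewrite rad_gt0//= ler_pdivrMr ?powR_gt0 ?ltr0n// mul1r.
by rewrite le1r_powR ?ler1n// -[leLHS]invr1 lef_pV2 ?posrE// ltW.
Qed.

(** Split at X = M / [rad th M] = M^(1/th). Up to X the trivial bound on the coefficients of [tri]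
    gives d(n) / M = d(n) X^-th; beyond X their decay gives d(n) X / (M |n|). Up to constants both
    are at most d(n) |n|^-th. *)
Lemma kauf_bound th M n : 0 < th < 1 -> (0 < M)%N -> n != 0 ->
  cmod (hat (cplx (kauf M (rad th M))) n) <= 192 * (ndiv `|n|)%:R * (`|n|%N)%:R `^ (- th).
Proof.
move=> t01 M0 n0; have r01 := rad01 t01 M0; have /andP[t0 t1] := t01.
have MM : 0 < M%:R :> R by rewrite ltr0n.
set N : R := (`|n|%N)%:R; have N0 : 0 < N by rewrite ltr0n absz_gt0.
pose X : R := M%:R `^ th^-1; have X0 : 0 < X by rewrite powR_gt0.
have XM : X `^ (- th) = M%:R^-1.
  by rewrite -powRrM mulrN mulVf ?gt_eqF// powR_inv1// ltW.
have d0 : (0 : R) <= (ndiv `|n|)%:R by [].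
have [nX|nX] := leP N X.
  have h := @kauf_hat_le _ M (rad th M) n 2 M0 r01 n0 ltac:(lra) (fun m _ _ => tri_hat_le2 _ r01).
  rewrite (le_trans h)// -XM.
  have : X `^ (- th) <= N `^ (- th).
    by rewrite -!powRV_pos// ge0_ler_powR ?nnegrE ?invr_ge0 ?(ltW X0) ?(ltW N0) ?(ltW t0)// lef_pV2.
  have p0 : 0 <= N `^ (- th) by exact: powR_ge0.
  move=> h2; rewrite (@le_trans _ _ ((ndiv `|n|)%:R * N `^ (- th) * 2))//; first by rewrite ler_pM2r// ler_wpM2l.
  have : 0 <= (ndiv `|n|)%:R * N `^ (- th) by rewrite mulr_ge0.
  by rewrite -mulrA; lra.
have B0 : 0 <= 192 * (X / N) by rewrite mulr_ge0// divr_ge0// ltW.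
have h := @kauf_hat_le _ M (rad th M) n _ M0 r01 n0 B0.
have {}h : cmod (hat (cplx (kauf M (rad th M))) n) <= (ndiv `|n|)%:R / M%:R * (192 * (X / N)).
  apply: h => m /andP[m1 m2] mn; set j := (n %/ m%:Z)%Z.
  have nE : j * m%:Z = n := divzK mn.
  have j0 : j != 0 by apply: contra_neq n0 => j0; rewrite -nE j0 mul0r.
  rewrite (le_trans (tri_decay r01 j0))//.
  have NE : N = (`|j|%N)%:R * m%:R by rewrite /N -nE abszM natrM.
  have jj : 0 < (`|j|%N)%:R :> R by rewrite ltr0n absz_gt0.
  have mm : 0 < m%:R :> R by rewrite ltr0n (leq_trans M0).
  have rE : rad th M = M%:R / X by [].
  rewrite NE rE ler_pdivrMr; last by rewrite mulr_gt0// divr_gt0.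
  rewrite [leRHS](_ : _ = 192 * (M%:R / m%:R)); last by field; rewrite !gt_eqF.
  have : 1 / 2 <= M%:R / m%:R :> R.
    rewrite ler_pdivlMr//; have : m%:R <= 2 * M%:R :> R by rewrite -natrM ler_nat ltnW.
    by clear; lra.
  lra.
rewrite (le_trans h)//.
have hX : X / M%:R <= N * N `^ (- th).
  rewrite -XM -{1}(powRr1 (ltW X0)) -{1}(powRr1 (ltW N0)) -!powRD_pos//.
  by rewrite ge0_ler_powR ?nnegrE ?(ltW X0) ?(ltW N0) ?(ltW nX)//; lra.
have -> : (ndiv `|n|)%:R / M%:R * (192 * (X / N)) = 192 * (ndiv `|n|)%:R * (X / M%:R / N).
  by field; rewrite !gt_eqF.
by rewrite ler_wpM2l ?mulr_ge0// ler_pdivrMr// [leRHS]mulrC.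
Qed.

Lemma ndiv_powR e : 0 < e -> exists2 C : R, 0 < C & forall k, (0 < k)%N -> (ndiv k)%:R <= C * k%:R `^ e.
Proof.
move=> e0; pose K := (Num.truncn e^-1).+1.
have K0 : 0 < K%:R :> R by rewrite ltr0n.
have Ke : K%:R^-1 <= e by rewrite -[leRHS]invrK lef_pV2 ?posrE ?invr_gt0// ltW// truncnS_gt.
have [C [C0 hC]] := ndiv_bound K.
exists (C%:R `^ K%:R^-1); first by apply: powR_gt0; rewrite ltr0n.
move=> k k0; rewrite (@le_trans _ _ (C%:R `^ K%:R^-1 * k%:R `^ K%:R^-1))//; last first.
  by rewrite ler_wpM2l ?powR_ge0// ler_powR// ler1n.
rewrite -powRM//; apply: le_powR_inv; rewrite ?mulr_ge0//.
by rewrite powR_mulrn// -natrX -natrM ler_nat hC.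
Qed.

(** The coefficients with 0 < |n| < M vanish. Beyond, one half of the room th - a absorbs the
    divisor function and the other half produces a factor at most M^-d. *)
Lemma kauf_small th a eta M0 : 0 < th < 1 -> 0 <= a < th -> 0 < eta ->
  exists M, [/\ (M0 <= M)%N, (0 < M)%N & forall n,
    cmod (hat (cplx (kauf M (rad th M))) n - (n == 0)%:R) * w R n `^ a <= eta].
Proof.
move=> t01 /andP[a0 at_] e0; have /andP[t0 t1] := t01.
pose d := (th - a) / 2; have d0 : 0 < d by rewrite divr_gt0// subr_gt0.
have [C C0 hC] := ndiv_powR d0.
pose K := 192 * C * 2; have K0 : 0 < K by rewrite !mulr_gt0.
pose M := maxn M0 (Num.truncn ((K / eta) `^ d^-1)).+1.
have Mpos : (0 < M)%N by rewrite /M leq_max orbT.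
have MK : (K / eta) `^ d^-1 <= M%:R.
  by rewrite (le_trans (ltW (truncnS_gt _)))// ler_nat leq_maxr.
exists M; split=> //; first by rewrite leq_maxl.
move=> n; have r01 := rad01 t01 Mpos.
have [->|n0] := eqVneq n 0; first by rewrite kauf_hat0// subrr cmod0 mul0r ltW.
rewrite subr0; have nn : (0 < `|n|)%N by rewrite absz_gt0.
have [nM|nM] := ltnP `|n| M; first by rewrite kauf_hat_small ?nn// cmod0 mul0r ltW.
set N : R := (`|n|%N)%:R; have N0 : 0 < N by rewrite ltr0n.
have N1 : 1 <= N by rewrite ler1n.
have wN : w R n `^ a <= 2 * N `^ a.
  rewrite (@le_trans _ _ ((2 * N) `^ a))//.
    by rewrite ge0_ler_powR ?nnegrE ?(ltW (w_gt0 _ _)) ?mulr_ge0 ?(ltW N0)// /w -/N; lra.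
  rewrite powRM ?(ltW N0)// ler_wpM2r ?powR_ge0// -[leRHS]powRr1// ler_powR//; lra.
rewrite (@le_trans _ _ (192 * (C * N `^ d) * N `^ (- th) * (2 * N `^ a)))//.
  apply: ler_pM => //; rewrite ?cmod_ge0 ?powR_ge0//.
  rewrite (le_trans (kauf_bound t01 Mpos n0))// ler_wpM2r ?powR_ge0// ler_pM2l//.
  exact: hC.
have -> : 192 * (C * N `^ d) * N `^ (- th) * (2 * N `^ a) = K * N `^ (- d).
  have -> : - d = d + - th + a by rewrite /d; field.
  by rewrite !powRD_pos// /K; ring.
rewrite powRN ler_pdivrMr ?powR_gt0// mulrC -ler_pdivrMr//.
have Ke : 0 <= K / eta by rewrite divr_ge0// ltW.
rewrite -[leLHS](powRVK d0)// ge0_ler_powR ?nnegrE ?powR_ge0 ?(ltW d0) ?(ltW N0)//.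
by rewrite (le_trans MK)// ler_nat.
Qed.

Definition nice g := [/\ contp (cplx g), Lip (cplx g) & forall t, 0 <= g t].

Lemma cplxM u v : cplx (fun t => u t * v t) = fun t => cplx u t * cplx v t.
Proof. by apply/funext => t; rewrite /cplx rmorphM. Qed.

(** The change from g to g' is the product of g with [kauf] - 1, whose coefficients are uniformly
    small in the weighted sup norm; g is Lipschitz, hence in A^1_a because a < th < 1/2. *)
Lemma kauf_step th a eta M0 g : 0 < th < 1 / 2 -> 0 <= a < th -> 0 < eta -> nice g ->
  exists M, let g' := fun t => g t * kauf M (rad th M) t in
    [/\ (M0 <= M)%N, (0 < M)%N, nice g' & forall n,
    cmod (hat (cplx g') n - hat (cplx g) n) * w R n `^ a <= eta].
Proof.
move=> t01 a01 e0 [cg Lg g0]; have [C gC] : exists C, A1 a (cplx g) C by apply: Lip_A1 => //; lra.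
have C0 := bnd_ge0 gC.2.
have e1 : 0 < eta / (C + 1) by rewrite divr_gt0//; lra.
have t01' : 0 < th < 1 by lra.
have [M [MM0 M0' hM]] := kauf_small M0 t01' a01 e1.
have r01 := rad01 t01' M0'.
have ck := kauf_contp M r01; have ck1 := contpB ck (contp_cst 1).
exists M => g'; split=> //.
  split; rewrite /g'.
  - by rewrite cplxM; exact: contpM.
  - by rewrite cplxM; apply: LipM => //; exact: kauf_Lip.
  - by move=> t; rewrite mulr_ge0// kauf_ge0.
move=> n; rewrite (@le_trans _ _ (C * (eta / (C + 1))))//; last first.
  by rewrite mulrCA ler_piMr ?(ltW e0)// ler_pdivrMr; lra.
rewrite (_ : hat (cplx g') n - hat (cplx g) n = hat (fun t => cplx g t * (cplx (kauf M (rad th M)) t - 1)) n).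
  apply: hat_prod_sup => //; first by case/andP: a01.
  move=> j; rewrite hatB ?hat_cst; [|by case: ck|exact: cont_cst].
  by rewrite mul1r eq_sym; exact: hM.
have cg' : contp (cplx g') by rewrite /g' cplxM; exact: contpM.
rewrite -hatB; [|by case: cg'|by case: cg].
by congr hat; apply/funext => t; rewrite /g' cplxM; ring.
Qed.

Lemma half_le d k : 2^-1 ^+ (d + k).+3 <= 2^-1 ^+ d.+1 :> R.
Proof. by apply: ler_wiXn2l; rewrite ?invr_ge0 ?invf_le1 ?ler1n// !ltnS -addn2 -addnA leq_addr. Qed.

Lemma kaufman_seq th : 0 < th < 1 / 2 -> exists (M : nat -> nat) (G : nat -> R -> R),
  [/\ forall k, (k < M k)%N,
      forall k, nice (G k),
      forall k, 1 / 2 <= mean (G k) <= 1,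
      forall a, 0 <= a < th -> exists C, forall k n, cmod (hat (cplx (G k)) n) * w R n `^ a <= C &
      forall k t, G k t != 0 -> forall i, (i < k)%N ->
        exists2 m, (M i <= m < 2 * M i)%N & tdist (m%:R * t) <= 3 * rad th (M i)].
Proof.
move=> t01; have t0 : 0 < th by case/andP: t01.
(* The exponents A k increase to th, so every a < th is eventually preserved; the increments eta k
   add up to 1/4, the distance from the initial mean 3/4 to both ends of [1/2, 1]. *)
pose A k : R := th - th / k.+1%:R; pose eta k : R := 2^-1 ^+ k.+3.
have A01 k : 0 <= A k < th.
  have k1 : 1 <= k.+1%:R :> R by rewrite ler1n.
  rewrite /A subr_ge0 gtrDl oppr_lt0 divr_gt0 ?ltr0n// andbT ler_pdivrMr ?ltr0n//.
  by rewrite ler_peMr// ltW.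
have eta0 k : 0 < eta k by rewrite exprn_gt0// invr_gt0.
(* The frequency is arbitrary when the function is not nice, so that [choice] can make it a total
   function of the stage and the density. *)
have step (x : nat * (R -> R)) : exists M, nice x.2 ->
    let g' := fun t => x.2 t * kauf M (rad th M) t in
    [/\ (x.1 < M)%N, nice g' & forall n, cmod (hat (cplx g') n - hat (cplx x.2) n) * w R n `^ (A x.1) <= eta x.1].
  have [nx|nx] := pselect (nice x.2); last by exists 0%N.
  have [M [h1 h2 h3 h4]] := kauf_step x.1.+1 t01 (A01 x.1) (eta0 x.1) nx.
  by exists M => _ g'.
have [Mf hMf] := choice step.
pose G := fix G k : R -> R := if k is k'.+1 then
  (fun t => G k' t * kauf (Mf (k', G k')) (rad th (Mf (k', G k'))) t) else (fun=> 3 / 4).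
pose M k := Mf (k, G k).
have GS k : G k.+1 = fun t => G k t * kauf (M k) (rad th (M k)) t by [].
have niceG k : nice (G k).
  elim: k => [|k IH]; last by have [_ ? _] := hMf (k, G k) IH.
  by split; [exact: (@contp_cst R (3 / 4)%:C)|exact: (@Lip_cst R (3 / 4)%:C)|move=> t /=; lra].
have kM k : (k < M k)%N by have [] := hMf (k, G k) (niceG k).
have diff k n : cmod (hat (cplx (G k.+1)) n - hat (cplx (G k)) n) * w R n `^ (A k) <= eta k.
  by have [_ _] := hMf (k, G k) (niceG k); exact.
have hatm k : hat (cplx (G k)) 0 = (mean (G k))%:C by rewrite hat0 /cplx tint_real.
exists M, G; split=> //.
- move=> k; have : `|mean (G k) - 3 / 4| <= 1 / 4 - 1 / 4 * 2^-1 ^+ k.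
    elim: k => [|k IH]; first by rewrite /= mean_cst subrr normr0 expr0; lra.
    have := diff k 0; rewrite !hatm -rmorphB cmod_real /w absz0 addr0 powR1 mulr1 /eta !exprS => h.
    have := ler_normD (mean (G k.+1) - mean (G k)) (mean (G k) - 3 / 4); rewrite subrKA.
    lra.
  have : 0 <= 2^-1 ^+ k :> R by rewrite exprn_ge0.
  move=> h1 h2; have := ler_norm (mean (G k) - 3 / 4); have := ler_norm (- (mean (G k) - 3 / 4)).
  by rewrite normrN; lra.
- move=> a a01.
  have ex k : exists B : R, forall n, cmod (hat (cplx (G k)) n) * w R n `^ a <= B.
    have [ck Lk _] := niceG k.
    have [C [_ hC]] := Lip_A1 (s := a) ltac:(lra) ck Lk.
    by exists C => n; have := hC [:: n] isT; rewrite big_seq1.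
  have [B hB] := choice ex.
  have B0 k : 0 <= B k by apply: le_trans (hB k 0); rewrite mulr_ge0 ?cmod_ge0 ?powR_ge0.
  (* From k0 on the exponent A k is at least a and the increments sum up; the finitely many earlier
     densities are bounded one by one. *)
  pose k0 := Num.truncn (th / (th - a)).
  have Ak k : (k0 <= k)%N -> a <= A k.
    move=> kk; rewrite /A lerBrDl -lerBrDr ler_pdivrMr ?ltr0n// mulrC -ler_pdivrMr; last by lra.
    by rewrite (le_trans (ltW (truncnS_gt _)))// ler_nat ltnS.
  exists (\sum_(i < k0.+1) B i + 1) => k n.
  have BS i : (i <= k0)%N -> B i <= \sum_(i < k0.+1) B i.
    move=> ik; rewrite (bigD1 (Ordinal (ik : (i < k0.+1)%N)))//= lerDl sumr_ge0//.
  have [kk|kk] := leqP k k0; first by rewrite (le_trans (hB k n))// ler_wpDr// BS.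
  have H d : cmod (hat (cplx (G (d + k0)%N)) n) * w R n `^ a <= B k0 + (1 - 2^-1 ^+ d).
    elim: d => [|d IH]; first by rewrite add0n expr0 subrr addr0 hB.
    rewrite addSn -[hat (cplx (G _.+1)) n](subrK (hat (cplx (G (d + k0)%N)) n)).
    rewrite (le_trans (ler_wpM2r (powR_ge0 _ _) (cmodD _ _)))// mulrDl.
    have h1 : cmod (hat (cplx (G (d + k0).+1)) n - hat (cplx (G (d + k0)%N)) n) * w R n `^ a <= eta (d + k0)%N.
      by rewrite (le_trans _ (diff _ n))// ler_wpM2l ?cmod_ge0// wt_mono// Ak// leq_addl.
    have h2 : eta (d + k0)%N <= 2^-1 ^+ d.+1.
      exact: half_le.
    have e1 : 2^-1 ^+ d = 2 * 2^-1 ^+ d.+1 :> R by rewrite exprS mulrA mulfV ?mul1r.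
    by lra.
  rewrite -(subnK (ltnW kk)) (le_trans (H _))// lerD ?BS// gerBl exprn_ge0//.
- elim=> [//|k IH] t; rewrite GS mulf_eq0 negb_or => /andP[g0 k0] i.
  rewrite ltnS leq_eqVlt => /predU1P[->|ik]; last exact: IH.
  apply: contrapT => h; move/eqP: k0; apply; rewrite /kauf big_nat_cond big1 ?mulr0// => m /andP[mM _].
  have r0 : 0 < rad th (M k) by apply: rad_gt0; exact: leq_ltn_trans (kM k).
  rewrite /tri tent_eq0 ?mul0r// leNgt; apply/negP => h2; apply: h.
  by exists m => //; exact: ltW.
Qed.

End KaufmanSeq.

(** * The Kaufman set: its densities as functionals, and what they exclude *)

Section KaufmanSet.
Variable R : realType.
Variables (th : R) (M : nat -> nat) (G : nat -> R -> R).
Hypotheses (t01 : 0 < th < 1 / 2) (kM : forall k, (k < M k)%N) (niceG : forall k, nice (G k))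
  (meanG : forall k, 1 / 2 <= mean (G k) <= 1)
  (hatG : forall a, 0 <= a < th -> exists C, forall k n, cmod (hat (cplx (G k)) n) * w R n `^ a <= C)
  (suppG : forall k t, G k t != 0 -> forall i, (i < k)%N ->
        exists2 m, (M i <= m < 2 * M i)%N & tdist (m%:R * t) <= 3 * rad th (M i)).
Implicit Types (s e a C t : R) (u v f : R -> R[i]) (k i m : nat) (n : int).

Definition kset_at i : set R :=
  [set t | exists2 m, (M i <= m < 2 * M i)%N & tdist (m%:R * t) <= 3 * rad th (M i)].

Definition kset : set R := [set t | forall i, kset_at i t].

Lemma tdist_periodn (y : R) m : tdist (y + m%:R * (2 * pi)) = tdist y.
Proof.
elim: m => [|m IH]; first by rewrite mul0r addr0.
by rewrite -natr1 mulrDl mul1r addrA tdist_period.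
Qed.

Lemma kset_at_periodic i : periodic_set (kset_at i).
Proof.
by move=> t; split=> -[m h1 h2]; exists m => //; move: h2; rewrite mulrDr tdist_periodn.
Qed.

Lemma kset_at_closed i : closed (kset_at i).
Proof.
have -> : kset_at i = \bigcup_(m in [set m | (M i <= m < 2 * M i)%N])
    ((fun t => tdist (m%:R * t)) @^-1` [set y | y <= 3 * rad th (M i)]).
  by apply/seteqP; split=> t [m h1 h2]; exists m.
apply: closed_bigcup => [|m _].
  by apply: sub_finite_set (finite_II (2 * M i)%N) => m /= /andP[].
apply: closed_comp (@closed_le _ _) => t _.
apply: (@rlip_cont R (fun t => tdist (m%:R * t)) m%:R) => x y.
have := tdist_lip (m%:R * x) (m%:R * y); have := tdist_lip (m%:R * y) (m%:R * x).
rewrite -!mulrBr !normrM normr_nat (distrC y) => h1 h2; rewrite ler_norml; lra.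
Qed.

Lemma kset_closed : closed_torus kset.
Proof.
split=> [t|].
  by split=> h i; apply/kset_at_periodic; exact: h.
have -> : kset = \bigcap_i kset_at i.
  by apply/seteqP; split=> t h i //; exact: h.
by apply: closed_bigI => i _; exact: kset_at_closed.
Qed.

(* By compactness the supports of the densities G k shrink to the set. *)
Lemma kset_shrink u e : contp u -> (forall t, kset t -> u t = 0) -> 0 < e ->
  exists k, forall t, G k t != 0 -> cmod (u t) <= e.
Proof.
move=> cu u0 e0; have [pu cu'] := cu.
pose K := `[0, 2 * pi] `&` [set t | e <= cmod (u t)].
have cK : compact K.
  apply: compact_closedI; first exact: segment_compact.
  by apply: closed_comp (@closed_ge _ _) => t _; exact: cont_cmod.
rewrite compact_cover in cK.
have [i _|t [_ /= ut]|D _ DK] := cK nat setT (fun i => ~` kset_at i).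
- by apply: closed_openC; exact: kset_at_closed.
- have : ~ kset t by move=> /u0 h; move: ut; rewrite h cmod0 leNgt e0.
  by move=> /existsNP[i hi]; exists i.
have [N DN] := finite_nat_bound (finite_fset D).
exists N => t Gt; rewrite leNgt; apply/negP => ut.
have [n hn] := mod2pi t 0.
have uE : u (t + 2 * pi * n%:~R) = u t by exact: periodic_int.
have [|i iD] := DK (t + 2 * pi * n%:~R).
  split; first by rewrite /= in_itv /=; lra.
  by rewrite /= uE ltW.
by apply; apply/(periodic_setZ _ _ (@kset_at_periodic i)); exact: suppG Gt _ (DN _ iD).
Qed.

Definition Lk k u : R[i] := tint (fun t => cplx (G k) t * u t).

Lemma Lk_bound k u e : contp u -> (forall t, G k t != 0 -> cmod (u t) <= e) -> 0 <= e -> cmod (Lk k u) <= 2 * e.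
Proof.
move=> cu ue e0; have [ck _ g0] := niceG k; have /andP[_ m1] := meanG k.
have cGu := contpM ck cu.
rewrite (le_trans (cmod_tint cGu.2))// ler_pM2l//.
have cG : continuous (G k) by case: ck => _ [].
rewrite (@le_trans _ _ (mean (fun t => e * G k t)))//; last by rewrite mean_Z// ler_piMr.
apply: mean_le; [exact: cont_cmod cGu.2|by move=> t; apply: cvgM; [exact: cvg_cst|exact: cG]|].
move=> t _; rewrite cmodM /cplx cmod_real ger0_norm// mulrC.
have [->|gt] := eqVneq (G k t) 0; first by rewrite !mulr0.
by rewrite ler_wpM2r// ue.
Qed.

Lemma Lk_functional k : functional (Lk k).
Proof.
have [ck _ g0] := niceG k; split=> [z u v cu cv|u B cu uB].
  rewrite /Lk; have [_ c1] := contpM ck cu; have [_ c2] := contpM ck cv.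
  rewrite -tintZ// -tintD//; last by apply: contM => //; exact: cont_cst.
  by congr tint; apply/funext => t; ring.
apply: Lk_bound => //; exact: le_trans (cmod_ge0 _) (uB 0).
Qed.

Lemma Lk_expi k n : Lk k (expi n) = hat (cplx (G k)) (- n).
Proof. by rewrite /Lk /hat opprK. Qed.

Lemma Lk1 k : Lk k (fun=> 1) = (mean (G k))%:C.
Proof. by rewrite /Lk -tint_real; congr tint; apply/funext => t; rewrite mulr1. Qed.

Lemma Lk1_ge k : 1 / 2 <= cmod (Lk k (fun=> 1)).
Proof. by rewrite Lk1 cmod_real (le_trans _ (ler_norm _))//; case/andP: (meanG k). Qed.

Lemma kset_not_cyclic p q b C f : 1 < p -> q = p / (p - 1) -> 0 <= b -> A1 b f C ->
  1 < q * (th + b) -> kset `<=` zeros f -> ~ cyclic p b (distr_of_fun f).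
Proof.
move=> p1 qE b0 fA qt Ef; have q0 : 0 < q by rewrite qE divr_gt0//; lra.
have [a a01 qa] : exists2 a, 0 <= a < th & 1 < q * (a + b).
  have [qb|qb] := ltP 1 (q * b); first by exists 0; rewrite ?add0r// lexx; case/andP: t01.
  (* Chosen to make q (a + b) the midpoint of 1 and q (th + b). *)
  exists (th - (q * (th + b) - 1) / (2 * q)).
    have h1 : 0 < (q * (th + b) - 1) / (2 * q) by rewrite divr_gt0 ?mulr_gt0//; lra.
    have h2 : (q * (th + b) - 1) / (2 * q) <= th by rewrite ler_pdivrMr ?mulr_gt0//; nra.
    by apply/andP; split; lra.
  rewrite (_ : q * _ = (q * (th + b) + 1) / 2); last by field; rewrite gt_eqF.
  by lra.
have [C1 hC1] := hatG a01; have [C2 hC2] := wt_sum qa.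
have C10 : 0 <= C1 by apply: le_trans (hC1 0%N 0); rewrite mulr_ge0 ?cmod_ge0 ?powR_ge0.
apply: (@not_cyclic _ p q b C (C1 `^ q * C2)) => // P e tP e0.
have cPf : contp (fun t => P t * f t) by apply: contpM; [exact: tp_contp|case: fA].
have e2 : 0 < e / 2 by rewrite divr_gt0.
have z0 t : kset t -> P t * f t = 0 by move=> Et; rewrite (Ef t Et) mulr0.
have [k hk] := kset_shrink cPf z0 e2.
exists (Lk k); split.
- exact: Lk_functional.
- move=> F uF.
  rewrite (le_trans _ (ler_wpM2l (powR_ge0 _ _) (hC2 F uF)))// mulr_sumr ler_sum// => n _.
  have h1 := hC1 k (- n); rewrite wN in h1.
  rewrite Lk_expi; set x := cmod _ in h1 *; have x0 : 0 <= x by exact: cmod_ge0.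
  have -> : x `^ q * w R n `^ (- (q * b)) = (x * w R n `^ a) `^ q * w R n `^ (- (q * (a + b))).
    rewrite powRM ?powR_ge0// -powRrM -mulrA -powRD_pos ?w_gt0//; congr (_ * _ `^ _).
    by ring.
  by rewrite ler_wpM2r ?powR_ge0// ge0_ler_powR ?nnegrE ?mulr_ge0 ?powR_ge0// ltW.
- by rewrite (le_trans (Lk_bound cPf hk (ltW e2)))//; lra.
- exact: Lk1_ge.
Qed.

(** The lower bound for the dimension, by duality. The densities are uniformly bounded on the
    weighted l^2 space once 2a + 2c > 1, so a cutoff phi of tiny norm equal to 1 near the set would
    give 1/2 <= |L 1| <= |L (phi - 1)| + |L phi| <= 1/8 + 1/8. *)
Lemma kset_null c : 1 - 2 * c < 2 * th -> 0 < c -> ~ null_set c kset.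
Proof.
move=> c1 c0 nl.
have sqw (y : R) n : (w R n `^ y) ^+ 2 = w R n `^ (2 * y).
  by rewrite -powR_mulrn ?powR_ge0// -powRrM mulrC.
have [a a01 ac] : exists2 a, 0 <= a < th & 1 < 2 * a + 2 * c.
  have [h|h] := ltP 1 (2 * c); first by exists 0; rewrite ?mulr0 ?add0r// lexx; case/andP: t01.
  by exists ((th + (1 - 2 * c) / 2) / 2); [apply/andP; split; lra|lra].
have [C1 hC1] := hatG a01; have [C2 hC2] := wt_sum ac.
have C10 : 0 <= C1 by apply: le_trans (hC1 0%N 0); rewrite mulr_ge0 ?cmod_ge0 ?powR_ge0.
have C20 := bnd_ge0 hC2; pose K := C1 ^+ 2 * C2 + 1.
have K0 : 0 < K by rewrite ltr_wpDl// mulr_ge0 ?sqr_ge0.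
pose l := (16 * K)^-1; have l0 : 0 < l by rewrite invr_gt0 mulr_gt0.
have e0 : 0 < l / 16 by rewrite divr_gt0.
have [phi [cphi [L hL] [d d0 hd] hb]] := nl _ e0.
have cv : contp (fun t => phi t - 1) by apply: contpB => //; exact: contp_cst.
have z0 t : kset t -> phi t - 1 = 0 by move=> Et; rewrite (hd t t Et) ?subrr ?normr0.
have [k hk] := kset_shrink (e := 1 / 16) cv z0 ltac:(lra).
have h1 := Lk_bound cv hk ltac:(lra).
have [D hD] : exists D, A1 0 phi D by apply: Lip_A1 => //; [lra|exists L].
have h2 : cmod (Lk k phi) <= 1 / 8.
  apply: (functional_le (Lk_functional k) cphi (A1_l1 (lexx 0) hD)) => N.
  rewrite (@le_trans _ _ ((\sum_(n <- zr N) cmod (hat phi n) ^+ 2 * w R n `^ (2 * c)) / l +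
     l * \sum_(n <- zr N) cmod (Lk k (expi n)) ^+ 2 * w R n `^ (- (2 * c))))//.
    have h := @sum_cond_le R (fun n => cmod (hat phi n) * w R n `^ c) (fun n => cmod (Lk k (expi n)) * w R n `^ (- c)) l (zr N) l0.
    have {}h := h (fun n => mulr_ge0 (cmod_ge0 _) (powR_ge0 _ _)) (fun n => mulr_ge0 (cmod_ge0 _) (powR_ge0 _ _)).
    apply: le_trans (le_trans h _).
      rewrite le_eqVlt; apply/orP; left; apply/eqP; apply: eq_bigr => n _.
      by rewrite powRN; field; rewrite gt_eqF// wt_gt0.
    rewrite le_eqVlt; apply/orP; left; apply/eqP; congr (_ / _ + _ * _); apply: eq_bigr => n _.
      by rewrite exprMn sqw.
    by rewrite exprMn sqw mulrN.
  rewrite (_ : 1 / 8 = 1 / 16 + 1 / 16 :> R); last by field.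
  apply: lerD.
    rewrite ler_pdivrMr// (le_trans (hb _ (zr_uniq N)))//; lra.
  rewrite (@le_trans _ _ (l * (C1 ^+ 2 * C2)))//; last first.
    by rewrite /l mulrC ler_pdivrMr ?mulr_gt0// /K; lra.
  rewrite ler_pM2l// (le_trans _ (ler_wpM2l (sqr_ge0 _) (hC2 _ (zr_uniq N))))// mulr_sumr.
  apply: ler_sum => n _.
  have h3 := hC1 k (- n); rewrite wN in h3.
  rewrite Lk_expi; set x := cmod _ in h3 *; have x0 : 0 <= x by exact: cmod_ge0.
  have -> : x ^+ 2 * w R n `^ (- (2 * c)) = (x * w R n `^ a) ^+ 2 * w R n `^ (- (2 * a + 2 * c)).
    rewrite exprMn sqw; move: (x ^+ 2) => X; rewrite -mulrA -powRD_pos ?w_gt0//.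
    by congr (_ * _ `^ _); ring.
  by rewrite ler_wpM2r ?powR_ge0//; apply: lerXn2r; rewrite ?nnegrE ?mulr_ge0 ?powR_ge0.
have := Lk1_ge k.
have := (Lk_functional k).1 (-1) (fun t => phi t - 1) phi cv cphi.
rewrite (_ : (fun t => _) = fun=> 1); last by apply/funext => t; ring.
move=> ->; have := cmodD (-1 * Lk k (fun t => phi t - 1)) (Lk k phi).
rewrite mulN1r cmodN; lra.
Qed.

End KaufmanSet.

(** * Dimension of the Kaufman set; closed sets that forbid cyclicity *)

Section NonCyclicSets.
Variable R : realType.
Implicit Types (s e a C t th al b q p r : R) (f : R -> R[i]) (k i m M N : nat) (n : int) (E : set R).

Lemma powR_small s e : s < 0 -> 0 < e -> exists N0 : nat, forall N, (N0 < N)%N -> N%:R `^ s <= e.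
Proof.
move=> s0 e0; exists (Num.truncn (e^-1 `^ (- s)^-1)) => N NN.
have N0 : 0 < N%:R :> R by rewrite ltr0n (leq_ltn_trans _ NN).
have h : e^-1 `^ (- s)^-1 <= N%:R.
  by rewrite (le_trans (ltW (truncnS_gt _)))// ler_nat.
have ns : 0 < - s by lra.
have : (e^-1 `^ (- s)^-1) `^ (- s) <= N%:R `^ (- s).
  by rewrite ge0_ler_powR ?nnegrE ?powR_ge0// ltW.
rewrite powRVK ?invr_ge0 ?(ltW e0)// powRN => h2.
by rewrite -[leRHS]invrK -[leLHS]invrK lef_pV2 ?posrE ?invr_gt0 ?powR_gt0.
Qed.

Lemma tdist_mul_near M m r t : (0 < m)%N -> 0 < r <= 1 -> 0 <= t < 2 * pi -> tdist (m%:R * t) <= 3 * r ->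
  exists2 j : nat, (j <= m)%N & `|t - 2 * pi * j%:R / m%:R| <= 4 * r / m%:R.
Proof.
move=> m0 /andP[r0 r1] /andP[t0 t1] h; have p2 := pi_ge2 R.
have mm : 0 < m%:R :> R by rewrite ltr0n.
have [n hn] : exists n, `|m%:R * t + 2 * pi * n%:~R| < 4 * r by apply: tdist_lt; lra.
have mt0 : 0 <= m%:R * t by rewrite mulr_ge0// ltW.
have mt1 : m%:R * t < m%:R * (2 * pi) by rewrite ltr_pM2l.
move: hn; rewrite ltr_norml => /andP[h1 h2].
have p0 := twopi_gt0 R.
have n1 : n%:~R < 1 :> R.
  by rewrite -(ltr_pM2l p0); lra.
have n2 : - (m%:R + 1) < n%:~R :> R.
  by rewrite -(ltr_pM2l p0) mulrN mulrDr mulr1; lra.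
have n3 : n <= 0 by rewrite -ltzD1 add0r -(ltr_int R).
have n4 : (`|n| <= m)%N.
  have : - (m.+1)%:Z < n by rewrite -(ltr_int R) rmorphN /= -pmulrn -natr1.
  by move: n3; clear; lia.
exists `|n|%N => //.
have nE : n%:~R = - (`|n|%N)%:R :> R.
  have nn : n = - (`|n|%N)%:Z by move: n3; clear; lia.
  by rewrite {1}nn rmorphN /= -pmulrn.
rewrite (_ : t - _ = (m%:R * t + 2 * pi * n%:~R) / m%:R); last first.
  by rewrite nE; field; rewrite gt_eqF.
rewrite normrM (ger0_norm (_ : 0 <= _^-1)) ?invr_ge0 ?(ltW mm)// ler_pM2r ?invr_gt0//.
by rewrite ler_norml; apply/andP; split; lra.
Qed.

(** One level K = M N0 suffices: at most K times 2 K arcs of radius at most 4 K^(-1/th) have content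
    O(K^(2 - s/th)), with a negative exponent since s > 2 th. *)
Lemma kset_cov th (M : nat -> nat) s : 0 < th < 1 / 2 -> (forall k, (k < M k)%N) -> 2 * th < s ->
  cov s (kset th M `&` `[0, 2 * pi[).
Proof.
move=> t01 kM hs e e0; have s0 : 0 < s by lra.
have th0 : 0 < th by case/andP: t01.
have K0 : 0 < 2 * 4 `^ s :> R by rewrite mulr_gt0// powR_gt0.
have [N0 hN] : exists N0 : nat, forall N, (N0 < N)%N -> N%:R `^ (2 - s / th) <= e / (2 * 4 `^ s).
  apply: powR_small; last by rewrite divr_gt0.
  by rewrite subr_lt0 ltr_pdivlMr.
pose K := M N0; have NK : (N0 < K)%N := kM N0.
have K1 : (0 < K)%N by exact: leq_ltn_trans NK.
have KK : 0 < K%:R :> R by rewrite ltr0n.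
have r01 : 0 < rad th K <= 1 by apply: rad01 => //; lra.
have /andP[r0 r1] := r01.
exists [seq (2 * pi * j%:R / m%:R, 4 * rad th K / m%:R) | m <- index_iota K (2 * K), j <- iota 0 m.+1]; split.
- move=> _ /allpairsPdep[m [j [mK _ ->]]] /=; move: mK; rewrite mem_index_iota => /andP[mK _].
  by apply: divr_gt0; [exact: mulr_gt0|rewrite ltr0n; exact: leq_trans mK].
- move=> t [Et]; rewrite /= in_itv /= => t0.
  have [m mK ht] := Et N0; have /andP[m1 m2] := mK.
  have [|j jm hj] := tdist_mul_near K _ r01 t0 ht; first exact: leq_trans m1.
  exists (2 * pi * j%:R / m%:R, 4 * rad th K / m%:R) => //.
  apply: (@allpairs_f_dep _ _ _ (fun m j : nat => (2 * pi * j%:R / m%:R, 4 * rad th K / m%:R))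
    (index_iota K (2 * K)) (fun m => iota 0 m.+1) m j); first by rewrite mem_index_iota.
  by rewrite mem_iota.
rewrite big_allpairs_dep /=.
rewrite (@le_trans _ _ (\sum_(m <- index_iota K (2 * K)) (2 * K)%:R * (4 * rad th K / K%:R) `^ s))//.
  rewrite big_seq [leRHS]big_seq; apply: ler_sum => m; rewrite mem_index_iota => /andP[m1 m2].
  rewrite -[0%N :: _]/(iota 0 m.+1) big_const_seq count_predT size_iota iter_addr_0 -[leLHS]mulr_natl.
  have mm : 0 < m%:R :> R by rewrite ltr0n (leq_trans K1).
  apply: ler_pM; rewrite ?powR_ge0 ?ler_nat//.
  rewrite ge0_ler_powR ?nnegrE ?(ltW s0) ?divr_ge0 ?mulr_ge0 ?(ltW r0)//.
  by rewrite ler_wpM2l ?mulr_ge0 ?(ltW r0)// lef_pV2 ?posrE// ler_nat.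
rewrite big_const_seq count_predT size_iota iter_addr_0 -[leLHS]mulr_natl.
rewrite (_ : (2 * K - K)%N = K); last by lia.
have -> : 4 * rad th K / K%:R = 4 * K%:R `^ (- th^-1).
  by rewrite /rad powRN; field; rewrite !gt_eqF// powR_gt0.
rewrite powRM ?powR_ge0// -powRrM natrM.
rewrite (_ : _ * _ = 2 * 4 `^ s * (K%:R * K%:R * K%:R `^ (- th^-1 * s))); last by ring.
rewrite mulrC -ler_pdivlMr// (le_trans _ (hN K NK))//.
rewrite powRD_pos// powR_mulrn ?(ltW KK)// expr2 (_ : - th^-1 * s = - (s / th))//.
by rewrite mulNr mulrC.
Qed.

Lemma cov_null_torus s E : 0 < s < 1 -> periodic_set E -> cov s (E `&` `[0, 2 * pi[) ->
  null_set ((1 - s) / 2) E.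
Proof.
move=> s01 pE cE; apply: cov_null cE _; [lra|lra|].
exact: (@sumset_periodic _ _ 0).
Qed.

Lemma dimT_eq s E : 0 < s <= 1 -> closed_torus E -> (forall s', s < s' -> cov s' (E `&` `[0, 2 * pi[)) ->
  (forall s', 0 < s' < s -> ~ null_set ((1 - s') / 2) E) -> dimT E = s%:E.
Proof.
move=> s01 cE up lo; apply/eqP; rewrite eq_le; apply/andP; split.
  apply/lee_addgt0Pr => e e0; rewrite -EFinD; apply: dimT_le; first by lra.
  by apply: up; rewrite ltrDl.
apply: dimT_ge => // s' s'01 c; apply: (lo s') => //.
by apply: cov_null_torus c; [lra|case: cE].
Qed.

(** From above, N equal arcs. From below, a cutoff equal to 1 everywhere has coefficient 1 at 0, so
    the whole circle is never null. *)
Lemma dimT_setT : dimT [set: R] = 1%E.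
Proof.
have p0 := twopi_gt0 R.
apply: dimT_eq; [lra|by split; [|exact: closedT]| |].
  move=> s s1 e e0; have s0 : 0 < s by lra.
  have K0 : 0 < (2 * pi) `^ s :> R by rewrite powR_gt0.
  have [N0 hN] : exists N0 : nat, forall N, (N0 < N)%N -> N%:R `^ (1 - s) <= e / (2 * pi) `^ s.
    by apply: powR_small; [lra|rewrite divr_gt0].
  pose N := N0.+1; have NN : 0 < N%:R :> R by rewrite ltr0n.
  exists [seq (2 * pi * j%:R / N%:R, 2 * pi / N%:R) | j <- iota 0 N]; split.
  - by move=> _ /mapP[j _ ->] /=; rewrite divr_gt0.
  - move=> t [_]; rewrite /= in_itv /= => /andP[t0 t1].
    pose x := t * N%:R / (2 * pi); have x0 : 0 <= x by rewrite divr_ge0 ?(ltW p0)// mulr_ge0.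
    have /andP[x1 x2] := truncn_itv x0; pose j := Num.truncn x.
    have xN : x < N%:R by rewrite ltr_pdivrMr// mulrC ltr_pM2l.
    have jN : (j < N)%N by rewrite -(ltr_nat R); exact: le_lt_trans xN.
    exists (2 * pi * j%:R / N%:R, 2 * pi / N%:R).
      apply: (@map_f _ _ (fun j : nat => (2 * pi * j%:R / N%:R, 2 * pi / N%:R)) (iota 0 N)).
      by rewrite mem_iota.
    have tE : t = 2 * pi * x / N%:R by rewrite /x [2 * pi * _]mulrC divfK ?gt_eqF// mulfK ?gt_eqF.
    rewrite /= [X in `|X - _|]tE -mulrBl -mulrBr normrM (ger0_norm (_ : 0 <= _^-1)) ?invr_ge0// ler_pM2r ?invr_gt0//.
    rewrite normrM (ger0_norm (ltW p0)) ler_piMr ?(ltW p0)// ger0_norm ?subr_ge0//.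
    by rewrite lerBlDr (le_trans (ltW x2))// -natr1 addrC.
  rewrite big_map /= -[0%N :: _]/(iota 0 N) big_const_seq count_predT size_iota iter_addr_0 -[leLHS]mulr_natl.
  rewrite powRM ?invr_ge0 ?(ltW p0)// powRV_pos//.
  rewrite mulrCA -ler_pdivlMl// mulrC [leRHS]mulrC (le_trans _ (hN N (ltnSn _)))//.
  by rewrite powRD_pos// powRr1// mulrC.
move=> s s01 nl; have [phi [_ _ [d d0 hd] hb]] := nl (1 / 2) ltac:(lra).
have phiE : phi = fun=> 1 by apply/funext => t; apply: (hd t t) => //; rewrite subrr normr0.
have := hb [:: 0] isT; rewrite big_seq1 phiE hat_cst eqxx mulr1 cmod1 expr1n mul1r /w absz0 addr0 powR1.
lra.
Qed.

(** For al < 1 this is the Kaufman set with th = al / 2. The densities require th < 1/2, so for al =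
    1 the whole circle is taken; it contains a Kaufman set above the threshold, which already
    forbids cyclicity. *)
Lemma noncyclic_sets p q b al : 1 < p -> q = p / (p - 1) -> 2 < q -> 0 < b -> b * q <= 1 ->
  2 / q * (1 - b * q) < al -> al <= 1 ->
  exists E, [/\ closed_torus E, dimT E = al%:E &
    forall f, fun_in_A 1 b f -> zeros f = E -> ~ cyclic p b (distr_of_fun f)].
Proof.
move=> p1 qE q2 b0 bq D1 al1; have q0 : 0 < q by lra.
have D0 : 0 <= 2 / q * (1 - b * q) by rewrite mulr_ge0 ?divr_ge0 ?(ltW q0)//; lra.
have qD th : 2 / q * (1 - b * q) < 2 * th -> 1 < q * (th + b).
  move=> h; have : q * (2 / q * (1 - b * q)) < q * (2 * th) by rewrite ltr_pM2l.
  rewrite (_ : q * (2 / q * (1 - b * q)) = 2 * (1 - b * q)); last by field; rewrite gt_eqF.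
  lra.
have key th : 0 < th < 1 / 2 -> 2 / q * (1 - b * q) < 2 * th -> exists E,
    [/\ closed_torus E, dimT E = (2 * th)%:E &
     forall f, fun_in_A 1 b f -> E `<=` zeros f -> ~ cyclic p b (distr_of_fun f)].
  move=> t01 Dt; have [M [G [kM nG mG hG sG]]] := kaufman_seq t01.
  have cE := kset_closed th M; exists (kset th M); split => //.
    apply: dimT_eq => //; first by lra.
      by move=> s hs; exact: kset_cov.
    by move=> s s01; apply: (kset_null t01 nG mG hG sG); lra.
  move=> f /fun_in_A_A1[C fA] Ef.
  exact: (kset_not_cyclic t01 nG mG hG sG p1 qE (ltW b0) fA (qD _ Dt) Ef).
have [al1'|al1'] := ltP al 1.
  have [||E [cE dE hE]] := key (al / 2); [lra|lra|].
  exists E; split=> //; first by rewrite dE; congr EFin; lra.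
  by move=> f fA zE; apply: hE => //; rewrite zE.
have [||E [cE dE hE]] := key ((2 / q * (1 - b * q) + 1) / 4); [lra|lra|].
exists setT; split; first by split; [|exact: closedT].
  by rewrite dimT_setT; congr EFin; lra.
by move=> f fA zE; apply: hE => //; rewrite zE.
Qed.

End NonCyclicSets.

(** * Cantor sets with small sumsets *)

Section Cantor.
Variable R : realType.
Variables (s : R) (a : nat).
Hypothesis s01 : 0 < s < 1.
Implicit Types (e t h x y r : R) (i j k J D B : nat).

(* At stage J each interval of length [cantor_len] is replaced by 2^J.+1 equally spaced
   ones. The factor 2^-(a J) is subexponential compared with [cantor_num J], so it does
   not change the dimension s, but for large a it beats the factor K^J by which K-fold
   sums increase the number of intervals. *)
Fixpoint cantor_num J : nat := if J is J'.+1 then (cantor_num J' * 2 ^ J)%N else 1%N.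

Definition cantor_len J : R := (cantor_num J)%:R `^ (- s^-1) * 2^-1 ^+ (a * J).

Definition cantor_gap J : R := if J is J'.+1 then cantor_len J' / 2 ^+ J else 1.

(** Left endpoints of the intervals of stage J, indexed in mixed radix. Indices from [cantor_num J]
    on give integer translates of the construction, so the estimates on consecutive points hold
    without a range condition. *)
Fixpoint cantor_pt J i : R := if J is J'.+1 then cantor_pt J' (i %/ 2 ^ J) + (i %% 2 ^ J)%:R * cantor_gap J else i%:R.

Lemma cantor_num_gt0 J : (0 < cantor_num J)%N.
Proof. by elim: J => //= J IH; rewrite muln_gt0 IH expn_gt0. Qed.

Lemma cantor_num_gt J : (J < cantor_num J)%N.
Proof.
elim: J => //= J IH; rewrite (@leq_trans (cantor_num J * 2)%N)//.
  by rewrite (@leq_trans (J.+1 * 2)%N) ?leq_mul2r ?IH ?orbT// muln2 -addnn addSn ltnS leq_addl.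
by rewrite leq_mul2l expnS leq_pmulr ?orbT// expn_gt0.
Qed.

Lemma cantor_len_gt0 J : 0 < cantor_len J.
Proof. by rewrite mulr_gt0 ?powR_gt0 ?ltr0n ?cantor_num_gt0// exprn_gt0// invr_gt0. Qed.

Lemma cantor_len0 : cantor_len 0 = 1.
Proof. by rewrite /cantor_len /= powR1 muln0 expr0 mulr1. Qed.

(** Intervals of one stage do not overlap: s < 1 makes the length shrink at least as fast as the
    spacing, since (2^J)^(-1/s) <= 2^-J. *)
Lemma cantor_len_le_cd J : cantor_len J <= cantor_gap J.
Proof.
case: J => [|J]; first by rewrite cantor_len0.
have s0 : 0 < s by case/andP: s01.
rewrite /cantor_gap /cantor_len /= natrM powRM ?ler0n//.
have m0 : 0 < (cantor_num J)%:R :> R by rewrite ltr0n cantor_num_gt0.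
have h1 : (2 ^ J.+1)%:R `^ (- s^-1) <= (2 ^+ J.+1)^-1 :> R.
  have k1 : 1 <= 2 ^+ J.+1 :> R by rewrite exprn_ege1// ler1n.
  rewrite natrX powRN lef_pV2 ?posrE ?powR_gt0 ?exprn_gt0//.
  by rewrite le1r_powR// invf_ge1// ltW//; case/andP: s01.
have h2 : 2^-1 ^+ (a * J.+1) <= 2^-1 ^+ (a * J) :> R.
  by apply: ler_wiXn2l; rewrite ?invr_ge0 ?invf_le1 ?ler1n// leq_mul.
rewrite -!mulrA ler_wpM2l ?powR_ge0// mulrC.
by apply: ler_pM; rewrite ?exprn_ge0 ?powR_ge0 ?invr_ge0.
Qed.

Lemma cantor_gap_gt0 J : 0 < cantor_gap J.
Proof. exact: lt_le_trans (cantor_len_gt0 J) (cantor_len_le_cd J). Qed.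

Lemma cantor_gapS J : cantor_gap J.+1 * 2 ^+ J.+1 = cantor_len J.
Proof. by rewrite /cantor_gap divfK// expf_neq0. Qed.

Lemma cantor_pt_step J i : cantor_pt J i + cantor_gap J <= cantor_pt J i.+1.
Proof.
elim: J i => [|J IH] i; first by rewrite /= -natr1.
rewrite -[cantor_pt J.+1 i]/(cantor_pt J (i %/ 2 ^ J.+1) + (i %% 2 ^ J.+1)%:R * cantor_gap J.+1).
rewrite -[cantor_pt J.+1 i.+1]/(cantor_pt J (i.+1 %/ 2 ^ J.+1) + (i.+1 %% 2 ^ J.+1)%:R * cantor_gap J.+1).
have N0 : (0 < 2 ^ J.+1)%N by rewrite expn_gt0.
rewrite divnS// modnS; case: ifP => dv; last first.
  by rewrite add0n -natr1 mulrDl mul1r addrA.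
rewrite add1n mul0r addr0.
have mE : (i %% 2 ^ J.+1).+1 = (2 ^ J.+1)%N.
  have := modnS i (2 ^ J.+1); rewrite dv => h0.
  apply/eqP; rewrite eqn_leq ltn_pmod//= dvdn_leq//.
  by rewrite /dvdn -addn1 modnDml addn1 -/(dvdn _ _).
rewrite -addrA -{2}(mul1r (cantor_gap J.+1)) -mulrDl natr1 mE natrX mulrC cantor_gapS.
by rewrite (le_trans _ (IH _))// lerD2l cantor_len_le_cd.
Qed.

Lemma cantor_pt_gap J i k : cantor_pt J i + k%:R * cantor_gap J <= cantor_pt J (i + k).
Proof.
elim: k => [|k IH]; first by rewrite mul0r addr0 addn0.
by rewrite addnS (le_trans _ (cantor_pt_step _ _))// -natr1 mulrDl mul1r addrA lerD2r.
Qed.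

(** B is the number of intervals of stage j + k inside one of stage j. Indices fall into runs of
    length B, each run inside its parent interval, and the first of a run has the left endpoint of
    the parent; hence left endpoints survive all later stages. *)
Lemma cantor_pt_refine j k : exists B, [/\ cantor_num (j + k) = (cantor_num j * B)%N, (0 < B)%N,
  forall i, cantor_pt j (i %/ B) <= cantor_pt (j + k) i <= cantor_pt j (i %/ B) + (cantor_len j - cantor_len (j + k)) &
  forall i, cantor_pt (j + k) (i * B) = cantor_pt j i].
Proof.
elim: k => [|k [B [MB B0 hB hB2]]].
  by exists 1%N; rewrite addn0 muln1 subrr; split=> // i; rewrite ?muln1// divn1 addr0 lexx.
have N0 : (0 < 2 ^ (j + k).+1)%N by rewrite expn_gt0.
exists (B * 2 ^ (j + k).+1)%N; rewrite addnS; split.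
- by rewrite -[cantor_num _]/(cantor_num (j + k) * 2 ^ (j + k).+1)%N MB mulnA.
- by rewrite muln_gt0 B0.
- move=> i; rewrite -[cantor_pt (j + k).+1 i]/(cantor_pt (j + k) (i %/ 2 ^ (j + k).+1) + (i %% 2 ^ (j + k).+1)%:R * cantor_gap (j + k).+1).
  rewrite mulnC divnMA; have /andP[h1 h2] := hB (i %/ 2 ^ (j + k).+1)%N.
  have d0 := cantor_gap_gt0 (j + k).+1.
  have h3 : 0 <= (i %% 2 ^ (j + k).+1)%:R * cantor_gap (j + k).+1 by rewrite mulr_ge0// ltW.
  have h4 : (i %% 2 ^ (j + k).+1)%:R * cantor_gap (j + k).+1 + cantor_gap (j + k).+1 <= cantor_len (j + k).
    rewrite -{2}(mul1r (cantor_gap _)) -mulrDl natr1 -cantor_gapS mulrC ler_pM2l// -natrX ler_nat.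
    exact: ltn_pmod.
  have h5 := cantor_len_le_cd (j + k).+1.
  by apply/andP; split; lra.
- move=> i; rewrite -[cantor_pt (j + k).+1 _]/(cantor_pt (j + k) (i * (B * 2 ^ (j + k).+1) %/ 2 ^ (j + k).+1) +
    (i * (B * 2 ^ (j + k).+1) %% 2 ^ (j + k).+1)%:R * cantor_gap (j + k).+1).
  by rewrite mulnA mulnK// modnMl mul0r addr0 hB2.
Qed.

Lemma cantor_pt01 J i : (i < cantor_num J)%N -> 0 <= cantor_pt J i <= 1.
Proof.
move=> iJ; have [B [MB B0 hB _]] := cantor_pt_refine 0 J.
have := hB i; rewrite add0n /= in MB *; rewrite mul1n in MB.
rewrite divn_small -?MB// cantor_len0 add0r => /andP[h1 h2]; rewrite h1 (le_trans h2)//.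
by rewrite gerBl ltW// cantor_len_gt0.
Qed.

Definition cantor : set R :=
  [set x | forall J, exists2 i, (i < cantor_num J)%N & tdist (x - cantor_pt J i) <= cantor_len J].

Lemma cantor_closed : closed_torus cantor.
Proof.
split=> [t|].
  have pe J i : tdist (t + 2 * pi - cantor_pt J i) = tdist (t - cantor_pt J i) by rewrite addrAC tdist_period.
  by split=> h J; have [i iJ hi] := h J; exists i => //; rewrite ?pe// -pe.
have -> : cantor = \bigcap_J \bigcup_(i in [set i | (i < cantor_num J)%N]) ((fun t => tdist (t - cantor_pt J i)) @^-1` [set y | y <= cantor_len J]).
  apply/seteqP; split=> [t h J _|t h J]; first by have [i iJ hi] := h J; exists i.
  by have [i iJ hi] := h J I; exists i.
apply: closed_bigI => J _; apply: closed_bigcup => [|i _].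
  exact: sub_finite_set (finite_II (cantor_num J)).
apply: closed_comp (@closed_le _ _) => t _.
apply: (@rlip_cont R (fun t => tdist (t - cantor_pt J i)) 1) => x y.
have := tdist_lip (x - cantor_pt J i) (y - cantor_pt J i); have := tdist_lip (y - cantor_pt J i) (x - cantor_pt J i).
rewrite (_ : y - _ - (x - _) = y - x); last by ring.
rewrite (_ : x - cantor_pt J i - (y - _) = x - y); last by ring.
by rewrite (distrC y) mul1r => h1 h2; rewrite ler_norml; lra.
Qed.

Lemma cantor_pt_cantor J i : (i < cantor_num J)%N -> cantor (cantor_pt J i).
Proof.
move=> iJ j; have [jJ|jJ] := leqP j J.
  have [B [MB B0 hB _]] := cantor_pt_refine j (J - j); rewrite subnKC// in MB hB.
  exists (i %/ B)%N; first by rewrite ltn_divLR// -MB.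
  have /andP[h1 h2] := hB i; have l0 := cantor_len_gt0 J.
  by rewrite (le_trans (tdist_le0 _))// ger0_norm; lra.
have [B [MB B0 _ hB]] := cantor_pt_refine J (j - J); rewrite (subnKC (ltnW jJ)) in MB hB.
exists (i * B)%N; first by rewrite MB ltn_pmul2r.
by rewrite hB subrr (le_trans (tdist_le0 _))// normr0 ltW// cantor_len_gt0.
Qed.

Lemma cantor_pt_fund J i : (i < cantor_num J)%N -> (cantor `&` `[0, 2 * pi[) (cantor_pt J i).
Proof.
move=> iJ; split; first exact: cantor_pt_cantor.
have /andP[h1 h2] := cantor_pt01 iJ; rewrite /= in_itv /= h1 (le_lt_trans h2)//.
have := pi_ge2 R; lra.
Qed.

Lemma cantor_len_le1 J : cantor_len J <= 1.
Proof.
elim: J => [|J IH]; first by rewrite cantor_len0.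
rewrite (le_trans (cantor_len_le_cd _))// (le_trans _ IH)// /cantor_gap.
by rewrite ler_pdivrMr ?exprn_gt0// ler_peMr ?(ltW (cantor_len_gt0 _))// exprn_ege1// ler1n.
Qed.

Lemma cantor_len_le_half J : (0 < J)%N -> cantor_len J <= 1 / 2.
Proof.
case: J => // J _; rewrite (le_trans (cantor_len_le_cd _))// /cantor_gap.
rewrite ler_pdivrMr ?exprn_gt0// exprS mulrA divfK// mul1r (le_trans (cantor_len_le1 J))//.
by rewrite exprn_ege1// ler1n.
Qed.

(* On this window the fundamental translate of a point does not depend on the stage. *)
Definition cwin : set R := cantor `&` `[-1, 2 * pi - 1[.

Lemma cwinI x : cantor x -> -1 <= x -> x < 2 * pi - 1 -> cwin x.
Proof. by move=> cx x0 x1; split; rewrite //= in_itv /= x0. Qed.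

Lemma cwin_near J x : (0 < J)%N -> cwin x -> exists2 i, (i < cantor_num J)%N & `|x - cantor_pt J i| < 2 * cantor_len J.
Proof.
move=> J0 [cx]; rewrite /= in_itv /= => /andP[x0 x1]; have [i iJ hi] := cx J.
exists i => //; have l0 := cantor_len_gt0 J; have l1 := cantor_len_le_half J0.
have p2 := pi_ge2 R; have p0 := twopi_gt0 R.
(* x lies in [-1, 2 pi - 1[ and the endpoint in [0, 1], so only the translate n = 0 comes within
   distance 1. *)
have [n hn] : exists n, `|x - cantor_pt J i + 2 * pi * n%:~R| < 2 * cantor_len J by apply: tdist_lt; lra.
have /andP[q0 q1] := cantor_pt01 iJ.
have := hn; rewrite ltr_norml => /andP[h1 h2].
have n1 : n%:~R < 1 :> R by rewrite -(ltr_pM2l p0); lra.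
have n2 : -1 < n%:~R :> R by rewrite -(ltr_pM2l p0); lra.
have nn : n = 0.
  have : n < 1 by rewrite -(ltr_int R).
  have : -1 < n by rewrite -(ltr_int R).
  by clear; lia.
by rewrite nn mulr0 addr0 in hn.
Qed.

Definition cend J : set R := [set y | exists2 i, (i < cantor_num J)%N & y = cantor_pt J i].

Lemma sum_near J j x : (0 < J)%N -> sumset cwin j x ->
  exists2 y, sumset (cend J) j y & `|x - y| <= 2 * j.+1%:R * cantor_len J.
Proof.
move=> J0; elim: j x => [|j IH] x /=.
  move=> /(cwin_near J0)[i iJ h]; exists (cantor_pt J i); first by exists i.
  by rewrite mulr1 ltW.
move=> [x1 [x2 [/(cwin_near J0)[i iJ h] /IH[y sy hy] ->]]].
exists (cantor_pt J i + y); first by exists (cantor_pt J i), y; split=> //; exists i.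
rewrite (_ : x1 + x2 - (cantor_pt J i + y) = (x1 - cantor_pt J i) + (x2 - y)); last by ring.
rewrite (le_trans (ler_normD _ _))//.
have jn : j.+2%:R = j.+1%:R + 1 :> R by rewrite natr1.
by have := ltW h; rewrite jn => h'; lra.
Qed.

(** This is why sumsets stay small: the offsets of a stage are multiples of one gap, so their sums
    over j + 1 summands take at most (j + 1) 2^(J+1) values instead of the power j + 1 of
    2^(J+1). *)
Lemma sum_step J j y : sumset (cend J.+1) j y ->
  exists y' c, [/\ sumset (cend J) j y', (c < j.+1 * 2 ^ J.+1)%N & y = y' + c%:R * cantor_gap J.+1].
Proof.
have base x : cend J.+1 x -> exists y' c, [/\ cend J y', (c < 2 ^ J.+1)%N & x = y' + c%:R * cantor_gap J.+1].
  move=> [i iJ ->]; exists (cantor_pt J (i %/ 2 ^ J.+1)), (i %% 2 ^ J.+1)%N; split=> //.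
  - by exists (i %/ 2 ^ J.+1)%N => //; rewrite ltn_divLR ?expn_gt0.
  - by rewrite ltn_pmod// expn_gt0.
elim: j y => [|j IH] y; first by rewrite mul1n; exact: base.
move=> [x1 [x2 [/base[y1 [c1 [h1 hc1 ->]]] /IH[y2 [c2 [h2 hc2 ->]]] ->]]].
exists (y1 + y2), (c1 + c2)%N; split; [by exists y1, y2| |by rewrite natrD; ring].
by rewrite mulSn -addnS leq_add// ltnW.
Qed.

Fixpoint ctab K J : seq R := if J is J'.+1 then
  [seq y + c%:R * cantor_gap J | y <- ctab K J', c <- iota 0 (K * 2 ^ J)] else [:: 0].

Lemma size_ctab K J : size (ctab K J) = (K ^ J * cantor_num J)%N.
Proof.
by elim: J => [|J IH] //; rewrite size_allpairs IH size_iota (expnSr K) mulnACA.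
Qed.

Lemma mem_ctab K J j y : (j < K)%N -> sumset (cend J) j y -> y \in ctab K J.
Proof.
move=> jK; elim: J y => [|J IH] y.
  have base x : cend 0 x -> x = 0 by move=> [[|i] //= _ ->].
  rewrite /= inE => h; apply/eqP; clear jK.
  by elim: j y h => [|j IH] y /=; [exact: base|move=> [x1 [x2 [/base -> /IH -> ->]]]; rewrite addr0].
move=> /sum_step[y' [c [h1 h2 ->]]].
apply: (@allpairs_f _ _ _ (fun y c => y + c%:R * cantor_gap J.+1) (ctab K J) (iota 0 (K * 2 ^ J.+1)) y' c).
  exact: IH.
by rewrite mem_iota add0n (leq_trans h2)// leq_mul2r jK orbT.
Qed.

(** K^J times [cantor_num J] intervals of radius 2 K [cantor_len J] suffice. As the s-th power of
    [cantor_len J] is 2^(-asJ) / [cantor_num J], their content is Q (K 2^(-as))^J, at most Q 2^-J by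
    the hypothesis on a. *)
Lemma sumset_cov K j : (j < K)%N -> K%:R * (2^-1 `^ s) ^+ a <= 1 / 2 -> cov s (sumset cwin j).
Proof.
move=> jK HK e e0; have /andP[s0 s1] := s01.
have K0 : 0 < K%:R :> R by rewrite ltr0n (leq_trans _ jK).
pose Q := (2 * K%:R) `^ s; have Q0 : 0 < Q by rewrite powR_gt0// mulr_gt0.
have [J J0 QJ] : exists2 J, (0 < J)%N & Q / e <= 2 ^+ J.
  exists (Num.truncn (Q / e)).+1 => //.
  by rewrite (le_trans (ltW (truncnS_gt _)))// -natrX ler_nat ltnW// ltn_expl.
exists [seq (y, 2 * K%:R * cantor_len J) | y <- ctab K J]; split.
- by move=> _ /mapP[y _ ->] /=; rewrite mulr_gt0 ?cantor_len_gt0// mulr_gt0.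
- move=> x sx; have [y sy hy] := sum_near J0 sx.
  exists (y, 2 * K%:R * cantor_len J); first by apply: map_f; exact: mem_ctab sy.
  rewrite /= (le_trans hy)// ler_wpM2r ?(ltW (cantor_len_gt0 _))// ler_pM2l// ler_nat//.
rewrite big_map /= big_const_seq count_predT iter_addr_0 -[leLHS]mulr_natl size_ctab.
have m0 : 0 < (cantor_num J)%:R :> R by rewrite ltr0n cantor_num_gt0.
have clE : cantor_len J `^ s = (cantor_num J)%:R^-1 * ((2^-1 `^ s) ^+ a) ^+ J.
  rewrite /cantor_len powRM ?powR_ge0 ?exprn_ge0 ?invr_ge0// -powRrM mulNr mulVf ?gt_eqF//.
  by rewrite powR_inv1 ?(ltW m0)// powR_expn ?invr_ge0// exprM.
rewrite powRM ?mulr_ge0 ?(ltW (cantor_len_gt0 _))// -/Q clE natrM natrX.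
rewrite (_ : _ * _ = Q * (K%:R * (2^-1 `^ s) ^+ a) ^+ J); last first.
  by rewrite exprMn; field; rewrite gt_eqF.
rewrite (@le_trans _ _ (Q * (1 / 2) ^+ J))//.
  by rewrite ler_pM2l//; apply: lerXn2r; rewrite ?nnegrE ?mulr_ge0 ?exprn_ge0 ?powR_ge0.
rewrite mul1r exprVn ler_pdivrMr ?exprn_gt0// mulrC.
by rewrite -ler_pdivrMr.
Qed.

Lemma cwin_lift x : cantor x -> exists n : int, cwin (x + 2 * pi * n%:~R).
Proof.
move=> cx; have [n hn] := mod2pi x (-1); exists n; split.
  by apply/periodic_setZ => //; case: (cantor_closed).
by rewrite /= in_itv /= addrC in hn *; move: hn; rewrite [-1 + _]addrC.
Qed.

Lemma sumset_lift j x : sumset cantor j x -> exists n : int, sumset cwin j (x + 2 * pi * n%:~R).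
Proof.
elim: j x => [|j IH] x /=; first exact: cwin_lift.
move=> [y [z [/cwin_lift[n hn] /IH[m hm] ->]]]; exists (n + m).
exists (y + 2 * pi * n%:~R), (z + 2 * pi * m%:~R); split=> //.
by rewrite rmorphD /=; ring.
Qed.

(** The case of one summand, brought back from the window [-1, 2 pi - 1[: the part in [2 pi - 1, 2
    pi[ is covered by translates by 2 pi, which doubles the content. *)
Lemma cantor_cov K : (0 < K)%N -> K%:R * (2^-1 `^ s) ^+ a <= 1 / 2 -> cov s (cantor `&` `[0, 2 * pi[).
Proof.
move=> K0 HK e e0; have e2 : 0 < e / 2 by rewrite divr_gt0.
have pi1 : 1 <= 2 * pi :> R by have := pi_ge2 R; lra.
have [l [l0 lA lS]] := sumset_cov K0 HK e2.
exists (l ++ map (fun x : R * R => (x.1 + 2 * pi, x.2)) l); split.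
- move=> x; rewrite mem_cat => /orP[/l0//|/mapP[y yl ->] /=]; exact: l0.
- move=> t [ct]; rewrite /= in_itv /= => /andP[t0 t1].
  have [h|h] := ltP t (2 * pi - 1).
    have [|x xl hx] := lA t; first by split=> //=; rewrite in_itv /= h andbT; lra.
    by exists x => //; rewrite mem_cat xl.
  have [|x xl hx] := lA (t - 2 * pi).
    apply: cwinI.
    - by case: (cantor_closed) => pc _; apply/(pc (t - 2 * pi)); rewrite subrK.
    - by rewrite lerBrDr addrC.
    - by apply: (@lt_le_trans _ _ 0); [rewrite subr_lt0; exact: t1|rewrite subr_ge0; exact: pi1].
  exists (x.1 + 2 * pi, x.2) => /=.
    by rewrite mem_cat (map_f (fun x : R * R => (x.1 + 2 * pi, x.2))) ?orbT.
  by rewrite (_ : t - _ = t - 2 * pi - x.1)//; ring.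
by rewrite big_cat big_map /=; lra.
Qed.

Lemma cantor_num_sqr j : (2 ^ (j * j) <= cantor_num j * cantor_num j)%N.
Proof.
elim: j => // j IH; rewrite [cantor_num j.+1]/= mulnACA -expnD.
rewrite (_ : (j.+1 * j.+1 = j * j + (j + j.+1))%N); last by lia.
by rewrite expnD leq_mul// leq_exp2l//; lia.
Qed.

(** [cantor_num j] is at least 2^(j^2/2), so even a small power of it beats the exponential
    2^(aj). *)
Lemma exp_le_cM (de : R) : 0 < de -> exists2 C : R, 0 < C & forall j, 2 ^+ (a * j) <= C * (cantor_num j)%:R `^ de.
Proof.
move=> d0; pose j1 := (Num.truncn (2 * a%:R / de)).+1.
exists (2 ^+ (a * j1)) => [|j]; first by rewrite exprn_gt0.
have m1 : 1 <= (cantor_num j)%:R :> R by rewrite ler1n cantor_num_gt0.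
have q1 : 1 <= (cantor_num j)%:R `^ de by rewrite -[leLHS](powRr0 (cantor_num j)%:R) ler_powR// ltW.
have [jj|jj] := leqP j j1.
  rewrite (@le_trans _ _ (2 ^+ (a * j1)))//; last by rewrite ler_peMr ?exprn_ge0.
  by apply: ler_weXn2l; rewrite ?ler1n// leq_mul2l jj orbT.
rewrite (@le_trans _ _ ((cantor_num j)%:R `^ de))//; last first.
  by rewrite ler_peMl ?powR_ge0// exprn_ege1// ler1n.
have h1 : 2 * a%:R / de <= j%:R.
  by rewrite (le_trans (ltW (truncnS_gt _)))// ler_nat ltnW.
have h2 : (2 ^ (j * j))%:R `^ (de / 2) <= (cantor_num j)%:R `^ de.
  rewrite (_ : (cantor_num j)%:R `^ de = ((cantor_num j * cantor_num j)%N%:R) `^ (de / 2)).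
    by rewrite ge0_ler_powR ?nnegrE// ?ler_nat ?cantor_num_sqr//; lra.
  rewrite natrM powRM// -powRD_pos; last by lra.
  by congr (_ `^ _); field.
rewrite (le_trans _ h2)// natrX -!powR_mulrn// -powRrM ler_powR ?ler1n//.
rewrite !natrM; have j0 : (0 : R) <= j%:R by [].
move: h1; rewrite ler_pdivrMr// => h1.
have := ler_wpM2l j0 h1; lra.
Qed.

(** The endpoints of a stage, equally weighted, satisfy the growth condition of the mass
    distribution principle with exponent t; the room between t and s absorbs the factor 2^(aj),
    through [exp_le_cM]. *)
Lemma cantor_pt_count t : 0 < t < s -> exists2 C : R, 0 < C & forall J i D h,
  (i + D < cantor_num J)%N -> 0 <= h -> cantor_pt J (i + D) - cantor_pt J i <= h ->
  D%:R <= 3 + 3 * (cantor_num J)%:R * (C * h) `^ t.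
Proof.
move=> /andP[t0 ts]; have /andP[s0 s1] := s01.
pose de := t^-1 - s^-1.
have d0 : 0 < de by rewrite subr_gt0 ltf_pV2 ?posrE.
have [C C0 hC] := exp_le_cM d0; exists C => // J i D h iDJ h0 hg.
have mJ : 0 < (cantor_num J)%:R :> R by rewrite ltr0n cantor_num_gt0.
have [D3|D3] := leqP D 2.
  rewrite ler_wpDr ?mulr_ge0 ?powR_ge0//.
  by rewrite ler_nat; lia.
(* The least stage for which D indices are worth three runs of length B. Three runs force at least
   two gaps of that stage ([gap]), and minimality bounds D from above ([jD]). *)
have ex : exists j, (3 * cantor_num J <= cantor_num j * D)%N by exists J; rewrite mulnC leq_mul2l D3 orbT.
case: (ex_minnP ex) => -[|j] hj jmin.
  by rewrite mul1n in hj; exfalso; have := leq_trans hj (leq_addl i D); rewrite leqNgt (leq_trans iDJ)// leq_pmull.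
have jJ : (j.+1 <= J)%N by apply: jmin; rewrite mulnC leq_mul2l D3 orbT.
have jD : (cantor_num j * D < 3 * cantor_num J)%N by rewrite ltnNge; apply/negP => /jmin; rewrite ltnn.
have [B [MB B0 hB _]] := cantor_pt_refine j.+1 (J - j.+1); rewrite subnKC// in MB hB.
have BD : (3 * B <= D)%N.
  by move: hj; rewrite MB mulnCA leq_pmul2l// cantor_num_gt0.
pose k := (D %/ B)%N; have k3 : (3 <= k)%N by rewrite leq_divRL.
have Dk : (D < k.+1 * B)%N by exact: ltn_ceil.
have B0' : 0 < B%:R :> R by rewrite ltr0n.
have d0' := cantor_gap_gt0 j.+1.
have gap : (k%:R - 1) * cantor_gap j.+1 <= h.
  have /andP[u1 u2] := hB i; have /andP[u3 u4] := hB (i + D)%N.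
  have ik : (i %/ B + k <= (i + D) %/ B)%N by rewrite leq_divRL// mulnDl leq_add// leq_trunc_div.
  have u5 := cantor_pt_gap j.+1 (i %/ B) ((i + D) %/ B - i %/ B); rewrite subnKC in u5; last first.
    by rewrite leq_div2r// leq_addr.
  have u6 : k%:R * cantor_gap j.+1 <= ((i + D) %/ B - i %/ B)%:R * cantor_gap j.+1.
    by rewrite ler_pM2r// ler_nat leq_subRL// leq_div2r// leq_addr.
  have u7 := cantor_len_le_cd j.+1; have u8 := cantor_len_gt0 J.
  by rewrite mulrBl mul1r; lra.
pose y : R := D%:R / (3 * (cantor_num J)%:R); have D0 : 0 < D%:R :> R by rewrite ltr0n (leq_trans _ D3).
have y0 : 0 < y by rewrite divr_gt0// mulr_gt0.
have mj : 0 < (cantor_num j)%:R :> R by rewrite ltr0n cantor_num_gt0.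
have l0 := cantor_len_gt0 j.
have gap2 : y * ((cantor_num j)%:R * cantor_len j) <= h.
  apply: le_trans gap.
  have -> : y * ((cantor_num j)%:R * cantor_len j) = D%:R / (3 * B%:R) * cantor_gap j.+1.
    rewrite /y MB [cantor_num j.+1]/= /cantor_gap !natrM natrX; field; rewrite !gt_eqF//.
  rewrite ler_pM2r// ler_pdivrMr ?mulr_gt0//.
  have : D%:R <= (k%:R + 1) * B%:R :> R by rewrite natr1 -natrM ler_nat ltnW.
  have : 3 <= k%:R :> R by rewrite ler_nat.
  move=> k3' hD; have : (k%:R + 1) * B%:R <= (k%:R - 1) * 3 * B%:R :> R by rewrite ler_pM2r//; lra.
  lra.
have my : (cantor_num j)%:R <= y^-1.
  rewrite -[leLHS]invrK lef_pV2 ?posrE ?invr_gt0// /y ler_pdivrMr ?mulr_gt0//.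
  by rewrite mulrC ler_pdivlMr// mulrC -!natrM ler_nat ltnW.
have t1 : 1 < t^-1 by rewrite invf_gt1//; lra.
have key : y `^ t^-1 <= C * h.
  rewrite mulrC -ler_pdivrMr// (le_trans _ gap2)//.
  have -> : y `^ t^-1 / C = y * (y `^ (t^-1 - 1) / C).
    by rewrite mulrA -{2}(powRr1 (ltW y0)) -powRD_pos// subrKC.
  rewrite ler_pM2l// ler_pdivrMr//.
  have e1 : (cantor_num j)%:R * cantor_len j * C = (cantor_num j)%:R `^ (1 - s^-1) * (C / 2 ^+ (a * j)).
    by rewrite powRD_pos// powRr1 ?(ltW mj)// /cantor_len exprVn; ring.
  have e2 : (cantor_num j)%:R `^ (1 - t^-1) <= (cantor_num j)%:R * cantor_len j * C.
    rewrite e1 (_ : 1 - t^-1 = (1 - s^-1) - de); last by rewrite /de; ring.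
    rewrite (@powRD_pos R _ (1 - s^-1) (- de) mj) ler_wpM2l ?powR_ge0// powRN ler_pdivlMr ?exprn_gt0// mulrC ler_pdivrMr ?powR_gt0//.
  apply: le_trans e2; rewrite (_ : 1 - t^-1 = - (t^-1 - 1)); last by ring.
  have e3 : (cantor_num j)%:R `^ (t^-1 - 1) <= y^-1 `^ (t^-1 - 1).
    by rewrite ge0_ler_powR ?nnegrE ?invr_ge0 ?(ltW y0) ?(ltW mj)//; lra.
  rewrite powRN -[leLHS]invrK lef_pV2 ?posrE ?invr_gt0 ?powR_gt0//.
  by rewrite (le_trans e3)// powRV_pos// powRN.
have key2 : y <= (C * h) `^ t.
  have yE : y = (y `^ t^-1) `^ t by rewrite powRVK// ltW.
  by rewrite [leLHS]yE ge0_ler_powR ?nnegrE ?powR_ge0 ?mulr_ge0 ?(ltW t0) ?(ltW C0).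
have DE : D%:R = 3 * (cantor_num J)%:R * y by rewrite /y mulrC divfK// gt_eqF// mulr_gt0.
rewrite DE (@le_trans _ _ (3 * (cantor_num J)%:R * (C * h) `^ t))//.
  by rewrite ler_pM2l// mulr_gt0.
by rewrite lerDr.
Qed.

End Cantor.

(** * Dimension of the Cantor sets; closed sets that force cyclicity *)

Section CantorSets.
Variable R : realType.
Implicit Types (s e t b p q c eps : R) (i j k J D K M : nat) (E : set R) (f : R -> R[i]).

Lemma size_window (P : pred nat) M (B : R) : 0 <= B ->
  (forall i D, (i + D < M)%N -> P i -> P (i + D)%N -> D%:R <= B) ->
  (count P (iota 0 M))%:R <= B + 1.
Proof.
move=> B0 h; rewrite -size_filter.
have [ex|nex] := pselect (exists i, P i && (i < M)%N); last first.
  rewrite (_ : [seq _ <- _ | _] = [::]) ?addr_ge0//.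
  apply/eqP; rewrite -[_ == _]negbK -has_filter; apply/hasPn => i.
  by rewrite mem_iota add0n /= => iM; apply/negP => Pi; apply: nex; exists i; rewrite Pi.
case: (ex_minnP ex) => i0 /andP[P0 i0M] i0min.
rewrite (@le_trans _ _ (Num.truncn B).+1%:R)//; last by rewrite -natr1 lerD2r; case/andP: (truncn_itv B0).
rewrite ler_nat -[leqRHS](size_iota i0); apply: uniq_leq_size.
  by rewrite filter_uniq// iota_uniq.
move=> i; rewrite mem_filter !mem_iota add0n => /andP[Pi /= iM].
have ii : (i0 <= i)%N by apply: i0min; rewrite Pi.
rewrite ii addnS ltnS -leq_subLR truncn_ge_nat//.
by apply: (h i0) => //; rewrite subnKC.
Qed.

Lemma count_cover (T U : eqType) (Q : T -> pred U) (l : seq T) (r : seq U) :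
  (forall y, y \in r -> exists2 x, x \in l & Q x y) -> (size r <= \sum_(x <- l) count (Q x) r)%N.
Proof.
elim: r => [|y r IH] h //=; rewrite big_split /= -add1n leq_add//.
  have [x xl Qx] := h y (mem_head _ _).
  by rewrite (big_rem x)//= Qx.
by apply: IH => z zr; apply: h; rewrite inE zr orbT.
Qed.

(** Mass distribution: an interval of radius r holds at most 4 + O(N r^t) of the N endpoints of
    stage J. A cover by |l| intervals of small enough content thus accounts for at most 4 |l| + N /
    2 of them, which is less than N because N > J = 8 |l|. *)
Lemma cantor_ncov s (a : nat) t : 0 < s < 1 -> 0 < t < s -> ~ cov t (cantor s a `&` `[0, 2 * pi[).
Proof.
move=> s01 ts cA; have [C C0 hC] := cantor_pt_count a s01 ts; have /andP[t0 t1] := ts.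
have q0 : 0 < (2 * C) `^ t by rewrite powR_gt0// mulr_gt0.
have e0 : 0 < 1 / (6 * (2 * C) `^ t) by rewrite divr_gt0// mulr_gt0.
have [l [l0 lA lS]] := cA _ e0.
pose J := (8 * size l)%N.
pose Q (x : R * R) i := `|cantor_pt s a J i - x.1| <= x.2.
have h1 : (cantor_num J <= \sum_(x <- l) count (Q x) (iota 0 (cantor_num J)))%N.
  rewrite -{1}(size_iota 0 (cantor_num J)); apply: count_cover => i; rewrite mem_iota add0n => /= iJ.
  exact: lA (cantor_pt_fund a s01 iJ).
have m0 : 0 <= (cantor_num J)%:R :> R by [].
have h2 x : x \in l -> (count (Q x) (iota 0 (cantor_num J)))%:R <= 4 + 3 * (cantor_num J)%:R * (2 * C) `^ t * x.2 `^ t.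
  move=> xl; have x0 := l0 x xl.
  have B0 : 0 <= 3 + 3 * (cantor_num J)%:R * (C * (2 * x.2)) `^ t by rewrite addr_ge0 ?mulr_ge0 ?powR_ge0.
  apply: le_trans (size_window B0 _) _.
    move=> i D iD Qi QD; apply: (hC J i) => //; first by rewrite mulr_ge0// ltW.
    move: Qi QD; rewrite /Q !ler_norml => /andP[a1 a2] /andP[a3 a4]; lra.
  rewrite (_ : C * (2 * x.2) = (2 * C) * x.2); last by ring.
  rewrite powRM ?mulr_ge0 ?(ltW C0) ?(ltW x0)// mulrA.
  by lra.
have h3 : (cantor_num J)%:R <= 4 * (size l)%:R + 3 * (cantor_num J)%:R * (2 * C) `^ t * \sum_(x <- l) x.2 `^ t.
  rewrite (@le_trans _ _ (\sum_(x <- l) (count (Q x) (iota 0 (cantor_num J)))%:R))//.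
    by rewrite -natr_sum ler_nat.
  rewrite mulr_sumr (_ : 4 * (size l)%:R = \sum_(x <- l) 4); last first.
    by rewrite big_const_seq count_predT iter_addr_0 mulr_natr.
  by rewrite -big_split /= big_seq [leRHS]big_seq; apply: ler_sum => x xl; exact: h2.
have h4 : 3 * (cantor_num J)%:R * (2 * C) `^ t * \sum_(x <- l) x.2 `^ t <= (cantor_num J)%:R / 2.
  rewrite (le_trans (ler_wpM2l _ lS)) ?mulr_ge0 ?(ltW q0)//.
  by rewrite le_eqVlt; apply/orP; left; apply/eqP; field; rewrite gt_eqF.
have := cantor_num_gt J; rewrite -(ltr_nat R) natrM; lra.
Qed.

Lemma exists_ratio s K : 0 < s -> exists a : nat, K%:R * (2^-1 `^ s) ^+ a <= 1 / 2.
Proof.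
move=> s0; exists (Num.truncn (K.+1%:R / s)).+1.
rewrite -powR_mulrn ?powR_ge0// -powRrM.
rewrite (@le_trans _ _ (K%:R * 2^-1 ^+ K.+1))//.
  rewrite ler_wpM2l// -powR_mulrn ?invr_ge0//; apply: ger_powR; first by rewrite invr_gt0 ltr0n invf_le1 ?ler1n.
  by rewrite mulrC -ler_pdivrMr// ltW// truncnS_gt.
rewrite exprVn ler_pdivrMr ?exprn_gt0// exprS mulrA divfK// mul1r -natrX ler_nat ltnW// ltn_expl//.
Qed.

Lemma cantor_exists s K : 0 < s < 1 -> (0 < K)%N -> exists E,
  [/\ closed_torus E, dimT E = s%:E & forall j, (j < K)%N -> null_set ((1 - s) / 2) (sumset E j)].
Proof.
move=> s01 K0; have /andP[s0 s1] := s01; have [a ha] := exists_ratio K s0.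
have cE := cantor_closed s a.
exists (cantor s a); split=> //.
  apply/eqP; rewrite eq_le (dimT_le s0 (cantor_cov s01 K0 ha)) /=.
  by apply: dimT_ge => // t ts; exact: cantor_ncov.
move=> j jK; apply: (cov_null _ _ (sumset_cov s01 jK ha)); [lra|lra|].
by move=> x; exact: sumset_lift.
Qed.

Lemma null_set0 c : null_set c (set0 : set R).
Proof.
move=> e e0; exists (fun=> 0); split=> //; first exact: contp_cst.
- exact: Lip_cst.
- by exists 1.
move=> F uF; rewrite big1 ?(ltW e0)// => n _.
by rewrite hat_cst mul0r cmod0 expr0n mul0r.
Qed.

Lemma closed_torus0 : closed_torus (set0 : set R).
Proof. by split; [|exact: closed0]. Qed.

Lemma dimT_set0 : dimT (set0 : set R) = 0%E.
Proof.
apply/eqP; rewrite eq_le dimT_ge0 andbT; apply/lee_addgt0Pr => e e0; rewrite add0e.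
by apply: dimT_le => // e' e'0; exists [::]; split=> //; [move=> t []|rewrite big_nil ltW].
Qed.

(** The empty set is null for every c, so c may be taken large enough for the first alternative of
    [dual_sums]. *)
Lemma cyclic_no_zeros p q b f : 1 < p -> q = p / (p - 1) -> 2 < q -> 0 < b -> b * q <= 1 ->
  fun_in_A 1 b f -> zeros f = set0 -> cyclic p b (distr_of_fun f).
Proof.
move=> p1 qE q2 b0 bq /fun_in_A_A1[C fA] z0.
have q0 : 0 < 2 / q by rewrite divr_gt0//; lra.
apply: (cyclic_null (c := 1) (j := 0) p1 qE q2 b0 bq fA) => //.
- by rewrite mul1r; nra.
- have h : 0 <= 2 / q * (1 - b * q) by rewrite mulr_ge0 ?(ltW q0)//; lra.
  by left; rewrite !mulr1; split=> //; lra.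
by rewrite z0; exact: null_set0.
Qed.

(** The two alternatives are those of [dual_sums] with 1 - 2c = s. *)
Lemma cyclic_set p q b s K : 1 < p -> q = p / (p - 1) -> 2 < q -> 0 < b -> b * q <= 1 ->
  0 < s < 1 -> (0 < K)%N -> K%:R * b < 1 / 2 ->
  2 * K%:R < q /\ s < 2 * K%:R / q * (1 - b * q) \/ q <= 2 * K%:R /\ s <= 1 - 2 * K%:R * b ->
  exists E, [/\ closed_torus E, dimT E = s%:E &
    forall f, fun_in_A 1 b f -> zeros f = E -> cyclic p b (distr_of_fun f)].
Proof.
move=> p1 qE q2 b0 bq s01; case: K => // j _ Kb hs.
have [E [cE dE hE]] := cantor_exists s01 (ltn0Sn j).
exists E; split=> // f /fun_in_A_A1[C fA] zE.
apply: (cyclic_null (c := (1 - s) / 2) (j := j) p1 qE q2 b0 bq fA) => //.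
- by case/andP: s01 => _ s1; lra.
- by case: hs => -[h1 h2]; [left|right]; split=> //; lra.
by rewrite zE; exact: hE.
Qed.

(** The first term of the maximum comes from k-fold sums, by interpolation when 2k < q; the second
    from (k + 1)-fold sums, where 2(k + 1) > q and boundedness suffices. *)
Lemma cyclic_sets p q b eps : 1 < p -> q = p / (p - 1) -> 2 < q -> 0 < b -> b * q <= 1 -> 0 < eps ->
  let k : R := (Num.floor (q / 2))%:~R in exists E, [/\ closed_torus E,
    ((Num.max (2 / q * (1 - b * q) * k - eps) (1 - 2 * (k + 1) * b))%:E <= dimT E)%E &
    forall f, fun_in_A 1 b f -> zeros f = E -> cyclic p b (distr_of_fun f)].
Proof.
move=> p1 qE q2 b0 bq eps0 k.
have q0 : 0 < q by lra.
have bq0 : 0 < b * q by rewrite mulr_gt0.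
have [K K0 kE] : exists2 K : nat, (0 < K)%N & k = K%:R.
  have f1 : 1 <= Num.floor (q / 2) by rewrite floor_ge_int; lra.
  exists `|Num.floor (q / 2)|%N; first by move: f1; clear; lia.
  by rewrite /k [in RHS]pmulrn; congr (_%:~R); move: f1; clear; lia.
have kq : 2 * K%:R <= q.
  have := floor_le (q / 2); rewrite -/k kE; lra.
have qk : q < 2 * (K%:R + 1).
  have := floorD1_gt (q / 2); rewrite intrD -/k kE; lra.
have K1 : 1 <= K%:R :> R by rewrite ler1n.
pose D : R := 2 * K%:R / q * (1 - b * q).
have DE : 2 / q * (1 - b * q) * K%:R = D by rewrite /D; ring.
rewrite kE DE; set m := Num.max _ _.
(* A nonpositive lower bound is met by the empty set, whose [dimT] is 0. *)
have [m0|m0] := leP m 0.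
  exists set0; split; [exact: closed_torus0|by rewrite dimT_set0 lee_fin|].
  by move=> f; exact: (cyclic_no_zeros p1 qE q2 b0 bq).
have Dq : D * q = 2 * K%:R * (1 - b * q) by rewrite /D mulrAC divfK// gt_eqF.
have [h|h] := leP (1 - 2 * (K%:R + 1) * b) (D - eps).
  have mE : m = D - eps by rewrite /m max_l.
  rewrite mE in m0; have D0 : 0 < D by lra.
  have bq1 : b * q < 1.
    rewrite lt_neqAle bq andbT; apply: contraTneq D0 => h1; rewrite /D h1 subrr mulr0 ltxx//.
  have D1 : D < 1.
    rewrite -(ltr_pM2r q0) Dq mul1r; nra.
  have [||||E [cE dE hE]] := @cyclic_set p q b m K p1 qE q2 b0 bq; rewrite ?mE//; first lra.
  - nra.
  (* For q = 2k there is nothing to interpolate, and the second alternative applies because D = 1 -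
     b q. *)
  - have [hK|hK] := ltP (2 * K%:R) q; [left|right]; split=> //; first by rewrite -/D; lra.
    have qE2 : q = 2 * K%:R by apply/eqP; rewrite eq_le hK.
    have : D = 1 - b * q by rewrite /D -qE2 divff ?gt_eqF// mul1r.
    by rewrite -qE2 mulrC; lra.
  by exists E; split=> //; rewrite dE mE.
have mE : m = 1 - 2 * (K%:R + 1) * b by rewrite /m max_r// ltW.
rewrite mE in m0.
have K1E : K.+1%:R = K%:R + 1 :> R by rewrite natr1.
have [||||E [cE dE hE]] := @cyclic_set p q b m K.+1 p1 qE q2 b0 bq; rewrite ?mE ?K1E//.
- by rewrite m0 /= gtrDl oppr_lt0 !mulr_gt0//; lra.
- lra.
- by right; split; [exact: ltW|].
by exists E; split=> //; rewrite dE mE.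
Qed.

(** The condition on p means q = 2k, so s^k lies in a weighted l^2 space without interpolation and
    no eps is lost; for b q = 1 the empty set has the required dimension 0. *)
Lemma cyclic_sets_exact p q b k : 1 < p -> q = p / (p - 1) -> 2 < q -> 0 < b -> b * q <= 1 ->
  (0 < k)%N -> p = (2 * k%:R) / (2 * k%:R - 1) -> exists E, [/\ closed_torus E,
    dimT E = (1 - b * q)%:E &
    forall f, fun_in_A 1 b f -> zeros f = E -> cyclic p b (distr_of_fun f)].
Proof.
move=> p1 qE q2 b0 bq k0 pE; have k1 : 1 <= k%:R :> R by rewrite ler1n.
have qk : q = 2 * k%:R.
  rewrite qE pE; field; apply/andP; split; rewrite ?gt_eqF//; lra.
have bq0 : 0 < b * q by rewrite mulr_gt0//; lra.
have [bq1|bq1] := eqVneq (b * q) 1.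
  exists set0; split; [exact: closed_torus0|by rewrite bq1 subrr dimT_set0|].
  by move=> f; exact: (cyclic_no_zeros p1 qE q2 b0 bq).
have bq1' : b * q < 1 by rewrite lt_neqAle bq1.
apply: (@cyclic_set p q b (1 - b * q) k) => //.
- by apply/andP; split; lra.
- by rewrite qk in bq1'; lra.
- by right; rewrite -qk lexx; split=> //; rewrite mulrC.
Qed.

End CantorSets.

Local Close Scope complex_scope.

Theorem theorem3p4 (R : realType) (p q beta : R)
    (hp : 1 < p < 2) (hq : q = p / (p - 1))
    (hbeta : 0 < beta) (hbetaq : beta * q <= 1) :
  [/\ (forall f : R -> R[i],
         fun_in_A 1 beta f ->
         (dimT (zeros f) < (2 / q * (1 - beta * q))%:E)%E ->
         cyclic p beta (distr_of_fun f)),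
      (forall f : R -> R[i],
         fun_in_A 1 beta f ->
         (0 < capacity (1 - beta * q) (zeros f))%E ->
         ~ cyclic p beta (distr_of_fun f)),
      (forall alpha : R,
         2 / q * (1 - beta * q) < alpha -> alpha <= 1 ->
         exists E : set R,
           [/\ closed_torus E, dimT E = alpha%:E &
               forall f : R -> R[i],
                 fun_in_A 1 beta f -> zeros f = E ->
                 ~ cyclic p beta (distr_of_fun f)]) &
      (let k : R := (Num.floor (q / 2))%:~R in
       forall eps : R, 0 < eps ->
         exists E : set R,
           [/\ closed_torus E,
               ((Num.max (2 / q * (1 - beta * q) * k - eps)
                         (1 - 2 * (k + 1) * beta))%:E <= dimT E)%E &
               forall f : R -> R[i],
                 fun_in_A 1 beta f -> zeros f = E ->
                 cyclic p beta (distr_of_fun f)]) /\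
      (forall k : nat, (0 < k)%N -> p = (2 * k%:R) / (2 * k%:R - 1) ->
         exists E : set R,
           [/\ closed_torus E, dimT E = (1 - beta * q)%:E &
               forall f : R -> R[i],
                 fun_in_A 1 beta f -> zeros f = E ->
                 cyclic p beta (distr_of_fun f)])].
Proof.
have /andP[p1 p2] := hp.
have q2 : 2 < q by rewrite hq ltr_pdivlMr; lra.
split; [| | |split].
- by move=> f /fun_in_A_A1[C fA]; exact: cyclic_small_dim fA.
- by move=> f /fun_in_A_A1[C fA]; exact: capacity_not_cyclic fA.
- by move=> alpha; exact: noncyclic_sets.
- by move=> k eps e0; exact: cyclic_sets.
- by move=> k k0 pk; exact: cyclic_sets_exact pk.
Qed.
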